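(* Let $G$ be a benzenoid system with boundary cycle $Z$, and let $|Z|$ denote the number of vertices of $Z$. Then the Szeged index $Sz(G)$ can be computed in $O(|Z|)$ time.
   Context: Let $\mathcal H$ be the hexagonal (graphite) lattice in the plane and $Z$ a cycle in it. The benzenoid system determined by $Z$ is the graph $G$ induced by the vertices and edges of $\mathcal H$ lying on $Z$ and in its interior; $Z$ is called its boundary cycle. The input to the computation is the boundary cycle $Z$ (the cyclic sequence of its vertices in the plane). $d_G$ denotes the shortest-path distance. For an edge $e=uv$ of $G$, let $N_1(e|G)=\{x\in V(G): d_G(x,u)<d_G(x,v)\}$ and $N_2(e|G)=\{x\in V(G): d_G(x,v)<d_G(x,u)\}$. The Szeged index is $Sz(G)=\sum_{e\in E(G)}|N_1(e|G)|\cdot|N_2(e|G)|$. *)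

(* Defs.v *)
From HB Require Import structures.
From mathcomp Require Import all_boot all_order all_algebra finmap.
From mathcomp Require Import all_classical all_reals all_analysis.
Import Order.TTheory GRing.Theory Num.Theory.
Import numFieldNormedType.Exports.

Set Implicit Arguments.
Unset Strict Implicit.
Unset Printing Implicit Defensive.

Local Open Scope classical_set_scope.
Local Open Scope ring_scope.

(* An undirected graph.  Each edge uv is listed once in [edges], as one of
   the two pairs (u, v), (v, u); adjacency forgets the choice. *)
Record graph (T : Type) := Graph { vertices : set T; edges : set (T * T) }.

Section Szeged.
Variables (T : choiceType) (G : graph T).

Definition adjacent : rel T :=
  fun u v => `[< edges G (u, v) \/ edges G (v, u) >].

Definition walk (n : nat) (x y : T) : Prop :=
  exists p : seq T, [/\ path adjacent x p, last x p = y & size p = n].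

(* The value is 0, and meaningless, if no walk joins x to y. *)
Definition dist (x y : T) : nat :=
  xget 0%N [set n | walk n x y /\ forall m, walk m x y -> (n <= m)%N].

Definition N1 (e : T * T) : set T :=
  [set x | vertices G x /\ (dist x e.1 < dist x e.2)%N].

Definition N2 (e : T * T) : set T :=
  [set x | vertices G x /\ (dist x e.2 < dist x e.1)%N].

(* [fset_set A] is the finite set with the elements of A when A is finite,
   as is the case for the sets below if G is a finite graph. *)
Definition Szeged : nat :=
  (\sum_(e <- fset_set (edges G))
     #|` fset_set (N1 e)| * #|` fset_set (N2 e)|)%N.

End Szeged.

(* The pair (a, b) stands for the point a e1 + b e2 of the triangular lattice,
   where e1 and e2 are unit vectors at angle pi / 3.  The points with
   a = b mod 3 are the centres of the hexagons, the others are the vertices of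
   the hexagonal lattice.  The latter is bipartite, with colour classes
   a - b = 1 and a - b = 2 mod 3; [hex_edge] goes from the former class to the
   latter, so that it relates the two ends of each edge in one order only. *)
Definition hex_point : Type := int * int.

Definition hex_vertex (u : hex_point) : bool := (u.1 - u.2 != 0 %[mod 3])%Z.

Definition hex_edge (u v : hex_point) : bool :=
  (u.1 - u.2 == 1 %[mod 3])%Z &&
  ((v.1 - u.1, v.2 - u.2) \in [:: (1, 0); (0, -1); (-1, 1)]).

Definition hex_adjacent (u v : hex_point) : bool := hex_edge u v || hex_edge v u.

(* The second condition excludes the empty sequence and the closed walk which
   goes through one edge and back. *)
Definition hex_cycle (Z : seq hex_point) : Prop :=
  ucycle hex_adjacent Z /\ (2 < size Z)%N.

Section Plane.
Variable R : realType.

Definition plane_point (u : hex_point) : R * R :=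
  (u.1%:~R + u.2%:~R / 2, u.2%:~R * (Num.sqrt 3 / 2)).

Definition plane_segment (u v : hex_point) : set (R * R) :=
  [set ((1 - t) * (plane_point u).1 + t * (plane_point v).1,
        (1 - t) * (plane_point u).2 + t * (plane_point v).2) | t in `[0, 1]].

Definition plane_curve (Z : seq hex_point) : set (R * R) :=
  \bigcup_(u in [set` Z]) plane_segment u (next Z u).

Definition plane_interior (Z : seq hex_point) : set (R * R) :=
  [set p | (~` plane_curve Z) p /\
           bounded_set (connected_component (~` plane_curve Z) p)].

Definition plane_region (Z : seq hex_point) : set (R * R) :=
  plane_curve Z `|` plane_interior Z.

Definition benzenoid (Z : seq hex_point) : graph hex_point := {|
  vertices := [set u | hex_vertex u /\ plane_region Z (plane_point u)];
  edges := [set e | hex_edge e.1 e.2 /\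
                    plane_segment e.1 e.2 `<=` plane_region Z] |}.

End Plane.

Local Close Scope ring_scope.

(* A random access machine with structured control: integer registers, a memory
   addressed by natural numbers, integer arithmetic.  Comparisons give 0 or 1,
   and a test succeeds when its value is not 0. *)
Inductive binop := Plus | Minus | Times | Quot | Less | Equal.

Inductive expr :=
| Const of int
| Reg of nat
| Read of expr
| Bin of binop & expr & expr.

Inductive cmd :=
| Skip
| Assign of nat & expr
| Write of expr & expr
| Seq of cmd & cmd
| If of expr & cmd & cmd
| While of expr & cmd.

Record state := State { register : nat -> int; memory : nat -> int }.

Definition set_register (s : state) (r : nat) (v : int) : state :=
  State (fun i => if i == r then v else register s i) (memory s).

Definition set_memory (s : state) (a : nat) (v : int) : state :=
  State (register s) (fun i => if i == a then v else memory s i).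

Definition eval_binop (o : binop) (x y : int) : int :=
  match o with
  | Plus => (x + y)%R
  | Minus => (x - y)%R
  | Times => (x * y)%R
  | Quot => (x %/ y)%Z
  | Less => Posz (x < y)%R
  | Equal => Posz (x == y)
  end.

(* The result of an operation must fit in a machine word, that is, be at most B
   in absolute value; otherwise the machine is stuck, as it is on a negative
   address. *)
Definition word (B : nat) (v : int) : option int :=
  if `|v|%N <= B then Some v else None.

Fixpoint value (B : nat) (s : state) (e : expr) : option int :=
  match e with
  | Const v => word B v
  | Reg r => Some (register s r)
  | Read a => if value B s a is Some (Posz i) then Some (memory s i) else None
  | Bin o e1 e2 =>
      match value B s e1, value B s e2 with
      | Some v1, Some v2 => word B (eval_binop o v1 v2)
      | _, _ => None
      end
  end.

Fixpoint cost (e : expr) : nat :=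
  match e with
  | Const _ | Reg _ => 1
  | Read a => (cost a).+1
  | Bin _ e1 e2 => (cost e1 + cost e2).+1
  end.

(* [exec B c s t s']: with words bounded by B, the command c started in the
   state s terminates after t units of time in the state s'. *)
Inductive exec (B : nat) : cmd -> state -> nat -> state -> Prop :=
| ExecSkip s : exec B Skip s 1 s
| ExecAssign r e s v :
    value B s e = Some v ->
    exec B (Assign r e) s (cost e).+1 (set_register s r v)
| ExecWrite a e s i v :
    value B s a = Some (Posz i) -> value B s e = Some v ->
    exec B (Write a e) s (cost a + cost e).+1 (set_memory s i v)
| ExecSeq c1 c2 s s1 s2 t1 t2 :
    exec B c1 s t1 s1 -> exec B c2 s1 t2 s2 ->
    exec B (Seq c1 c2) s (t1 + t2) s2
| ExecIf e c1 c2 s s1 v t :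
    value B s e = Some v -> exec B (if v != Posz 0 then c1 else c2) s t s1 ->
    exec B (If e c1 c2) s (cost e + t).+1 s1
| ExecWhileStop e c s :
    value B s e = Some (Posz 0) -> exec B (While e c) s (cost e).+1 s
| ExecWhileLoop e c s s1 s2 v t1 t2 :
    value B s e = Some v -> v != Posz 0 ->
    exec B c s t1 s1 -> exec B (While e c) s1 t2 s2 ->
    exec B (While e c) s (cost e + t1 + t2).+1 s2.

(* The input is in the first cells of the memory and its length is in register
   0; all the rest is 0. *)
Definition init (xs : seq int) : state :=
  State (fun r => if r == 0 then Posz (size xs) else Posz 0) (fun i => nth (Posz 0) xs i).

Definition magnitude (xs : seq int) : nat :=
  size xs + \max_(x <- xs) `|x|%N.

(* The function f is computed in time O(T), the result being left in register 0,
   on the inputs that satisfy P.  Words are polynomially bounded in the length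
   and the entries of the input, i.e. they have logarithmically many bits:
   without such a bound, multiplication in unit time would not be a reasonable
   measure of cost. *)
Definition computable_in_time (I : Type) (P : I -> Prop) (encode : I -> seq int)
    (f : I -> int) (T : I -> nat) : Prop :=
  exists (c : cmd) (C k : nat), forall x : I, P x ->
    exists (t : nat) (s : state),
      [/\ exec (magnitude (encode x) ^ k) c (init (encode x)) t s,
          t <= C * T x
        & register s 0 = f x].

Definition encode_cycle (Z : seq hex_point) : seq int :=
  flatten [seq [:: u.1; u.2] | u <- Z].

(* Main.v *)
(** A cut is a maximal row of hexagons of G glued along parallel edges; these
    edges partition the edges of G.  Both ends of a cut are edges of Z, and the
    sides of the cut are the sets N_1(e) and N_2(e) of each of its edges e: a path
    in G from one side to the other crosses the cut, and along the cut the distance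
    of G is that of the lattice.  Hence Sz(G) is the sum over all cuts of
    l m (N - m), where l is the number of edges of the cut, m the number of vertices
    on one side and N = |V(G)|.

    Consider the cuts of one direction, say through horizontal edges.  Without
    these edges G is a union of zigzag chains with ends on Z, and the heights of
    the vertices of a chain are consecutive.  So a chain is counted by the height
    of its upper end, plus 1, minus the height of its lower end, and m is the sum
    of such weights over the vertices of Z on one side of the cut, which form an
    arc: it is a difference of two prefix sums.  The two ends of a cut are found by
    sweeping the edges of Z by increasing height (a bucket sort): in each column
    the edges alternately open and close a cut.

    A hexagon is inside Z when an odd number of edges of Z lie below it in its
    column.  That this and the sides of a cut are well defined comes from identities
    modulo 2 which hold for each edge of Z separately, and telescope along Z. *)

From Pilot Require Import Defs.
From mathcomp Require Import all_boot all_order all_algebra finmap.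
From mathcomp Require Import all_classical all_reals all_analysis.
From mathcomp Require Import zify ring lra.
Import Order.TTheory GRing.Theory Num.Theory.
Import numFieldNormedType.Exports.
(* [adjacent] is also the name of a lemma of mathcomp-analysis. *)
Import Pilot.Defs.

Set Implicit Arguments.
Unset Strict Implicit.
Unset Printing Implicit Defensive.

Local Open Scope ring_scope.

(** * The hexagonal lattice *)

(** The region may contain on the order of |Z|^2 hexagons, so the program cannot list the vertices
    of G: it reads Z alone, and every count has to be a sum over Z. The definition of G speaks of
    connected components in the real plane. The parity [inside] on hexagons replaces it; it is
    matched with the components by showing that the inside hexagons fill a clopen part of a
    component, while the outside ones can be joined to infinity. The orientation of Z is not given,
    yet the weights of the vertices depend on it: prefix sums are kept for both orientations, and
    the sign of the total tells which one is right. Only the cuts through horizontal edges are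
    studied; a rotation by 2 pi / 3 gives the other directions, but [inside] is defined by vertical
    columns, so that its invariance has to be proved. The bucket sort is linear because the heights
    along Z stay within n of the first one; the memory starts at 0, so each direction uses fresh
    arrays. *)

Lemma hex_edge_cases (u v : hex_point) : hex_edge u v ->
  modz (u.1 - u.2) 3 = 1 /\
    [\/ v = (u.1 + 1, u.2), v = (u.1, u.2 - 1) | v = (u.1 - 1, u.2 + 1)].
Proof.
case: u v => [a b] [c d]; rewrite /hex_edge !inE !xpair_eqE /=.
move=> /andP[/eqP h] /or3P[] /andP[/eqP h1 /eqP h2]; (split; first by lia).
- by apply: Or31; congr pair; lia.
- by apply: Or32; congr pair; lia.
- by apply: Or33; congr pair; lia.
Qed.

Lemma hex_adjacent_cases (u v : hex_point) : hex_adjacent u v ->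
  (modz (u.1 - u.2) 3 = 1 /\
    [\/ v = (u.1 + 1, u.2), v = (u.1, u.2 - 1) | v = (u.1 - 1, u.2 + 1)]) \/
  (modz (u.1 - u.2) 3 = 2 /\
    [\/ v = (u.1 - 1, u.2), v = (u.1, u.2 + 1) | v = (u.1 + 1, u.2 - 1)]).
Proof.
case/orP => /hex_edge_cases; [by left|case: u v => [a b] [c d] /= [h h']; right].
split; first by case: h' => -[-> ->]; lia.
by case: h' => -[-> ->]; [apply: Or31|apply: Or32|apply: Or33]; congr pair; lia.
Qed.

Ltac adj_cases h := case: (hex_adjacent_cases h) => -[+ []] ->.

Ltac bool_step b :=
  let e := fresh in
  first [ have e : b = false by lia
        | have e : b = true by lia
        | case e : b ];
  rewrite ?e.

(** For Boolean identities between integer comparisons: each comparison is decided by [lia] when the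
    context suffices, and split otherwise. *)
Ltac bool_solve :=
  repeat (cbn [addb andb orb negb];
    match goal with
    | |- context [@eq_op ?T ?x ?y] => bool_step (@eq_op T x y)
    | |- context [@Order.le ?d ?T ?x ?y] => bool_step (@Order.le d T x y)
    | |- context [@Order.lt ?d ?T ?x ?y] => bool_step (@Order.lt d T x y)
    end);
  cbn [addb andb orb negb]; try reflexivity.

Lemma hex_adjacent_sym : symmetric hex_adjacent.
Proof. by move=> u v; rewrite /hex_adjacent orbC. Qed.

(* The centre of the hexagon on the left of the edge from u to v. *)
Definition lhex (u v : hex_point) : hex_point :=
  (u.1 + u.2 - v.2, v.1 + v.2 - u.1).

Definition same_edge (u v x y : hex_point) : bool :=
  ((u == x) && (v == y)) || ((u == y) && (v == x)).

(** Twice the abscissa of a lattice point is [2 * a + b], so the second condition puts the midpoint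
    of a horizontal edge uv on the vertical line through c. *)
Definition rung_below (c u v : hex_point) : bool :=
  [&& u.2 == v.2, u.1 + v.1 + u.2 == 2 * c.1 + c.2 & u.2 < c.2].

(** Twice the abscissa of a vertex is 1 or 2 modulo 3, and its quotient by 3 numbers the vertical
    zigzag chains. So x lies on the chain of the slanted edge uv, below this edge. *)
Definition chain_below (u v x : hex_point) : bool :=
  [&& u.2 != v.2, divz (2 * x.1 + x.2) 3 == divz (2 * u.1 + u.2) 3,
      x.2 <= u.2 & x.2 <= v.2].

(** If uv is horizontal, its two hexagons share a column and only uv itself is counted for just one
    of them. If uv is slanted, the edges leaving the part of its chain below uv are uv and the
    horizontal edges below one of the two hexagons; xy is such an edge exactly when one of its ends
    is on that part. *)
Lemma rung_below_edge_step (u v x y : hex_point) : hex_edge u v -> hex_edge x y ->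
  (rung_below (lhex u v) x y (+) rung_below (lhex v u) x y)
    (+) same_edge u v x y
  = chain_below u v x (+) chain_below u v y.
Proof.
move=> /hex_edge_cases[h1 huv] /hex_edge_cases[h2 hxy].
case: u x h1 h2 huv hxy => [a b] [c d] /= h1 h2.
case=> ->; case=> ->;
rewrite /rung_below /same_edge /chain_below /lhex !xpair_eqE /=.
all: bool_solve.
Qed.

Lemma rung_belowC c x y : rung_below c x y = rung_below c y x.
Proof.
rewrite /rung_below [y.2 == x.2]eq_sym; case: eqP => //= ->.
by rewrite [x.1 + y.1]addrC.
Qed.

Lemma same_edgeC u v x y : same_edge u v x y = same_edge v u x y.
Proof. by rewrite /same_edge orbC andbC [X in _ || X]andbC. Qed.

Lemma same_edgeCr u v x y : same_edge u v x y = same_edge u v y x.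
Proof. by rewrite /same_edge orbC. Qed.

Lemma chain_belowC u v x : hex_edge u v -> chain_below u v x = chain_below v u x.
Proof.
move=> /hex_edge_cases[+ huv]; rewrite /chain_below [v.2 == u.2]eq_sym.
case: (eqVneq u.2 v.2) => //= nuv h.
have -> : divz (2 * v.1 + v.2) 3 = divz (2 * u.1 + u.2) 3.
  by case: huv nuv => -> /= nuv; lia.
by congr (_ && _); rewrite andbC.
Qed.

Lemma rung_below_step (u v x y : hex_point) :
  hex_adjacent u v -> hex_adjacent x y ->
  (rung_below (lhex u v) x y (+) rung_below (lhex v u) x y)
    (+) same_edge u v x y
  = chain_below u v x (+) chain_below u v y.
Proof.
have half u' v' : hex_edge u' v' -> hex_adjacent x y ->
    (rung_below (lhex u' v') x y (+) rung_below (lhex v' u') x y)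
      (+) same_edge u' v' x y = chain_below u' v' x (+) chain_below u' v' y.
  move=> uv /orP[xy|yx]; first exact: rung_below_edge_step.
  rewrite ![rung_below _ x y]rung_belowC same_edgeCr [RHS]addbC.
  exact: rung_below_edge_step.
move=> /orP[uv|vu]; first exact: half.
move=> xy; rewrite [X in X (+) _]addbC same_edgeC (half v u) //.
by rewrite !(chain_belowC _ vu).
Qed.

Lemma addb_telescope (g t : nat -> bool) (i j : nat) : (i <= j)%N ->
  (forall k, (i <= k < j)%N -> g k = t k (+) t k.+1) ->
  \big[addb/false]_(i <= k < j) g k = t i (+) t j.
Proof.
move=> ij h.
suff H d : (i + d <= j)%N ->
    \big[addb/false]_(i <= k < i + d) g k = t i (+) t (i + d)%N.
  by rewrite -(subnKC ij) H // subnKC.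
elim: d => [|d IH] hd; first by rewrite addn0 big_geq // addbb.
rewrite addnS big_nat_recr ?leq_addr //= IH; last by lia.
rewrite h; last by lia.
by case: (t _) (t _) (t _) => [] [] [].
Qed.

(** * Lattice cycles and their inside *)

(** A periodic sequence spares the wrap-around at the end of a list: [z k.+1] and [z k.+2] make
    sense for every k. *)
Record lattice_cycle (z : nat -> hex_point) (n : nat) : Prop := {
  cycle_gt2 : (2 < n)%N;
  cycle_period : forall k, z (k + n)%N = z k;
  cycle_adj : forall k, hex_adjacent (z k) (z k.+1);
  cycle_inj : forall k l, (k < n)%N -> (l < n)%N -> z k = z l -> k = l }.

Definition on_cycle (z : nat -> hex_point) (n : nat) (u : hex_point) : bool :=
  [exists k : 'I_n, u == z k].

Definition cycle_edge (z : nat -> hex_point) (n : nat) (u v : hex_point) : bool :=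
  [exists k : 'I_n, same_edge u v (z k) (z k.+1)].

(* Meaningful only if c is the centre of a hexagon. *)
Definition inside (z : nat -> hex_point) (n : nat) (c : hex_point) : bool :=
  \big[addb/false]_(0 <= k < n) rung_below c (z k) (z k.+1).

Section Cycle.
Variables (z : nat -> hex_point) (n : nat).
Hypothesis Hz : lattice_cycle z n.

Lemma cycle_gt0 : (0 < n)%N.
Proof. by have := cycle_gt2 Hz; lia. Qed.

Lemma cycle_mod k : z (k %% n) = z k.
Proof.
rewrite {2}(divn_eq k n); elim: (k %/ n)%N => [|m IH]; first by rewrite mul0n.
by rewrite mulSn -addnA addnC (cycle_period Hz).
Qed.

Lemma cycle_eq k l : z k = z l -> k = l %[mod n].
Proof.
rewrite -(cycle_mod k) -(cycle_mod l) => /(cycle_inj Hz); apply.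
  exact: ltn_pmod cycle_gt0.
exact: ltn_pmod cycle_gt0.
Qed.

Lemma cycle_eq_mod k l : k = l %[mod n] -> z k = z l.
Proof. by move=> h; rewrite -(cycle_mod k) h cycle_mod. Qed.

Lemma cycle_neq_add k d : (0 < d < 3)%N -> z k != z (k + d)%N.
Proof.
move=> hd; apply/eqP => /cycle_eq /esym /eqP.
rewrite eqn_mod_dvd ?leq_addr // addKn => /dvdn_leq.
by have := cycle_gt2 Hz; lia.
Qed.

Lemma cycle_neq2 k : z k != z k.+2.
Proof. by rewrite -addn2 cycle_neq_add. Qed.

Lemma on_cycleP u : reflect (exists k, u = z k) (on_cycle z n u).
Proof.
apply: (iffP existsP) => [[k /eqP ->]|[k ->]]; first by exists k.
by exists (Ordinal (ltn_pmod k cycle_gt0)); rewrite /= cycle_mod.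
Qed.

Lemma on_cycle_z k : on_cycle z n (z k).
Proof. by apply/on_cycleP; exists k. Qed.

Lemma cycle_edgeP u v :
  reflect (exists k, (u = z k /\ v = z k.+1) \/ (v = z k /\ u = z k.+1))
          (cycle_edge z n u v).
Proof.
have cs k : z (k %% n).+1 = z k.+1.
  by apply: cycle_eq_mod; rewrite -addn1 modnDml addn1.
apply: (iffP existsP) => [[k]|[k h]].
  case/orP => /andP[/eqP -> /eqP ->]; exists k; [left|right]; by [].
exists (Ordinal (ltn_pmod k cycle_gt0)); rewrite /same_edge /= cycle_mod cs.
by case: h => -[-> ->]; rewrite !eqxx // orbT.
Qed.

Lemma cycle_edgeC u v : cycle_edge z n u v = cycle_edge z n v u.
Proof. by apply: eq_existsb => k; rewrite same_edgeC. Qed.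

Lemma cycle_edge_z k : cycle_edge z n (z k) (z k.+1).
Proof. by apply/cycle_edgeP; exists k; left. Qed.

Lemma cycle_edge_adj u v : cycle_edge z n u v -> hex_adjacent u v.
Proof.
case/cycle_edgeP => k [] [-> ->]; have := cycle_adj Hz k => //.
by rewrite hex_adjacent_sym.
Qed.

Lemma same_edge_inj k l : (k < n)%N -> (l < n)%N ->
  same_edge (z k) (z k.+1) (z l) (z l.+1) -> k = l.
Proof.
move=> kn ln; case/orP => /andP[/eqP h1 /eqP h2]; first exact: (cycle_inj Hz).
have : z k = z k.+2.
  rewrite h1; apply: cycle_eq_mod; move/cycle_eq: h2 => h2.
  by rewrite -addn1 -[k.+2]addn1 -modnDml -h2 modnDml.
by move/eqP; rewrite (negPf (cycle_neq2 k)).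
Qed.

Lemma cycle_edge_sum u v :
  \big[addb/false]_(0 <= k < n) same_edge u v (z k) (z k.+1)
    = cycle_edge z n u v.
Proof.
have [/existsP[k hk]|/existsPn h] := boolP (cycle_edge z n u v).
  rewrite big_mkord (bigD1 k) //= hk big1 // => l lk; apply/negP => hl.
  case/negP: lk; apply/eqP/val_inj => /=; apply: same_edge_inj => //.
  move: hk hl; rewrite /same_edge.
  by do 2!case/orP => /andP[/eqP -> /eqP ->]; rewrite !eqxx ?orbT.
by rewrite big_mkord big1 // => k _; apply: negbTE; apply: h.
Qed.

Lemma inside_step (u v : hex_point) : hex_adjacent u v ->
  inside z n (lhex u v) (+) inside z n (lhex v u) = cycle_edge z n u v.
Proof.
move=> huv; rewrite -cycle_edge_sum /inside.
set S := \big[addb/false]_(0 <= k < n) same_edge _ _ _ _.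
apply: (can_inj (addbK S)); rewrite addbb /S -!big_split /=.
rewrite (addb_telescope (t := fun k => chain_below u v (z k))) //; last first.
  by move=> k _; rewrite rung_below_step // (cycle_adj Hz).
by rewrite -(cycle_period Hz 0) addbb.
Qed.

Lemma cycle_bounded : exists m : int, 0 <= m /\ forall k,
  `|(z k).1| <= m /\ `|(z k).2| <= m.
Proof.
exists (\sum_(k < n) (`|(z k).1| + `|(z k).2|)); split; first by apply: sumr_ge0 => k _;
  lia.
move=> k; rewrite -(cycle_mod k); have kn := ltn_pmod k cycle_gt0.
rewrite (bigD1 (Ordinal kn)) //=.
set s := \sum_(_ < _ | _) _.
have : 0 <= s by apply: sumr_ge0 => j _; lia.
by lia.
Qed.

End Cycle.

(** * Turns along the cycle, and the Jordan curve theorem for hexagons *)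

Definition hex_centre (c : hex_point) : Prop := modz (c.1 - c.2) 3 = 0.

(** The three neighbours of a lattice vertex c sum to 3 c. *)
Definition third_neighbour (p c q : hex_point) : hex_point :=
  (3 * c.1 - p.1 - q.1, 3 * c.2 - p.2 - q.2).

(* 1 for a turn to the left, - 1 for a turn to the right. *)
Definition turn (p c q : hex_point) : int :=
  (c.1 - p.1) * (q.2 - c.2) - (c.2 - p.2) * (q.1 - c.1).

Lemma lhex_centre u v : hex_adjacent u v -> hex_centre (lhex u v).
Proof.
move=> h; adj_cases h; case: u {h} => a b /=; rewrite /hex_centre /lhex /=; lia.
Qed.

(** Each of the three hexagons at c contains two of the three edges at c. At a left turn the edges
    pc and cq share the hexagon on their left, and the spoke separates the two on their right; at a
    right turn the roles are exchanged. *)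
Lemma turn_cases p c q : hex_adjacent p c -> hex_adjacent c q -> p != q ->
  let s := third_neighbour p c q in
  hex_adjacent c s /\
  ((turn p c q = 1 /\
    [/\ lhex p c = lhex c q, lhex q c = lhex c s & lhex s c = lhex c p]) \/
   (turn p c q = -1 /\
    [/\ lhex p c = lhex c s, lhex s c = lhex c q & lhex q c = lhex c p])).
Proof.
rewrite hex_adjacent_sym => hp hq; adj_cases hp; adj_cases hq;
  case: c {hp hq} => [a b] /=;
  rewrite /turn /lhex /third_neighbour /hex_adjacent /hex_edge xpair_eqE !inE !xpair_eqE
    /= => h1 h2 pq; try lia.
all: split; first by lia.
all: try by left; do !split; try congr pair; lia.
all: by right; do !split; try congr pair; lia.
Qed.

Section Inside.
Variables (z : nat -> hex_point) (n : nat).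
Hypothesis Hz : lattice_cycle z n.
Lemma inside_rung c : inside z n c ->
  exists2 k, (k < n)%N & rung_below c (z k) (z k.+1).
Proof.
move=> h; apply: contrapT => hn; move: h; rewrite /inside big1_seq // => k.
rewrite mem_index_iota => /andP[_ kn]; apply: negbTE; apply/negP => hk.
by apply: hn; exists k.
Qed.

Local Notation inside := (inside z n).
Local Notation cedge := (cycle_edge z n).

(** An inside hexagon has an edge of Z below it in its column, which bounds it in all directions but
    upwards. Above Z, shifting a hexagon by (-2, 1) into the next column on the left crosses no edge
    of Z, so the parity would be the same in a column beyond Z. *)
Lemma inside_bounded : exists m : int, 0 <= m /\
  forall c, hex_centre c -> inside c -> `|c.1| <= m /\ `|c.2| <= m.
Proof.
have [m [m0 hm]] := cycle_bounded Hz; exists (3 * m); split; first by lia.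
have up c (j : nat) : hex_centre c -> m < c.2 ->
    inside (c.1 - j%:Z * 2, c.2 + j%:Z) = inside c.
  move=> hc mc; elim: j => [|j IH]; first by case: c {hc mc} => a b /=; congr inside;
    congr pair; lia.
  pose u : hex_point := (c.1 - j%:Z * 2 - 1, c.2 + j%:Z).
  pose v : hex_point := (c.1 - j%:Z * 2 - 1, c.2 + j%:Z + 1).
  have uv : hex_adjacent u v.
    by move: hc; rewrite /hex_centre /hex_adjacent /hex_edge /u /v !inE !xpair_eqE /=; lia.
  have := inside_step Hz uv.
  have -> : lhex u v = (c.1 - j.+1%:Z * 2, c.2 + j.+1%:Z).
    by rewrite /lhex /u /v /=; congr pair; lia.
  have -> : lhex v u = (c.1 - j%:Z * 2, c.2 + j%:Z).
    by rewrite /lhex /u /v /=; congr pair; lia.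
  have -> : cedge u v = false.
    apply: negbTE; apply/negP => /(cycle_edgeP Hz)[k]; have := hm k; have := hm k.+1.
    move=> [_ h1] [_ h2] [] [h3 _]; move: h1 h2; rewrite -h3 /u /v /=; lia.
  by rewrite IH; case: (inside _) (inside _) => [] [].
move=> c hc hin.
have [k _ /and3P[/eqP h1 /eqP h2 h3]] := inside_rung hin.
have [hk1 hk2] := hm k; have [hk3 hk4] := hm k.+1.
have [mc|] := ltP m c.2; last by lia.
(* Each shift lowers [2 * c.1 + c.2] by 3, while the columns of the edges of Z are at least - 3
   m. *)
have := up c `|(2 * c.1 + c.2 + 3 * m + 1)%R|%N hc mc;
  rewrite hin => /inside_rung[k' _ /and3P[_ /eqP]].
have [hk5 hk6] := hm k'; have [hk7 hk8] := hm k'.+1.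
by move=> /=; lia.
Qed.

(* The third edge at a vertex of the cycle is its spoke. *)
Lemma not_spoke_edge k :
  cedge (z k.+1) (third_neighbour (z k) (z k.+1) (z k.+2)) = false.
Proof.
set s := third_neighbour _ _ _.
have [_ hs] := turn_cases (cycle_adj Hz k) (cycle_adj Hz k.+1) (cycle_neq2 Hz k).
apply: negbTE; apply/negP => /(cycle_edgeP Hz)[l [] [h1 h2]].
  have h : z k.+2 = z l.+1.
    apply: (cycle_eq_mod Hz); move/(cycle_eq Hz): h1 => h1.
    by rewrite -addn1 -[l.+1]addn1 -modnDml h1 modnDml.
  move: hs; rewrite -/s h2 -h.
  case: (z k) (z k.+1) (z k.+2) => [a b] [c d] [e f]; rewrite /lhex /turn /=.
  by case=> [[? [[] ? ? [] ? ? [] ? ?]]|[? [[] ? ? [] ? ? [] ? ?]]]; lia.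
have h : z k = z l.
  apply: (cycle_eq_mod Hz); move/(cycle_eq Hz): h2 => /eqP.
  by rewrite -[k.+1]addn1 -[l.+1]addn1 eqn_modDr => /eqP.
move: hs; rewrite -/s h1 -h.
case: (z k) (z k.+1) (z k.+2) => [a b] [c d] [e f]; rewrite /lhex /turn /=.
by case=> [[? [[] ? ? [] ? ? [] ? ?]]|[? [[] ? ? [] ? ? [] ? ?]]]; lia.
Qed.

Lemma inside_left k : inside (lhex (z k) (z k.+1)) = inside (lhex (z 0) (z 1)).
Proof.
elim: k => // k <-.
have [hs] := turn_cases (cycle_adj Hz k) (cycle_adj Hz k.+1) (cycle_neq2 Hz k).
have hi := inside_step Hz hs; move: hi; rewrite not_spoke_edge => hi.
case=> [[_ [-> _ _]]|[_ [-> h _]]] //.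
by move: hi; rewrite h; case: (inside _) (inside _) => [] [].
Qed.

Lemma inside_right k : inside (lhex (z k.+1) (z k)) = ~~ inside (lhex (z 0) (z 1)).
Proof.
have := inside_step Hz (cycle_adj Hz k); rewrite cycle_edge_z // inside_left.
by case: (inside _) (inside _) => [] [].
Qed.

(** With [o] telling whether the inside lies to the left of Z, this is the hexagon on the outer side
    of the edge k. *)
Definition outer (o : bool) (k : nat) : hex_point :=
  if o then lhex (z k.+1) (z k) else lhex (z k) (z k.+1).

Let o := inside (lhex (z 0) (z 1)).

Lemma inside_outer k : inside (outer o k) = false.
Proof.
rewrite /outer; have := inside_right k; have := inside_left k.
by rewrite -/o; case: (o) => h1 h2; rewrite ?h1 ?h2.
Qed.

Lemma outer_edge u v : cedge u v -> ~~ inside (lhex u v) ->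
  exists k, lhex u v = outer o k.
Proof.
case/(cycle_edgeP Hz) => k uv h; exists k; move: h.
have := inside_right k; have := inside_left k; rewrite -/o /outer.
by case: uv => -[-> ->]; case: (o) => h1 h2; rewrite ?h1 ?h2.
Qed.

Section Escape.
Variable H : hex_point -> Prop.
Hypothesis Hcross : forall u v, hex_adjacent u v -> ~~ cedge u v ->
  H (lhex u v) -> H (lhex v u).

(** [H] is any set of hexagons closed under crossing edges that are not in Z. The outer hexagons of
    consecutive edges coincide or share a spoke, which is not in Z. *)
Lemma escape_outer k l : H (outer o k) -> H (outer o l).
Proof.
have step j : H (outer o j) <-> H (outer o j.+1).
  have [hs] := turn_cases (cycle_adj Hz j) (cycle_adj Hz j.+1) (cycle_neq2 Hz j).
  have hc := not_spoke_edge j.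
  have hs' := hs; rewrite hex_adjacent_sym in hs'.
  have := Hcross hs; have := Hcross hs'; rewrite cycle_edgeC hc => /(_ isT) h1 /(_ isT) h2.
  rewrite /outer; case=> [[_ [e1 e2 e3]]|[_ [e1 e2 e3]]]; case: (o) => //.
  - by rewrite e2 -e3; split.
  - by rewrite e1.
  - by rewrite e3.
  - by rewrite e1 -e2; split.
have all0 j : H (outer o j) <-> H (outer o 0) by elim: j => // j IH; apply: iff_trans IH;
  apply: iff_sym.
by move=> /all0 h; apply/all0.
Qed.

Lemma escape_down c : hex_centre c -> H c ->
  (forall k, ~~ rung_below c (z k) (z k.+1)) ->
  forall B : int, exists c', [/\ hex_centre c', H c' & c'.2 < B].
Proof.
move=> hc Hc nr B.
have down j : H (c.1 + j%:Z, c.2 - j%:Z * 2).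
  elim: j => [|j IH]; first by rewrite mul0r subr0 addr0 -surjective_pairing.
  pose u : hex_point := (c.1 + j%:Z, c.2 - j%:Z * 2 - 1).
  pose v : hex_point := (c.1 + j%:Z + 1, c.2 - j%:Z * 2 - 1).
  have uv : hex_adjacent u v.
    by move: hc; rewrite /hex_centre /hex_adjacent /hex_edge /u /v !inE !xpair_eqE /=; lia.
  have := Hcross uv.
  have -> : lhex v u = (c.1 + j.+1%:Z, c.2 - j.+1%:Z * 2).
    by rewrite /lhex /u /v /=; congr pair; lia.
  have -> : lhex u v = (c.1 + j%:Z, c.2 - j%:Z * 2).
    by rewrite /lhex /u /v /=; congr pair; lia.
  apply => //; apply/negP => /(cycle_edgeP Hz)[k hk].
  by have := nr k; rewrite /rung_below; case: hk => -[<- <-]; rewrite /u /v /=; lia.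
exists (c.1 + `|(c.2 - B)%R|%N.+1%:Z, c.2 - `|(c.2 - B)%R|%N.+1%:Z * 2); split => //=;
  last by lia.
by move: hc; rewrite /hex_centre /=; lia.
Qed.

(** Going straight down from an outside hexagon, the path either meets an edge of Z, and does so
    from its outer side, or leads below Z. *)
Lemma escape_to_cycle c : hex_centre c -> H c -> ~~ inside c ->
  (exists k, H (outer o k)) \/
  forall B : int, exists c', [/\ hex_centre c', H c' & c'.2 < B].
Proof.
have [m [m0 hm]] := cycle_bounded Hz.
have [d] := ubnP `|(c.2 + m + 1)%R|%N; elim: d c => // d IH c hd hc Hc nin.
have [cm|cm] := leP c.2 (- m).
  right; apply: (@escape_down c) => // k; apply/negP => /and3P[_ _].
  by have [_] := hm k; lia.
pose u : hex_point := (c.1, c.2 - 1).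
pose v : hex_point := (c.1 + 1, c.2 - 1).
have uv : hex_adjacent u v.
  by move: hc; rewrite /hex_centre /hex_adjacent /hex_edge /u /v !inE !xpair_eqE /=; lia.
have eu : lhex u v = c.
  by rewrite /lhex /u /v /=; case: (c) => a b /=; congr pair; lia.
have ev : lhex v u = (c.1 + 1, c.2 - 2).
  by rewrite /lhex /u /v /=; congr pair; lia.
have [he|he] := boolP (cedge u v).
  left; have := @outer_edge u v he; rewrite eu => /(_ nin)[k hk]; exists k; by rewrite -hk.
have := Hcross uv he; have := inside_step Hz uv;
  rewrite (negPf he) eu ev (negPf nin) /= => hin /(_ Hc) Hc'.
apply: IH Hc' _; rewrite /= ?hin //; first by move: cm hd; clear; lia.
by move: hc; rewrite /hex_centre /=; lia.
Qed.

(* Jordan curve theorem: an outside hexagon is joined to the cycle, then along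
   its outer side to the lowest horizontal edge, then to infinity. *)
Lemma outside_escapes c : hex_centre c -> H c -> ~~ inside c ->
  forall B : int, exists c', [/\ hex_centre c', H c' & c'.2 < B].
Proof.
move=> hc Hc nin; have [[k Hk]|//] := escape_to_cycle hc Hc nin.
have [m [m0 hm]] := cycle_bounded Hz.
(* One of the two hexagons at the first edge is inside, so it has a horizontal edge of Z below
   it. *)
have hor : exists k, (z k).2 == (z k.+1).2.
  have := inside_step Hz (cycle_adj Hz 0); rewrite (cycle_edge_z Hz 0).
  have [/inside_rung[l _ /and3P[h _ _]] _|_ /=] := boolP (inside (lhex (z 0) (z 1))).
    by exists l.
  by move=> /inside_rung[l _ /and3P[h _ _]]; exists l.
have [l hl lmin] : exists2 l, (z l).2 == (z l.+1).2 &
    forall j, (z j).2 == (z j.+1).2 -> (z l).2 <= (z j).2.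
  case: hor => l0; have [d] := ubnP `|((z l0).2 + m)%R|%N.
  elim: d l0 => // d IH l0 hd h0.
  have [h|] := pselect (forall j, (z j).2 == (z j.+1).2 -> (z l0).2 <= (z j).2).
    by exists l0.
  move=> /existsNP[j /not_implyP[hj]] /negP; rewrite -ltNge => jl; apply: IH hj.
  by have [_ h1] := hm j; have [_ h2] := hm l0; lia.
(* A hexagon whose centre is at most as high as the lowest horizontal edge has no edge of Z below it
   in its column. One of the two hexagons at that edge is of this kind, hence outer. *)
have nr c' : hex_centre c' -> c'.2 <= (z l).2 -> forall j, ~~ rung_below c' (z j) (z j.+1).
  by move=> _ h j; apply/negP => /and3P[/lmin h1 _ h2]; lia.
have nout c' : hex_centre c' -> c'.2 <= (z l).2 -> ~~ inside c'.
  by move=> h1 h2; apply/negP => /inside_rung[j _]; rewrite (negPf (nr _ h1 h2 j)).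
have fin c' : hex_centre c' -> c'.2 <= (z l).2 -> (exists j, c' = outer o j) ->
    forall B : int, exists c', [/\ hex_centre c', H c' & c'.2 < B].
  move=> h1 h2 [j hj]; apply: escape_down h1 _ (nr _ h1 h2).
  by rewrite hj; apply: escape_outer Hk.
have zl := cycle_adj Hz l; have zl' := zl; rewrite hex_adjacent_sym in zl'.
have h1 := lhex_centre zl; have h2 := lhex_centre zl'.
have [h|h] := leP (lhex (z l) (z l.+1)).2 (z l).2.
  by apply: (fin _ h1 h); apply: outer_edge (cycle_edge_z Hz l) (nout _ h1 h).
have h' : (lhex (z l.+1) (z l)).2 <= (z l).2.
  by move: h; rewrite /lhex /=; move/eqP: hl; lia.
apply: (fin _ h2 h'); apply: outer_edge _ (nout _ h2 h').
by rewrite cycle_edgeC cycle_edge_z.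
Qed.

End Escape.
End Inside.

(** * The plane region bounded by a cycle *)

Section Plane.
Local Open Scope classical_set_scope.
Variable R : realType.
Implicit Types p q : R * R.

(** Coordinates in the basis e1, e2, in which lattice points have integer coordinates and the square
    root of 3 disappears. *)
Definition skew_y p : R := p.2 * 2 / Num.sqrt 3.
Definition skew_x p : R := p.1 - skew_y p / 2.

Lemma sqrt3_gt0 : 0 < Num.sqrt 3 :> R.
Proof. by rewrite sqrtr_gt0. Qed.

Lemma skew_x_point u : skew_x (plane_point R u) = u.1%:~R.
Proof. by rewrite /skew_x /skew_y /plane_point /=; field; rewrite gt_eqF // sqrt3_gt0. Qed.

Lemma skew_y_point u : skew_y (plane_point R u) = u.2%:~R.
Proof. by rewrite /skew_y /plane_point /=; field; rewrite gt_eqF // sqrt3_gt0. Qed.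

Lemma skew_inj p q : skew_x p = skew_x q -> skew_y p = skew_y q -> p = q.
Proof.
case: p q => [a b] [c d]; rewrite /skew_x => + h; rewrite h => /addIr /= ->.
congr pair; move: h; rewrite /skew_y /= => h.
have s0 : Num.sqrt 3 != 0 :> R by rewrite gt_eqF // sqrt3_gt0.
have -> : b = (b * 2 / Num.sqrt 3) * Num.sqrt 3 / 2 by field.
by rewrite h; field.
Qed.

Definition combo (t : R) p q : R * R :=
  ((1 - t) * p.1 + t * q.1, (1 - t) * p.2 + t * q.2).

Lemma skew_y_combo t p q : skew_y (combo t p q) = (1 - t) * skew_y p + t * skew_y q.
Proof. by rewrite /skew_y /=; ring. Qed.

Lemma skew_x_combo t p q : skew_x (combo t p q) = (1 - t) * skew_x p + t * skew_x q.
Proof. by rewrite /skew_x skew_y_combo /=; ring. Qed.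

Lemma plane_segmentP u v p : plane_segment u v p <->
  exists t, [/\ 0 <= t, t <= 1, skew_x p = (1 - t) * u.1%:~R + t * v.1%:~R &
                skew_y p = (1 - t) * u.2%:~R + t * v.2%:~R].
Proof.
split=> [[t /=]|[t [t0 t1 h1 h2]]].
  rewrite in_itv /= => /andP[t0 t1] <-; exists t.
  have := skew_x_combo t (plane_point R u) (plane_point R v).
  have := skew_y_combo t (plane_point R u) (plane_point R v).
  by rewrite !skew_x_point !skew_y_point.
exists t; first by rewrite /= in_itv /= t0.
apply/esym; apply: (@skew_inj p (combo t (plane_point R u) (plane_point R v))).
  by rewrite skew_x_combo !skew_x_point.
by rewrite skew_y_combo !skew_y_point.
Qed.

Lemma plane_segmentC u v p : plane_segment u v p -> plane_segment v u p.
Proof.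
move=> /plane_segmentP[t [t0 t1 h1 h2]]; apply/plane_segmentP; exists (1 - t).
by split; [lra|lra|rewrite h1; ring|rewrite h2; ring].
Qed.

Lemma skew_y_continuous : continuous skew_y.
Proof.
move=> p; rewrite /skew_y; apply: cvgMl; apply: cvgMl; exact: cvg_snd.
Qed.

Lemma skew_x_continuous : continuous skew_x.
Proof.
move=> p; rewrite /skew_x; apply: cvgB; first exact: cvg_fst.
apply: cvgMl; exact: skew_y_continuous.
Qed.

Definition hexagon (c : hex_point) : set (R * R) :=
  [set p | let x := skew_x p - c.1%:~R in let y := skew_y p - c.2%:~R in
     [/\ -1 <= x /\ x <= 1, -1 <= y /\ y <= 1 & -1 <= x + y /\ x + y <= 1]].

Lemma strip_closed (f : R * R -> R) (a : R) : continuous f ->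
  closed [set p | -1 <= f p - a /\ f p - a <= 1].
Proof.
move=> fc.
have -> : [set p | -1 <= f p - a /\ f p - a <= 1] =
    (f @^-1` [set x | a - 1 <= x]) `&` (f @^-1` [set x | x <= a + 1]).
  by apply/seteqP; split=> p /= [h1 h2]; split; lra.
apply: closedI; apply: closed_comp => [p _|];
  by [exact: fc|exact: closed_ge|exact: closed_le].
Qed.

Lemma hexagon_closed c : closed (hexagon c).
Proof.
have -> : hexagon c =
   [set p | -1 <= skew_x p - c.1%:~R /\ skew_x p - c.1%:~R <= 1] `&`
   [set p | -1 <= skew_y p - c.2%:~R /\ skew_y p - c.2%:~R <= 1] `&`
   [set p | -1 <= (skew_x \+ skew_y) p - (c.1%:~R + c.2%:~R) /\ (skew_x \+ skew_y) p -
     (c.1%:~R + c.2%:~R) <= 1].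
  apply/seteqP; split=> p /=; rewrite /hexagon /=.
    by case=> h1 h2 h3; do !split; lra.
  by case=> [[h1 h2] h3]; do !split; lra.
apply: closedI; first apply: closedI; apply: strip_closed.
- exact: skew_x_continuous.
- exact: skew_y_continuous.
- by move=> p; apply: cvgD; [exact: skew_x_continuous|exact: skew_y_continuous].
Qed.

(** The unit parallelogram around p splits into two triangles. Each has exactly one hexagon centre
    among its corners, and that hexagon contains the whole triangle. *)
Lemma hexagon_cover p : exists c, hex_centre c /\ hexagon c p.
Proof.
pose a := Num.floor (skew_x p); pose b := Num.floor (skew_y p).
have /andP[ha1 ha2] : a%:~R <= skew_x p < (a + 1)%:~R by exact: floor_itv.
have /andP[hb1 hb2] : b%:~R <= skew_y p < (b + 1)%:~R by exact: floor_itv.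
rewrite !intrD in ha2 hb2.
have [h|h] := leP (skew_x p + skew_y p) (a%:~R + b%:~R + 1).
  have [h0|[h1|h2]] : modz (a - b) 3 = 0 \/ modz (a - b) 3 = 1 \/ modz (a - b) 3 = 2 by lia.
  - by exists (a, b); split => //; do !split; rewrite /=; lra.
  - exists (a, b + 1); split; first by rewrite /hex_centre /=; lia.
    by do !split; rewrite /= ?intrD; lra.
  - exists (a + 1, b); split; first by rewrite /hex_centre /=; lia.
    by do !split; rewrite /= ?intrD; lra.
have [h0|[h1|h2]] : modz (a - b) 3 = 0 \/ modz (a - b) 3 = 1 \/ modz (a - b) 3 = 2 by lia.
- exists (a + 1, b + 1); split; first by rewrite /hex_centre /=; lia.
  by do !split; rewrite /= ?intrD; lra.
- exists (a, b + 1); split; first by rewrite /hex_centre /=; lia.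
  by do !split; rewrite /= ?intrD; lra.
- exists (a + 1, b); split; first by rewrite /hex_centre /=; lia.
  by do !split; rewrite /= ?intrD; lra.
Qed.

Lemma hexagon_meet c c' p : hex_centre c -> hex_centre c' ->
  hexagon c p -> hexagon c' p -> c = c' \/
  exists u v, [/\ hex_adjacent u v, lhex u v = c, lhex v u = c' & plane_segment u v p].
Proof.
case: c c' => [a b] [a' b'] hc hc' [] /= [x1 x2] [y1 y2] [s1 s2] [] [x1' x2'] [y1' y2']
  [s1' s2'].
have e1 : (a' - a <= 2)%R by rewrite -(ler_int R) intrB; lra.
have e2 : (-2 <= a' - a)%R by rewrite -(ler_int R) intrB; lra.
have e3 : (b' - b <= 2)%R by rewrite -(ler_int R) intrB; lra.
have e4 : (-2 <= b' - b)%R by rewrite -(ler_int R) intrB; lra.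
have e5 : ((a' - a) + (b' - b) <= 2)%R by rewrite -(ler_int R) intrD !intrB; lra.
have e6 : (-2 <= (a' - a) + (b' - b))%R by rewrite -(ler_int R) intrD !intrB; lra.
move: hc hc'; rewrite /hex_centre /= => hc hc'.
set x := skew_x p in x1 x2 s1 s2 x1' x2' s1' s2'.
set y := skew_y p in y1 y2 s1 s2 y1' y2' s1' s2'.
(* Here (e, f) is u - c, and its rotation (- f, e + f) by pi / 3 is v - c; their sum is c' - c. *)
have [[ha hb]|H] : (a' = a /\ b' = b) \/ exists e f : int,
    [/\ a' = a + (e - f), b' = b + (e + 2 * f) & (e, f) \in
      [:: (1, 0); (0, 1); (-1, 1); (-1, 0); (0, -1); (1, -1)]].
- have [f hf] : exists f : int, b' - b = (a' - a) + 3 * f.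
    by exists (divz ((b' - b) - (a' - a)) 3); move: hc hc'; clear; lia.
  have [h|h] := eqVneq a' a.
    by left; split => //; move: h e3 e4 hf; clear; lia.
  right; exists (a' - a + f), f; move: h e1 e2 e3 e4 e5 e6 hf; clear.
  by rewrite !inE !xpair_eqE; split; lia.
- by left; rewrite ha hb.
right; case: H => e [f [ha hb hef]].
exists (a + e, b + f), (a - f, b + e + f); split.
- have : modz (a - b) 3 = 0 by move: hc; clear; lia.
  move: hef; rewrite !inE !xpair_eqE /hex_adjacent /hex_edge !inE !xpair_eqE /=; clear.
  by case/or4P => [|||/or3P[]] /andP[/eqP -> /eqP ->] h; lia.
- by rewrite /lhex /=; congr pair; clear; lia.
- by rewrite /lhex /=; congr pair; move: ha hb; clear; lia.
have {}ha : a'%:~R = a%:~R + (e%:~R - f%:~R) :> R by rewrite ha intrD intrB.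
have {}hb : b'%:~R = b%:~R + (e%:~R + 2 * f%:~R) :> R.
  by rewrite hb !intrD intrM.
rewrite ha in x1' x2' s1' s2'; rewrite hb in y1' y2' s1' s2'.
apply/plane_segmentP; rewrite /= !(intrB, intrD) -/x -/y.
move: hef; rewrite !inE !xpair_eqE.
case/or4P => [|||/or3P[]] /andP[/eqP he /eqP hf];
  rewrite {}he {}hf in x1' x2' s1' s2' y1' y2' *.
- by exists (y - b%:~R); split; lra.
- by exists (a%:~R - x); split; lra.
- by exists (1 - (y - b%:~R)); split; lra.
- by exists (b%:~R - y); split; lra.
- by exists (x - a%:~R); split; lra.
- by exists (1 + (y - b%:~R)); split; lra.
Qed.

Lemma segment_hexagon u v p : hex_adjacent u v -> plane_segment u v p ->
  hexagon (lhex u v) p.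
Proof.
move=> h /plane_segmentP[t [t0 t1 hx hy]]; rewrite /hexagon /= hx hy /lhex /=.
by adj_cases h; rewrite /= ?(intrB, intrD); do !split; lra.
Qed.

Lemma segment_hexagons u v p : hex_adjacent u v -> plane_segment u v p ->
  hexagon (lhex u v) p /\ hexagon (lhex v u) p.
Proof.
move=> h hp; split; first exact: segment_hexagon.
by apply: segment_hexagon; [rewrite hex_adjacent_sym|apply: plane_segmentC].
Qed.

Lemma lhex_neq u v : hex_adjacent u v -> lhex u v != lhex v u.
Proof.
move=> h; adj_cases h; case: u {h} => a b h; rewrite /lhex xpair_eqE /=; lia.
Qed.

Lemma lhex_inj u v x y : lhex u v = lhex x y -> lhex v u = lhex y x ->
  u = x /\ v = y.
Proof.
case: u v x y => [a b] [c d] [e f] [g h]; rewrite /lhex /= => -[h1 h2] [h3 h4].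
by split; congr pair; lia.
Qed.

(* A hexagon is star-shaped, and only its boundary meets other hexagons. *)
Lemma hexagon_star c c' p (t : R) : hex_centre c -> hex_centre c' ->
  hexagon c p -> 0 <= t -> t < 1 ->
  hexagon c' (combo t (plane_point R c) p) -> c = c'.
Proof.
case: c c' => [a b] [a' b'] hc hc' [] /= [x1 x2] [y1 y2] [s1 s2] t0 t1.
rewrite /hexagon /= skew_x_combo skew_y_combo skew_x_point skew_y_point /=.
set x := skew_x p in x1 x2 s1 s2 *.
set y := skew_y p in y1 y2 s1 s2 *.
have shrink (r : R) : -1 <= r -> r <= 1 -> -1 < t * r /\ t * r < 1 by nra.
have [u1 u2] := shrink _ x1 x2; have [v1 v2] := shrink _ y1 y2.
have [w1 w2] := shrink _ s1 s2.
move=> [[x1' x2'] [y1' y2'] [s1' s2']].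
have e1 : (a' - a < 2)%R by rewrite -(ltr_int R) intrB; lra.
have e2 : (-2 < a' - a)%R by rewrite -(ltr_int R) intrB; lra.
have e3 : (b' - b < 2)%R by rewrite -(ltr_int R) intrB; lra.
have e4 : (-2 < b' - b)%R by rewrite -(ltr_int R) intrB; lra.
have e5 : ((a' - a) + (b' - b) < 2)%R by rewrite -(ltr_int R) intrD !intrB; lra.
have e6 : (-2 < (a' - a) + (b' - b))%R by rewrite -(ltr_int R) intrD !intrB; lra.
have [f hf] : exists f : int, b' - b = (a' - a) + 3 * f.
  exists (divz ((b' - b) - (a' - a)) 3).
  by move: hc hc'; rewrite /hex_centre /=; clear; lia.
by move: e1 e2 e3 e4 e5 e6 hf; clear => *; congr pair; lia.
Qed.

Definition midpoint u v : R * R := combo (1 / 2) (plane_point R u) (plane_point R v).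

Lemma midpoint_segment u v : plane_segment u v (midpoint u v).
Proof. by exists (1 / 2) => //=; rewrite in_itv /=; lra. Qed.

Lemma midpoint_hexagon u v c : hex_adjacent u v -> hex_centre c ->
  hexagon c (midpoint u v) -> c = lhex u v \/ c = lhex v u.
Proof.
case: c => a b h hc; rewrite /hexagon /= skew_x_combo skew_y_combo !skew_x_point
  !skew_y_point.
move=> [[x1' x2'] [y1' y2'] [s1' s2']].
have e1 : u.1 + v.1 - 2 * a <= 2 by rewrite -(ler_int R) !(intrB, intrD, intrM); lra.
have e2 : -2 <= u.1 + v.1 - 2 * a by rewrite -(ler_int R) !(intrB, intrD, intrM); lra.
have e3 : u.2 + v.2 - 2 * b <= 2 by rewrite -(ler_int R) !(intrB, intrD, intrM); lra.
have e4 : -2 <= u.2 + v.2 - 2 * b by rewrite -(ler_int R) !(intrB, intrD, intrM); lra.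
have e5 : u.1 + v.1 - 2 * a + (u.2 + v.2 - 2 * b) <= 2 by rewrite -(ler_int R) !(intrB,
  intrD, intrM); lra.
have e6 : -2 <= u.1 + v.1 - 2 * a + (u.2 + v.2 - 2 * b) by rewrite -(ler_int R) !(intrB,
  intrD, intrM); lra.
clear x1' x2' y1' y2' s1' s2'.
suff : ((a, b) == lhex u v) || ((a, b) == lhex v u) by case/orP => /eqP; [left|right].
move: hc e1 e2 e3 e4 e5 e6; rewrite /hex_centre /=.
by adj_cases h; case: u {h v} => c d /=; clear; rewrite /lhex !xpair_eqE /=; lia.
Qed.

End Plane.

(** * Components of the complement of the curve *)

Definition cycle_nth (Z : seq hex_point) (k : nat) : hex_point :=
  nth (0, 0) Z (k %% size Z).

Lemma next_cycle_nth Z k : uniq Z -> (0 < size Z)%N ->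
  next Z (cycle_nth Z k) = cycle_nth Z k.+1.
Proof.
move=> uZ Z0; have kn := ltn_pmod k Z0; rewrite /cycle_nth.
rewrite -[k.+1]addn1 -modnDml addn1; move: (k %% size Z)%N kn => j jn.
rewrite next_nth mem_nth // index_uniq //; case: Z uZ Z0 jn => //= x s _ _ jn.
have [e|e] := eqVneq j (size s); first by rewrite e modnn nth_default.
have js : (j < size s)%N by rewrite ltn_neqAle e -ltnS.
by rewrite modn_small //=; apply: set_nth_default.
Qed.

Lemma hex_cycle_lattice Z : hex_cycle Z -> lattice_cycle (cycle_nth Z) (size Z).
Proof.
case=> /andP[cZ uZ] s2; have s0 : (0 < size Z)%N by lia.
split=> // [k|k|k l kn ln].
- by rewrite /cycle_nth modnDr.
- rewrite -next_cycle_nth //; apply: next_cycle => //.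
  by rewrite mem_nth // ltn_pmod.
- by rewrite /cycle_nth !modn_small // => /eqP; rewrite nth_uniq // => /eqP.
Qed.

Definition box (m : nat) : seq hex_point :=
  [seq (i%:Z - m%:Z, j%:Z - m%:Z) | i <- iota 0 (2 * m).+1, j <- iota 0 (2 * m).+1].

Lemma mem_box m c : (c \in box m) = (`|c.1| <= m%:Z) && (`|c.2| <= m%:Z).
Proof.
apply/allpairsP/andP => [[[i j]]|[h1 h2]].
  by rewrite !mem_iota [(i, j).1]/= [(i, j).2]/= => -[hi hj ->] /=; lia.
exists (`|(c.1 + m%:Z)%R|%N, `|(c.2 + m%:Z)%R|%N); rewrite !mem_iota.
by split; cbn [fst snd]; [lia|lia|case: c h1 h2 => a b /= h1 h2; congr pair; lia].
Qed.

Section Region.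
Local Open Scope classical_set_scope.
Variables (R : realType) (Z : seq hex_point).
Hypothesis HZ : hex_cycle Z.

Let z := cycle_nth Z.
Let n := size Z.
Let Hz : lattice_cycle z n := hex_cycle_lattice HZ.
Local Notation inside := (inside z n).
Local Notation cedge := (cycle_edge z n).
Local Notation curve := (@plane_curve R Z).

Lemma plane_curveP p : curve p <-> exists k, plane_segment (z k) (z k.+1) p.
Proof.
case: HZ => /andP[_ uZ] s2; have s0 : (0 < size Z)%N by lia.
split=> [[u /= uin hp]|[k hk]].
  exists (index u Z); rewrite /z -next_cycle_nth //.
  by rewrite /cycle_nth modn_small ?index_mem // nth_index.
exists (z k); first by rewrite /= /z /cycle_nth mem_nth // ltn_pmod.
by rewrite next_cycle_nth.
Qed.

Lemma cycle_edge_curve u v p : cedge u v -> plane_segment u v p -> curve p.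
Proof.
case/(cycle_edgeP Hz) => k hk hp; apply/plane_curveP; exists k.
by case: hk hp => -[-> ->] // /plane_segmentC.
Qed.

Lemma inside_hexagon_unique p c c' : ~ curve p -> hex_centre c -> hex_centre c' ->
  hexagon c p -> hexagon c' p -> inside c = inside c'.
Proof.
move=> np hc hc' h h'; case: (hexagon_meet hc hc' h h') => [-> //|[u [v [uv <- <- hp]]]].
have := inside_step Hz uv; have [/cycle_edge_curve/(_ hp)//|_] := boolP (cedge u v).
by case: (inside _) (inside _) => [] [].
Qed.

Lemma norm_skew_y (p : R * R) :
  `|skew_y p| <= 2 * `|p.2| /\ `|p.2| <= `|skew_y p|.
Proof.
have s1 : 1 <= Num.sqrt 3 :> R by rewrite -[leLHS]sqrtr1 ler_sqrt // ler1n.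
have s2 : Num.sqrt 3 <= 2 :> R.
  by rewrite -(ler_pXn2r (n := 2)) // ?nnegrE ?sqrtr_ge0 // sqr_sqrtr // expr2; lra.
have h : `|skew_y p| * Num.sqrt 3 = 2 * `|p.2|.
  rewrite -{1}[Num.sqrt 3]gtr0_norm ?sqrt3_gt0 // -normrM /skew_y divfK ?gt_eqF
    ?sqrt3_gt0 //.
  by rewrite normrM [X in _ * X]ger0_norm // mulrC.
have : 0 <= `|skew_y p| * (Num.sqrt 3 - 1) by rewrite mulr_ge0 ?subr_ge0.
have : 0 <= `|skew_y p| * (2 - Num.sqrt 3) by rewrite mulr_ge0 ?subr_ge0.
by rewrite !mulrBr h; split; lra.
Qed.

Lemma skew_norm (p : R * R) (m : R) :
  `|skew_x p| <= m -> `|skew_y p| <= m -> `|p| <= 2 * m.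
Proof.
move=> h1 h2; have [_ h3] := norm_skew_y p; have m0 : 0 <= m by exact: le_trans h1.
rewrite prod_normE ge_max; apply/andP; split; last by lra.
have -> : p.1 = skew_x p + skew_y p / 2 by rewrite /skew_x subrK.
move/ler_normlP: h1 => [? ?]; move/ler_normlP: h2 => [? ?].
by apply/ler_normlP; split; lra.
Qed.

(** The inside hexagons are clopen in the component. They form a finite union of closed sets; within
    a bounded open window their complement is such a union too, since off the curve all hexagons
    through a point have the same parity. *)
Lemma component_inside p q c : ~ curve p -> hex_centre c -> inside c -> hexagon c p ->
  connected_component (~` curve) p q ->
  exists c', [/\ hex_centre c', inside c' & hexagon c' q].
Proof.
move=> np hc hin hp.
set C := connected_component _ _.
have Cc : C `<=` ~` curve by exact: connected_component_sub.
have [m0 [m00 hm0]] := inside_bounded Hz.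
have [m hm] : exists m : nat, forall c, hex_centre c -> inside c ->
    `|c.1| <= m%:Z /\ `|c.2| <= m%:Z.
  by exists `|m0|%N => c' h1 h2; have := hm0 c' h1 h2; rewrite gez0_abs.
pose K := [set q : R * R | exists c', [/\ hex_centre c', inside c' & hexagon c' q]].
suff : C `&` K = C by move=> <- [].
apply: component_connected.
- exists p; split; first exact: connected_component_refl.
  by exists c.
(* Inside hexagons stay within m + 1, hence in the window of radius m + 2; a hexagon meeting the
   window has its centre in the box of radius m + 5. *)
- exists ([set q | -(m.+2%:R : R) < skew_x q] `&` [set q | skew_x q < m.+2%:R] `&`
     [set q | - (m.+2%:R : R) < skew_y q] `&` [set q | skew_y q < m.+2%:R] `&`
     ~` \big[setU/set0]_(c' <- [seq c' <- box (m + 5) | (modz (c'.1 - c'.2) 3 == 0) && ~~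
       inside c']) hexagon c').
    apply: openI; last first.
      by apply: closed_openC; apply: closed_bigsetU => c' _; exact: hexagon_closed.
    have sx := @skew_x_continuous R; have sy := @skew_y_continuous R.
    apply: openI; [apply: openI; [apply: openI|]|].
    + by apply: (@open_comp _ _ (@skew_x R) [set x | - m.+2%:R < x]) => [? _|];
      [exact: sx|exact: open_gt].
    + by apply: (@open_comp _ _ (@skew_x R) [set x | x < m.+2%:R]) => [? _|];
      [exact: sx|exact: open_lt].
    + by apply: (@open_comp _ _ (@skew_y R) [set x | - m.+2%:R < x]) => [? _|];
      [exact: sy|exact: open_gt].
    + by apply: (@open_comp _ _ (@skew_y R) [set x | x < m.+2%:R]) => [? _|];
      [exact: sy|exact: open_lt].
  apply/seteqP; split=> r [Cr].
    move=> [c' [h1 h2 h3]]; split=> //; split; last first.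
      rewrite -bigcup_seq => -[d];
        rewrite /mkset mem_filter => /andP[/andP[/eqP d1 d2] _] hd.
      by move: d2; rewrite -(inside_hexagon_unique (Cc _ Cr) h1 d1 h3 hd) h2.
    have [/ler_normlP[a1 a2] /ler_normlP[b1 b2]] := hm c' h1 h2.
    move: a1 a2 b1 b2; rewrite -!(ler_int R) !intrN => a1 a2 b1 b2.
    case: h3 => /= [[x1 x2] [y1 y2] _]; rewrite -[m.+2]addn2 natrD.
    by do !split => /=; lra.
  move=> [[[[x1 x2] y1] y2] hn]; split=> //.
  have [c' [h1 h2]] := hexagon_cover r; exists c'; split=> //.
  apply: contra_notT hn => h3; rewrite -bigcup_seq; exists c' => //.
  rewrite /mkset mem_filter h1 eqxx h3 /= mem_box.
  move: x1 x2 y1 y2; rewrite /= -[m.+2]addn2 natrD => x1 x2 y1 y2.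
  case: h2 => /= [[x1' x2'] [y1' y2'] _].
  apply/andP; split; apply/ler_normlP; rewrite -!(ler_int R) intrN PoszD intrD; split; lra.
- exists (\big[setU/set0]_(c' <- [seq c' <- box m | (modz (c'.1 - c'.2) 3 == 0) && inside
  c']) hexagon c').
    by apply: closed_bigsetU => c' _; exact: hexagon_closed.
  apply/seteqP; split=> r [Cr].
    move=> [c' [h1 h2 h3]]; split=> //; rewrite -bigcup_seq; exists c' => //.
    by rewrite /mkset mem_filter h1 eqxx h2 /= mem_box; have [-> ->] := hm c' h1 h2.
  rewrite -bigcup_seq => -[d]; rewrite /mkset mem_filter => /andP[/andP[/eqP d1 d2] _] hd.
  by split=> //; exists d.
Qed.

Lemma inside_component_bounded p c : ~ curve p -> hex_centre c -> inside c ->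
  hexagon c p -> bounded_set (connected_component (~` curve) p).
Proof.
move=> np hc hin hp; have [m [m0 hm]] := inside_bounded Hz.
exists (2 * (m%:~R + 1)); split; first exact: num_real.
move=> M hM q /(component_inside np hc hin hp)[c' [h1 h2 h3]].
apply: le_trans (ltW hM).
have [/ler_normlP[a1 a2] /ler_normlP[b1 b2]] := hm c' h1 h2.
move: a1 a2 b1 b2; rewrite -!(ler_int R) !intrN => a1 a2 b1 b2.
case: h3 => /= [[x1 x2] [y1 y2] _].
by apply: skew_norm; apply/ler_normlP; split; lra.
Qed.

Lemma combo_component p q : (forall t, 0 <= t <= 1 -> ~ curve (combo t p q)) ->
  connected_component (~` curve) p q.
Proof.
move=> h.
have c0 : combo 0 p q = p by rewrite /combo subr0 !mul1r !mul0r !addr0 -surjective_pairing.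
have c1 : combo 1 p q = q by rewrite /combo subrr !mul1r !mul0r !add0r -surjective_pairing.
have cont : continuous (fun t : R => combo t p q).
  move=> t; have lin (a b : R) : (1 - s) * a + s * b @[s --> t] --> (1 - t) * a + t * b.
    apply: cvgD; apply: cvgMl; last exact: cvg_id.
    by apply: cvgB; [exact: cvg_cst|exact: cvg_id].
  exact: (cvg_pair (lin _ _) (lin _ _)).
apply: (@connected_component_max _ _ [set combo t p q | t in `[0, 1]]).
- by exists 0; rewrite //= in_itv /= lexx ler01.
- by move=> _ [t /= t01 <-]; apply: h; rewrite in_itv in t01.
- apply: connected_continuous_connected; first exact: segment_connected.
  exact: continuous_subspaceT.
- by exists 1; rewrite //= in_itv /= lexx ler01.
Qed.

(** A point of the curve lies in two distinct hexagons, whereas the points of the segment from the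
    centre to p, other than p, lie in no hexagon but c. *)
Lemma centre_component p c : ~ curve p -> hex_centre c -> hexagon c p ->
  connected_component (~` curve) (plane_point R c) p.
Proof.
move=> np hc hp; apply: combo_component => t /andP[t0 t1].
have [->|tn1] := eqVneq t 1.
  by rewrite /combo subrr !mul1r !mul0r !add0r -surjective_pairing.
have {}t1 : t < 1 by rewrite lt_neqAle tn1.
move=> /plane_curveP[k /(segment_hexagons (cycle_adj Hz k))[h1 h2]].
have a := cycle_adj Hz k; have a' := a; rewrite hex_adjacent_sym in a'.
have e1 := hexagon_star hc (lhex_centre a) hp t0 t1 h1.
have e2 := hexagon_star hc (lhex_centre a') hp t0 t1 h2.
by have := lhex_neq a; rewrite -e1 -e2 eqxx.
Qed.

Lemma midpoint_not_curve u v : hex_adjacent u v -> ~~ cedge u v ->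
  ~ curve (midpoint R u v).
Proof.
move=> uv /negP nuv /plane_curveP[k /(segment_hexagons (cycle_adj Hz k))[h1 h2]].
have a := cycle_adj Hz k; have a' := a; rewrite hex_adjacent_sym in a'.
have e1 := midpoint_hexagon uv (lhex_centre a) h1.
have e2 := midpoint_hexagon uv (lhex_centre a') h2.
apply: nuv; apply/(cycle_edgeP Hz); exists k; have := lhex_neq a.
case: e1 e2 => e1 [] e2; rewrite e1 e2 ?eqxx // => _.
  by have [-> ->] := lhex_inj e1 e2; left.
by have [-> ->] := lhex_inj e1 e2; right.
Qed.

(** [outside_escapes] is applied to the hexagons whose centres lie in the component of p;
    neighbouring centres are joined through the midpoint of the common edge. *)
Lemma outside_component_unbounded p c : ~ curve p -> hex_centre c -> ~~ inside c ->
  hexagon c p -> ~ bounded_set (connected_component (~` curve) p).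
Proof.
move=> np hc nin hp [M [_ hM]].
have {}hM q : connected_component (~` curve) p q -> `|q| <= M + 1.
  by move=> hq; apply: hM hq; rewrite ltrDl.
pose H c := connected_component (~` curve) p (plane_point R c).
have Hc : H c by apply: connected_component_sym; exact: centre_component.
have Hcross u v : hex_adjacent u v -> ~~ cedge u v -> H (lhex u v) -> H (lhex v u).
  move=> uv nuv h; apply: connected_component_trans h _.
  have nm := midpoint_not_curve uv nuv.
  have [h1 h2] := segment_hexagons uv (midpoint_segment R u v).
  have vu : hex_adjacent v u by rewrite hex_adjacent_sym.
  apply: connected_component_trans (centre_component nm (lhex_centre uv) h1) _.
  exact/connected_component_sym/centre_component/h2/lhex_centre.
have [c' [_ h1 h2]] := outside_escapes Hz Hcross hc Hc nin (- (Num.floor (2 * (M + 1)) +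
  1)).
have [] := norm_skew_y (plane_point R c'); rewrite skew_y_point => h3 _.
have h4 : `|(plane_point R c').2| <= M + 1.
  by apply: le_trans (hM _ h1); rewrite prod_normE le_max lexx orbT.
have := floorD1_gt (2 * (M + 1)); move: h2; rewrite -(ltr_int R) intrN => h2.
have := ler_norm (- c'.2%:~R : R); rewrite normrN; lra.
Qed.

Theorem plane_regionP p : plane_region Z p <->
  exists c, [/\ hex_centre c, inside c & @hexagon R c p].
Proof.
split=> [[/plane_curveP[k hk]|[np hb]]|[c [hc hin hp]]].
- have a := cycle_adj Hz k; have a' := a; rewrite hex_adjacent_sym in a'.
  have [h1 h2] := segment_hexagons a hk.
  have := inside_step Hz a; rewrite cycle_edge_z //.
  have [hi _|_ /= hi] := boolP (inside (lhex (z k) (z k.+1))).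
    by exists (lhex (z k) (z k.+1)); split => //; exact: lhex_centre.
  by exists (lhex (z k.+1) (z k)); split => //; exact: lhex_centre.
- have [c [hc hp]] := hexagon_cover p; exists c; split=> //.
  by apply: contra_notT (outside_component_unbounded np hc ^~ hp) _.
have [cp|np] := pselect (curve p); first by left.
by right; split=> //; exact: inside_component_bounded hin hp.
Qed.

End Region.

(** * The benzenoid system in terms of inside hexagons *)

Section InnerGraph.
Local Open Scope classical_set_scope.

Definition hex_neighbours (u : hex_point) : seq hex_point :=
  [seq v <- [:: (u.1 + 1, u.2); (u.1, u.2 - 1); (u.1 - 1, u.2 + 1);
                (u.1 - 1, u.2); (u.1, u.2 + 1); (u.1 + 1, u.2 - 1)]
  | hex_adjacent u v].

Lemma mem_hex_neighbours u v : (v \in hex_neighbours u) = hex_adjacent u v.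
Proof.
rewrite mem_filter andb_idr // => h.
by adj_cases h; rewrite !inE eqxx ?orbT.
Qed.

(** The three hexagons around u are the [lhex u v] for its neighbours v. *)
Definition inner_vertex z n (u : hex_point) : bool :=
  has (fun v => inside z n (lhex u v)) (hex_neighbours u).

Definition inner_edge z n (e : hex_point * hex_point) : bool :=
  hex_edge e.1 e.2 && (inside z n (lhex e.1 e.2) || inside z n (lhex e.2 e.1)).

Definition inner_graph z n : graph hex_point :=
  Graph [set u | inner_vertex z n u] [set e | inner_edge z n e].

Lemma inner_vertexP z n u :
  reflect (exists2 v, hex_adjacent u v & inside z n (lhex u v)) (inner_vertex z n u).
Proof.
apply: (iffP hasP) => -[v]; rewrite ?mem_hex_neighbours; first by exists v.
by exists v; rewrite ?mem_hex_neighbours.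
Qed.

Lemma hex_edge_adjacent u v : hex_edge u v -> hex_adjacent u v.
Proof. by rewrite /hex_adjacent => ->. Qed.

Lemma benzenoid_inner (R : realType) Z : hex_cycle Z ->
  benzenoid R Z = inner_graph (cycle_nth Z) (size Z).
Proof.
move=> HZ; have Hz := hex_cycle_lattice HZ; rewrite /benzenoid /inner_graph.
congr Graph; apply/seteqP; split.
- move=> u /= [hu /(plane_regionP HZ)[c [hc hin]]].
  rewrite /hexagon /= skew_x_point skew_y_point => -[[a1 a2] [b1 b2] [d1 d2]].
  have e1 : u.1 - c.1 <= 1 by rewrite -(ler_int R) intrB.
  have e2 : -1 <= u.1 - c.1 by rewrite -(ler_int R) intrB.
  have e3 : u.2 - c.2 <= 1 by rewrite -(ler_int R) intrB.
  have e4 : -1 <= u.2 - c.2 by rewrite -(ler_int R) intrB.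
  have e5 : (u.1 - c.1) + (u.2 - c.2) <= 1 by rewrite -(ler_int R) intrD !intrB.
  have e6 : -1 <= (u.1 - c.1) + (u.2 - c.2) by rewrite -(ler_int R) intrD !intrB.
  apply/inner_vertexP.
  (* The solution of [lhex u v = c]: it is u turned by pi / 3 about c. *)
  pose v : hex_point := (c.1 + c.2 - u.2, u.1 + u.2 - c.1); exists v.
    rewrite /v {v}; move: hu hc e1 e2 e3 e4 e5 e6; clear.
    rewrite /hex_vertex /hex_centre; case: u c => [a b] [c d] /=.
    move=> h1 h2 e1 e2 e3 e4 e5 e6.
    have [i hi] : exists i, a = c + i by exists (a - c); lia.
    have [j hj] : exists j, b = d + j by exists (b - d); lia.
    rewrite {}hi {}hj in h1 e1 e2 e3 e4 e5 e6 *.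
    have {e1 e2} : i = -1 \/ i = 0 \/ i = 1 by lia.
    have {e3 e4} : j = -1 \/ j = 0 \/ j = 1 by lia.
    rewrite /hex_adjacent /hex_edge !inE !xpair_eqE /=.
    by case=> [|[]] hj; case=> [|[]] hi; rewrite {}hi {}hj in h1 e5 e6 *; lia.
  suff -> : lhex u v = c by [].
  by rewrite /lhex /v [RHS]surjective_pairing /=; congr pair; lia.
- move=> u /= /inner_vertexP[v uv hin]; split.
    by case: (hex_adjacent_cases uv) => -[h _]; rewrite /hex_vertex; move: h; clear; lia.
  apply/(plane_regionP HZ); exists (lhex u v); split=> //; first exact: lhex_centre.
  apply: segment_hexagon uv _; apply/plane_segmentP; exists 0.
  by rewrite skew_x_point skew_y_point; split; lra.
- move=> [u v] /= [h sub]; rewrite /inner_edge /= h /=.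
  have uv := hex_edge_adjacent h.
  have /(plane_regionP HZ)[c [hc hin hm]] := sub _ (midpoint_segment R u v).
  by have [<-|<-] := midpoint_hexagon uv hc hm; rewrite hin ?orbT.
- move=> [u v] /= /andP[/= h hin]; split=> // p hp; apply/(plane_regionP HZ).
  have uv := hex_edge_adjacent h.
  have vu : hex_adjacent v u by rewrite hex_adjacent_sym.
  have [h1 h2] := segment_hexagons uv hp.
  case/orP: hin => hin; [exists (lhex u v)|exists (lhex v u)]; split=> //;
    exact: lhex_centre.
Qed.

End InnerGraph.

(** * Distances *)

Section Dist.
Variables (T : choiceType) (G : graph T).
Implicit Types x y u v : T.

Lemma adjacent_sym : symmetric (adjacent G).
Proof. by move=> x y; apply/asboolP/asboolP => -[]; [right|left|right|left]. Qed.

Lemma walk0 x : walk G 0 x x.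
Proof. by exists [::]. Qed.

Lemma walk1 x y : adjacent G x y -> walk G 1 x y.
Proof. by move=> h; exists [:: y]; rewrite /= h. Qed.

Lemma walk_cat k m x y v : walk G k x y -> walk G m y v -> walk G (k + m) x v.
Proof.
move=> [p [px <- <-]] [q [qy <- <-]]; exists (p ++ q).
by rewrite cat_path px qy last_cat size_cat.
Qed.

Lemma walk_rev k x y : walk G k x y -> walk G k y x.
Proof.
move=> [p [px <- <-]]; exists (rev (belast x p)); split.
- by rewrite (rev_path (adjacent G)) (eq_path (e' := adjacent G)) // => a b;
  rewrite adjacent_sym.
- by case: p px => //= a p _; rewrite rev_cons last_rcons.
- by rewrite size_rev size_belast.
Qed.

Lemma distP k x y : walk G k x y ->
  walk G (dist G x y) x y /\ forall m, walk G m x y -> (dist G x y <= m)%N.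
Proof.
move=> h; rewrite /dist; case: xgetP => [n _ []//|hn].
have ex : exists m, `[< walk G m x y >] by exists k; apply/asboolP.
exfalso; apply: (hn (ex_minn ex)); case: ex_minnP => m /asboolP hm lm.
by split=> // j hj; apply: lm; apply/asboolP.
Qed.

(** A shortest walk from x to v leaves the side of u by some step ab. Going from a to u is no longer
    than going from b to v, and the step ab is saved. *)
Lemma dist_lt_side (side : T -> bool) u v x :
  (forall a b, adjacent G a b -> side a = side u -> side b != side u ->
     exists2 k, walk G k a u & forall m, walk G m b v -> (k <= m)%N) ->
  side x = side u -> side v != side u -> (exists k, walk G k x v) ->
  (dist G x u < dist G x v)%N.
Proof.
move=> cross xu vu [k0 /distP[[p [px lp sp]] _]].
have [k1 [k2 [a [b [[w1 ab w2 e sa] sb]]]]] : exists k1 k2 a b,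
    [/\ walk G k1 x a, adjacent G a b, walk G k2 b v,
        (k1 + k2).+1 = size p & side a = side u] /\ side b != side u.
  elim: p x xu px lp {sp} => [|y p IH] /= x xu; first by move=> _ e;
    rewrite -e xu eqxx in vu.
  case/andP => xy py lp; have [yu|yu] := eqVneq (side y) (side u).
    have [k1 [k2 [a [b [[w1 ab w2 e sa] sb]]]]] := IH _ yu py lp.
    exists k1.+1, k2, a, b; split=> //; split=> //; last by rewrite -e.
    exact: walk_cat (walk1 xy) w1.
  by exists 0%N, (size p), x, y; split=> //; split=> //; [exact: walk0|exists p].
have [k ka kb] := cross a b ab sa sb.
have xw := walk_cat w1 ka; have [_ /(_ _ xw)] := distP xw.
by have := kb _ w2; rewrite -sp; lia.
Qed.

End Dist.

(** * Sides of a cut *)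

Definition class1 (x : hex_point) : bool := modz (x.1 - x.2) 3 == 1.

(* The chains are the zigzags of non-horizontal edges; the height u.2 of a
   vertex increases by one at each step of [chain_up]. *)
Definition chain_up (x : hex_point) : hex_point :=
  if class1 x then (x.1 - 1, x.2 + 1) else (x.1, x.2 + 1).

Definition chain_down (x : hex_point) : hex_point :=
  if class1 x then (x.1, x.2 - 1) else (x.1 + 1, x.2 - 1).

Definition right_end (x : hex_point) : hex_point := (x.1 + 1, x.2).

Definition spoke_out (o : bool) (p c q : hex_point) : bool :=
  turn p c q == if o then 1 else -1.

Definition side_hex (o : bool) (u v : hex_point) : hex_point :=
  if o then lhex v u else lhex u v.

(* The spoke at c leaves the region, on the right if o and on the left otherwise,
   and it is an edge below x of the chain of x. *)
Definition chain_cross (o : bool) (p c q x : hex_point) : bool :=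
  [&& spoke_out o p c q, (third_neighbour p c q).2 != c.2,
      divz (2 * x.1 + x.2) 3 == divz (2 * c.1 + c.2) 3 &
      (c.2 < x.2) || ((third_neighbour p c q).2 < x.2)].

Definition under_rung (x h : hex_point) : bool :=
  (2 * h.1 + h.2 == 2 * x.1 + x.2 + 1) && (h.2 < x.2).

(** At the vertex c the path of outer hexagons either stays or crosses the spoke. It enters or
    leaves the part of the column below the edge from x to its right end through the chain below one
    of these two ends, or through this edge itself. *)
Lemma chain_cross_rung o p c q x :
  hex_adjacent p c -> hex_adjacent c q -> p != q -> class1 x ->
  (chain_cross o p c q x (+) chain_cross o p c q (right_end x))
    (+) (spoke_out o p c q && same_edge x (right_end x) c (third_neighbour p c q))
  = under_rung x (side_hex o p c) (+) under_rung x (side_hex o c q).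
Proof.
rewrite hex_adjacent_sym => hp hq; adj_cases hp; adj_cases hq; move: o;
case: c x {hp hq} => [a b] [c d] /=; rewrite xpair_eqE /class1 /= => -[] h1 h2 pq /eqP h3;
try (exfalso; lia); clear pq;
rewrite /chain_cross /spoke_out /side_hex /same_edge /under_rung /right_end
  /third_neighbour /turn /lhex !xpair_eqE /=.
all: bool_solve.
Qed.

Lemma chain_cross_up o p c q x :
  hex_adjacent p c -> hex_adjacent c q -> p != q -> hex_vertex x ->
  chain_cross o p c q (chain_up x) (+) chain_cross o p c q x
  = spoke_out o p c q && same_edge x (chain_up x) c (third_neighbour p c q).
Proof.
rewrite hex_adjacent_sym => hp hq; adj_cases hp; adj_cases hq;
case: c x {hp hq} => [a b] [c d] /=;
  rewrite xpair_eqE /hex_vertex /chain_up /class1 /= => h1 h2 pq h3;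
try (exfalso; lia); clear pq;
rewrite /chain_cross; case: (spoke_out _ _ _ _) => //=;
rewrite /same_edge /third_neighbour /turn !xpair_eqE /=; case: ifP => h4;
  rewrite ?xpair_eqE /=.
all: bool_solve.
Qed.

(** The height of s exceeds that of c by 1, - 1 or 0, and the weight is [c.2 + 1], [- c.2] or 0
    accordingly; the right side is a form of it without branching, which the program evaluates. *)
Lemma third_neighbour_weight c s : hex_adjacent c s ->
  (c.2 + 1) * (chain_up c == s)%:Z - c.2 * (chain_down c == s)%:Z =
  (s.2 - c.2) * c.2 + (s.2 - c.2 == 1)%:Z.
Proof.
move=> h; adj_cases h; case: c {h} => a b /= h; rewrite /chain_up /chain_down /class1 /=.
all: case: ifP => h'; rewrite ?xpair_eqE /=; try (exfalso; lia).
all: bool_solve; lia.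
Qed.

Section InnerGraphs.
Implicit Types (x y c u v : hex_point) (i j k l : nat).

Definition inner_adj z n (x y : hex_point) : bool :=
  hex_adjacent x y && (inside z n (lhex x y) || inside z n (lhex y x)).

Lemma inner_adjC z n x y : inner_adj z n x y = inner_adj z n y x.
Proof. by rewrite /inner_adj hex_adjacent_sym orbC. Qed.

Lemma adjacent_inner z n x y : adjacent (inner_graph z n) x y = inner_adj z n x y.
Proof.
apply/asboolP/idP; rewrite /= /inner_edge /inner_adj /hex_adjacent /=.
  by case=> /andP[-> /orP[]->]; rewrite ?orbT.
by case/andP => /orP[] -> /orP[] -> ; rewrite ?orbT; by [left|right].
Qed.

Definition horizontal (z : nat -> hex_point) k : bool := (z k).2 == (z k.+1).2.

(** For a horizontal edge this is twice the abscissa of its midpoint, and so identifies its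
    column. *)
Definition line (z : nat -> hex_point) k : int := (z k).1 + (z k.+1).1 + (z k).2.

Definition below z l k : bool :=
  [&& horizontal z l, line z l == line z k & (z l).2 < (z k).2].

Definition open_below z n k : bool :=
  \big[addb/false]_(0 <= l < n) below z l k.

(* The edges i and k are the lower and upper end of the same cut. *)
Definition matched z n i k : bool :=
  [&& horizontal z k, below z i k, open_below z n k &
      all (fun l => ~~ (below z i l && below z l k)) (iota 0 n)].

(** Meant for the left end x of a horizontal edge, whose column is [2 * x.1 + x.2 + 1]. *)
Definition on_cut z i k x : bool :=
  [&& 2 * x.1 + x.2 + 1 == line z i, (z i).2 <= x.2 & x.2 <= (z k).2].

Section Side.
Variables (z : nat -> hex_point) (n : nat).
Hypothesis Hz : lattice_cycle z n.
Local Notation inside := (inside z n).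
Local Notation cedge := (cycle_edge z n).
Local Notation iadj := (inner_adj z n).
Local Notation o := (inside (lhex (z 0) (z 1))).
Local Notation spoke k := (third_neighbour (z k) (z k.+1) (z k.+2)).
Local Notation ext k := (spoke_out o (z k) (z k.+1) (z k.+2)).
Local Notation outer := (outer z o).
Local Notation horizontal := (horizontal z).
Local Notation line := (line z).
Local Notation matched := (matched z n).

Lemma inner_adj_cycle u v : cedge u v -> iadj u v.
Proof.
move=> h; have uv := cycle_edge_adj Hz h; rewrite /inner_adj uv /=.
by have := inside_step Hz uv; rewrite h; case: (inside _).
Qed.

Lemma inner_adj_spoke k : iadj (z k.+1) (spoke k) = ~~ ext k.
Proof.
have [hs h] := turn_cases (cycle_adj Hz k) (cycle_adj Hz k.+1) (cycle_neq2 Hz k).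
have := inside_step Hz hs; rewrite (not_spoke_edge Hz) /inner_adj hs /=.
have l1 := inside_left Hz k; have l2 := inside_left Hz k.+1.
have r1 := inside_right Hz k; have r2 := inside_right Hz k.+1.
rewrite /spoke_out.
case: h => [[-> [e1 e2 e3]]|[-> [e1 e2 e3]]].
  by rewrite e3 r1 -e2 r2; case: (o).
by rewrite -e1 e2 l1 l2; case: (o).
Qed.

Lemma inner_adj_ext k x y : iadj x y ->
  ext k && same_edge x y (z k.+1) (spoke k) = false.
Proof.
move=> xy; apply: negbTE; apply/negP => /andP[h hs].
have := inner_adj_spoke k; rewrite h.
by case/orP: hs => /andP[/eqP <- /eqP <-]; rewrite ?xy // inner_adjC xy.
Qed.

(* The parity of the number of crossings between the chain going down from x and
   the path of outer hexagons along the arc of the cycle from the edge i to the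
   edge j. *)
Definition side (i j : nat) (x : hex_point) : bool :=
  \big[addb/false]_(i <= k < j) chain_cross o (z k) (z k.+1) (z k.+2) x.

Lemma side_up i j x : hex_vertex x -> iadj x (chain_up x) ->
  side i j (chain_up x) = side i j x.
Proof.
move=> hx xy; apply: eq_bigr => k _.
have := chain_cross_up o (cycle_adj Hz k) (cycle_adj Hz k.+1) (cycle_neq2 Hz k) hx.
by rewrite inner_adj_ext //; case: (chain_cross _ _ _ _ _) (chain_cross _ _ _ _ _) => [] [].
Qed.

Lemma side_rung i j x : (i <= j)%N -> class1 x -> iadj x (right_end x) ->
  side i j x (+) side i j (right_end x) =
  under_rung x (outer i) (+) under_rung x (outer j).
Proof.
move=> ij hx xy; rewrite /side -big_split /=.
apply: (addb_telescope (t := fun k => under_rung x (outer k))) => // k _.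
rewrite -(chain_cross_rung o (cycle_adj Hz k) (cycle_adj Hz k.+1) (cycle_neq2 Hz k) hx).
by rewrite inner_adj_ext // addbF.
Qed.

Lemma horizontal_step k : horizontal k ->
  [/\ exists a : int, line k = 2 * a + 1 + (z k).2, (z k.+1).2 = (z k).2 &
      (z k.+1).1 = (z k).1 + 1 \/ (z k.+1).1 = (z k).1 - 1].
Proof.
rewrite /horizontal /line => /eqP h; have a := cycle_adj Hz k; move: h.
adj_cases a => _ /= h; split; try lia; try by [left|right].
  by exists (z k).1; lia.
by exists ((z k).1 - 1); lia.
Qed.

Lemma rung_inj k l : (k < n)%N -> (l < n)%N -> horizontal k -> horizontal l ->
  line k = line l -> (z k).2 = (z l).2 -> k = l.
Proof.
move=> kn ln hk hl e1 e2; apply: (same_edge_inj Hz kn ln).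
have [_ e3 e4] := horizontal_step hk; have [_ e5 e6] := horizontal_step hl.
move: e1 e2 e3 e4 e5 e6; rewrite /line /same_edge.
case: (z k) (z k.+1) (z l) (z l.+1) => [a b] [a' b'] [c d] [c' d'] /=.
by rewrite !xpair_eqE; clear; lia.
Qed.

Lemma matched_rel i k : matched i k ->
  [/\ horizontal i, horizontal k, line i = line k & (z i).2 + 2 <= (z k).2].
Proof.
move=> /and4P[hk /and3P[hi /eqP e h] _ _]; split=> //.
have [[a ha] _ _] := horizontal_step hk; have [[b hb] _ _] := horizontal_step hi.
by lia.
Qed.

Lemma matched_between i k l : matched i k -> (l < n)%N -> horizontal l ->
  line l = line i -> (z i).2 < (z l).2 -> (z l).2 < (z k).2 -> False.
Proof.
move=> m ln hl e h1 h2; have [hi hk e' _] := matched_rel m.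
case/and4P: m => _ _ _ /allP /(_ l); rewrite mem_iota ln => /(_ isT).
by rewrite /below hi hl -e' e eqxx h1 h2.
Qed.

(** No edge of Z lies between i and k in their column, so the edges below c are those below k, odd
    in number. *)
Lemma inside_cut i k c : matched i k -> 2 * c.1 + c.2 = line i ->
  (z i).2 < c.2 -> c.2 < (z k).2 -> inside c.
Proof.
move=> m e h1 h2; have [hi hk e' _] := matched_rel m.
suff -> : inside c = open_below z n k by case/and4P: m.
apply: eq_big_nat => l /= ln.
rewrite /rung_below /below -/(horizontal l) -/(line l) e e'.
case hl : (horizontal l) => //=; case: eqP => //= el.
have [[a ha] _ _] := horizontal_step hk; have [[b hb] _ _] := horizontal_step hl.
apply/idP/idP => [|h3]; first by lia.
rewrite ltNge; apply/negP => h4; apply: (matched_between m ln hl) => //; last by lia.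
by rewrite el.
Qed.

Lemma outer_rung k : horizontal k -> 2 * (outer k).1 + (outer k).2 = line k /\
  ((outer k).2 = (z k).2 - 1 \/ (outer k).2 = (z k).2 + 1).
Proof.
move=> hk; have [_ e1 e2] := horizontal_step hk.
have -> : outer k = if o then lhex (z k.+1) (z k) else lhex (z k) (z k.+1) by [].
by rewrite /line; case: (o); rewrite /lhex /=; lia.
Qed.

Lemma matched_outer i k : matched i k ->
  (outer i).2 = (z i).2 - 1 /\ (outer k).2 = (z k).2 + 1.
Proof.
move=> m; have [hi hk e h] := matched_rel m.
have [l1 b1] := outer_rung hi; have [l2 b2] := outer_rung hk.
split.
  case: b1 => // b1; have := inside_outer Hz i.
  by rewrite (inside_cut m) //; lia.
case: b2 => // b2; have := inside_outer Hz k.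
by rewrite (inside_cut m) //; lia.
Qed.

(** The outer hexagon of i is just below i and that of k just above k, as the hexagons between are
    inside. So an edge of this column is above exactly one of the two precisely when it belongs to
    the cut. *)
Lemma matched_under_rung i k x : matched i k -> class1 x ->
  under_rung x (outer i) (+) under_rung x (outer k) = on_cut z i k x.
Proof.
move=> m hx; have [hi hk e h] := matched_rel m.
have [l1 _] := outer_rung hi; have [l2 _] := outer_rung hk.
have [b1 b2] := matched_outer m.
rewrite /under_rung /on_cut l1 l2 -e b1 b2 [line i == _]eq_sym.
case: eqP => //= ex; have [[a ha] _ _] := horizontal_step hk.
by rewrite e in ex; move: ex ha h; clear; lia.
Qed.

Definition cut_side i k := side (minn i k) (maxn i k).

(** By [side_rung], a horizontal edge of G separates the sides when just one of the outer hexagons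
    of i and k is below it in its column. Together with [cut_side_chain], this makes the cut the set
    of all edges between the two sides. *)
Lemma cut_side_rung i k x : matched i k -> class1 x -> iadj x (right_end x) ->
  cut_side i k x (+) cut_side i k (right_end x) = on_cut z i k x.
Proof.
move=> m hx xy; rewrite /cut_side side_rung //; last by lia.
rewrite -(matched_under_rung m hx); case: (leqP i k) => // _.
by rewrite addbC.
Qed.

Lemma adj_up x y : hex_adjacent x y -> x.2 != y.2 -> y = chain_up x \/ x = chain_up y.
Proof.
move=> h; adj_cases h; case: x {h} => a b /= h; rewrite /chain_up /class1 /= => h';
  try (exfalso; lia).
- by right; case: ifP => h2; [exfalso; lia|congr pair; lia].
- by left; rewrite h eqxx.
- by left; rewrite h.
- right; case: ifP => h2; [congr pair; lia|exfalso; lia].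
Qed.

Lemma adj_right_end x y : hex_adjacent x y -> x.2 = y.2 ->
  (class1 x /\ y = right_end x) \/ (class1 y /\ x = right_end y).
Proof.
move=> h; adj_cases h; case: x {h} => a b /= h; rewrite /right_end /class1 /= => h';
  try (exfalso; lia).
- by left; rewrite h eqxx.
- by right; split; [lia|congr pair; lia].
Qed.

Lemma adj_vertex x y : hex_adjacent x y -> hex_vertex x.
Proof.
move=> h; case: (hex_adjacent_cases h) => -[e _]; rewrite /hex_vertex;
  move: e; move: (x.1 - x.2); lia.
Qed.

Lemma cut_side_chain i k x y : iadj x y -> x.2 != y.2 ->
  cut_side i k x = cut_side i k y.
Proof.
move=> xy h; have /andP[a _] := xy; have a' := a; rewrite hex_adjacent_sym in a'.
by case: (adj_up a h) xy => ->; [|rewrite inner_adjC] => xy;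
  rewrite /cut_side side_up //; apply: adj_vertex; eassumption.
Qed.

Lemma cut_side_cycle i k l : matched i k -> (i < n)%N -> (k < n)%N -> (l < n)%N ->
  cut_side i k (z l) (+) cut_side i k (z l.+1) = (l == i) (+) (l == k).
Proof.
move=> m ki kn ln; have [hi hk e h] := matched_rel m.
have hl := inner_adj_cycle (cycle_edge_z Hz l); have /andP[a _] := hl.
have [hor|nhor] := boolP (horizontal l); last first.
  rewrite (cut_side_chain i k hl nhor) addbb.
  have -> : (l == i) = false by apply: contraNF nhor => /eqP ->.
  by have -> : (l == k) = false by apply: contraNF nhor => /eqP ->.
have cut x : class1 x -> 2 * x.1 + x.2 + 1 = line l -> x.2 = (z l).2 ->
    on_cut z i k x = (l == i) (+) (l == k).
  move=> _ e1 e2; rewrite /on_cut e1 e2; have [el|nel] := eqVneq (line l) (line i);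
    last first.
    have -> : (l == i) = false by apply: contraNF nel => /eqP ->.
    have -> : (l == k) = false by apply: contraNF nel => /eqP ->; rewrite e.
    by [].
  have [->|nli] := eqVneq l i.
    have -> : (i == k) = false by apply/eqP => eik; rewrite eik in h; lia.
    by rewrite /=; lia.
  have [->|nlk] := eqVneq l k; first by rewrite /=; lia.
  apply: negbTE; apply/negP => /= /andP[h1 h2].
  apply: (@matched_between i k l) => //.
    rewrite lt_neqAle h1 andbT; apply: contraNneq nli => eb.
    by apply/eqP; apply: rung_inj.
  rewrite lt_neqAle h2 andbT; apply: contraNneq nlk => eb.
  by apply/eqP; apply: rung_inj => //; rewrite el.
move/eqP: hor => hor'; have [[c e1]|[c e1]] := adj_right_end a hor'.
  rewrite e1 (cut_side_rung m) -?e1 //; apply: cut => //.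
  by rewrite /line e1 /=; lia.
rewrite e1 addbC (cut_side_rung m) -?e1 1?inner_adjC //; apply: cut => //.
by rewrite /line hor' [in RHS]e1 /=; lia.
Qed.

(** Along Z the side changes only across the edges i and k. The edge i joins [z i] to [z i.+1],
    hence the strict lower bound and the inclusive upper one. *)
Lemma cut_side_arc i k l : matched i k -> (i < n)%N -> (k < n)%N -> (l <= n)%N ->
  cut_side i k (z l) (+) cut_side i k (z 0) = (minn i k < l <= maxn i k)%N.
Proof.
move=> m ki kn; elim: l => [|l IH] ln; first by rewrite addbb ltn0.
have := cut_side_cycle m ki kn ln; have := IH (ltnW ln).
have [_ _ _ h] := matched_rel m.
have ik : i != k by apply/eqP => e; rewrite e in h; lia.
case: (cut_side i k (z l)) (cut_side i k (z l.+1)) (cut_side i k (z 0)) => [] [] [] /=; lia.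
Qed.

End Side.

Lemma chain_down_adj x : hex_vertex x -> hex_adjacent x (chain_down x).
Proof.
case: x => a b; rewrite /hex_vertex /chain_down /class1 /hex_adjacent /hex_edge !inE
  !xpair_eqE /=.
by case: ifP => h h' /=; lia.
Qed.

Lemma chain_up_adj x : hex_vertex x -> hex_adjacent x (chain_up x).
Proof.
case: x => a b; rewrite /hex_vertex /chain_up /class1 /hex_adjacent /hex_edge !inE
  !xpair_eqE /=.
by case: ifP => h h' /=; lia.
Qed.

Lemma chain_down_height x : (chain_down x).2 = x.2 - 1.
Proof. by rewrite /chain_down; case: ifP. Qed.

Lemma chain_up_height x : (chain_up x).2 = x.2 + 1.
Proof. by rewrite /chain_up; case: ifP. Qed.

(** * Distances to the two ends of an edge of a cut *)

Section Distance.
Variables (z : nat -> hex_point) (n : nat).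
Hypothesis Hz : lattice_cycle z n.
Local Notation inside := (inside z n).
Local Notation iadj := (inner_adj z n).
Local Notation G := (inner_graph z n).
Local Notation ivert := (inner_vertex z n).

Lemma inner_adj_vertex x y : iadj x y -> ivert x.
Proof.
case/andP => xy /orP[h|h]; apply/inner_vertexP; first by exists y.
(* The neighbour w of x such that [lhex x w = lhex y x]. *)
exists (x.1 - x.2 + y.2, x.1 + 2 * x.2 - y.1 - y.2).
  adj_cases xy; case: x {xy h} => a b /= h;
    rewrite /hex_adjacent /hex_edge !inE !xpair_eqE /=; lia.
move: h; congr (is_true (inside _)); rewrite /lhex /=.
by congr pair; lia.
Qed.

Lemma inner_adj_off_cycle x v : ivert x -> ~~ on_cycle z n x ->
  hex_adjacent x v -> iadj x v.
Proof.
move=> /inner_vertexP[w xw hw] nx xv; rewrite /inner_adj xv /=.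
have nedge y : cycle_edge z n x y = false.
  apply: contraNF nx => /(cycle_edgeP Hz)[k [] [e1 e2]]; apply/(on_cycleP Hz).
    by exists k.
  by exists k.+1.
have [->|vw] := eqVneq v w; first by rewrite hw.
have vx := xv; rewrite hex_adjacent_sym in vx.
have := inside_step Hz xw; rewrite nedge hw.
have := inside_step Hz xv; rewrite nedge.
have [_] := turn_cases vx xw vw.
by case=> [[_ [-> _ _]]|[_ [_ _ ->]]]; rewrite ?hw; case: (inside _) (inside _) => [] [].
Qed.

Lemma inner_vertex_hex x : ivert x -> hex_vertex x.
Proof. by case/inner_vertexP => v /adj_vertex. Qed.

Lemma inner_vertex_cycle k : ivert (z k).
Proof. exact: inner_adj_vertex (inner_adj_cycle Hz (cycle_edge_z Hz k)). Qed.

Lemma inner_vertex_bounded : exists m : nat, forall x, ivert x ->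
  `|x.1| <= m%:Z /\ `|x.2| <= m%:Z.
Proof.
have [m [m0 hm]] := inside_bounded Hz.
exists (`|m|%N + 2)%N => x /inner_vertexP[v xv /(hm _ (lhex_centre xv))].
adj_cases xv => _; rewrite /lhex /=; case: x {xv} => a b /=; lia.
Qed.

(** A vertex off Z keeps its three edges in G, so its chain can be followed downwards until it meets
    Z; it does, as G is bounded. *)
Lemma walk_to_cycle x : ivert x -> exists k, walk G k x (z 0).
Proof.
have [m hm] := inner_vertex_bounded.
have [d] := ubnP `|(x.2 + m%:Z)%R|%N; elim: d x => // d IH x hd hx.
have [/(on_cycleP Hz)[k ->]|off] := boolP (on_cycle z n x).
  exists k; apply: walk_rev; elim: k {hd hx} => [|k h]; first exact: walk0.
  rewrite -addn1; apply: walk_cat h (walk1 _); rewrite adjacent_inner addn1.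
  exact: inner_adj_cycle (cycle_edge_z Hz k).
have xd := inner_adj_off_cycle hx off (chain_down_adj (inner_vertex_hex hx)).
have hd' : ivert (chain_down x) by apply: (inner_adj_vertex (y := x)); rewrite inner_adjC.
have [|k hk] := IH (chain_down x) _ hd'.
  by have [_] := hm _ hd'; have [_] := hm _ hx; rewrite chain_down_height; lia.
by exists (1 + k)%N; apply: walk_cat hk; apply: walk1; rewrite adjacent_inner.
Qed.

Lemma inner_connected x y : ivert x -> ivert y -> exists k, walk G k x y.
Proof.
move=> /walk_to_cycle[k hk] /walk_to_cycle[l /walk_rev hl].
by exists (k + l)%N; exact: walk_cat hl.
Qed.

Lemma path_height (p : seq hex_point) x :
  path (adjacent G) x p -> `|x.2 - (last x p).2| <= (size p)%:Z.
Proof.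
elim: p x => [|a p IH] x /=; first by rewrite subrr.
rewrite adjacent_inner => /andP[/andP[xa _] /IH].
suff : `|x.2 - a.2| <= 1 by lia.
by adj_cases xa; rewrite /=; lia.
Qed.

Lemma walk_height k x y : walk G k x y -> `|x.2 - y.2| <= k%:Z.
Proof. by move=> [p [/path_height + <- <-]]. Qed.

Section Cut.
Variables (i k : nat).
Hypothesis Hm : matched z n i k.
Local Notation S := (cut_side z n i k).
Local Notation cut := (on_cut z i k).

(** The hexagon between two consecutive edges of the cut is inside, so its four slanted sides, two
    on the left and two on the right, belong to G. *)
Lemma cut_step x : class1 x -> cut x -> cut (x.1 - 1, x.2 + 2) ->
  let x' := (x.1 - 1, x.2 + 2) in
  [/\ walk G 2 x x', walk G 2 (right_end x) (right_end x') & S x = S x'].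
Proof.
move=> cx hx hx' /=.
have hin : inside (x.1, x.2 + 1).
  move: hx hx'; rewrite /on_cut /= => /and3P[/eqP h1 h2 h3] /and3P[/eqP _ _ h4].
  by apply: (inside_cut Hz Hm); rewrite /=; lia.
have adj u v : hex_adjacent u v ->
  lhex u v = (x.1, x.2 + 1) \/ lhex v u = (x.1, x.2 + 1) -> iadj u v.
  by move=> uv [] e; rewrite /inner_adj uv e hin ?orbT.
have two u v w : iadj u v -> iadj v w -> walk G 2 u w.
  by move=> uv vw; apply: (@walk_cat _ G 1 1 u v w); apply: walk1; rewrite adjacent_inner.
move: cx; rewrite /class1 => cx.
have e1 : iadj x (x.1 - 1, x.2 + 1).
  apply: adj; last by right; rewrite /lhex /=; congr pair; lia.
  move: cx; clear; case: x => a b; rewrite /hex_adjacent /hex_edge !inE !xpair_eqE /=; lia.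
have e2 : iadj (x.1 - 1, x.2 + 1) (x.1 - 1, x.2 + 2).
  apply: adj; last by right; rewrite /lhex /=; congr pair; lia.
  move: cx; clear; case: x => a b; rewrite /hex_adjacent /hex_edge !inE !xpair_eqE /=; lia.
split; first exact: two e1 e2.
  apply: (two _ (x.1 + 1, x.2 + 1)); apply: adj; rewrite /right_end /=.
  - by move: cx; clear; case: x => a b;
    rewrite /hex_adjacent /hex_edge !inE !xpair_eqE /=; lia.
  - by left; rewrite /lhex /=; congr pair; lia.
  - by move: cx; clear; case: x => a b;
    rewrite /hex_adjacent /hex_edge !inE !xpair_eqE /=; lia.
  - by left; rewrite /lhex /=; congr pair; lia.
rewrite (cut_side_chain Hz i k e1); last by apply/eqP => /=; lia.
by rewrite (cut_side_chain Hz i k e2) //; apply/eqP => /=; lia.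
Qed.

Lemma cut_chain t x : class1 x -> cut x -> cut (x.1 - t%:Z, x.2 + 2 * t%:Z) ->
  let x' := (x.1 - t%:Z, x.2 + 2 * t%:Z) in
  [/\ walk G (2 * t) x x', walk G (2 * t) (right_end x) (right_end x') & S x = S x'].
Proof.
elim: t x => [|t IH] x cx hx hx' /=.
  have -> : (x.1 - 0, x.2 + 2 * 0) = x.
    by rewrite subr0 mulr0 addr0 -surjective_pairing.
  by split=> //; exact: walk0.
pose y : hex_point := (x.1 - 1, x.2 + 2).
have ey : (x.1 - t.+1%:Z, x.2 + 2 * t.+1%:Z) = (y.1 - t%:Z, y.2 + 2 * t%:Z).
  by rewrite /y /=; congr pair; lia.
have hy : cut y.
  by move: hx hx'; rewrite /on_cut /y /= => /and3P[h1 h2 h3] /and3P[h4 h5 h6];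
    apply/and3P; split; lia.
have cy : class1 y by move: cx; rewrite /class1 /y /=; lia.
have [w1 w2 e] := cut_step cx hx hy.
rewrite ey in hx' *; have [w3 w4 e'] := IH y cy hy hx'.
by rewrite mulnS e; split=> //; [exact: walk_cat w1 w3|exact: walk_cat w2 w4].
Qed.

(** The walks follow the cut; their length is the difference of heights, which by [walk_height] no
    walk of G can beat. *)
Lemma cut_walk x y : class1 x -> class1 y -> cut x -> cut y ->
  [/\ walk G `|(x.2 - y.2)%R|%N x y, walk G `|(x.2 - y.2)%R|%N (right_end x) (right_end y)
   & S x = S y].
Proof.
have main a b : class1 a -> cut a -> cut b -> a.2 <= b.2 ->
    [/\ walk G `|(a.2 - b.2)%R|%N a b,
      walk G `|(a.2 - b.2)%R|%N (right_end a) (right_end b) & S a = S b].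
  move=> ca ha hb ab.
  have [t ht] : exists t : nat, a.1 - b.1 = t%:Z.
    exists `|(a.1 - b.1)%R|%N; move: ha hb;
      rewrite /on_cut => /and3P[/eqP h1 _ _] /and3P[/eqP h2 _ _].
    by lia.
  have eb : b = (a.1 - t%:Z, a.2 + 2 * t%:Z).
    move: ha hb; rewrite /on_cut => /and3P[/eqP h1 _ _] /and3P[/eqP h2 _ _].
    by rewrite [LHS]surjective_pairing; congr pair; lia.
  have et : `|(a.2 - b.2)%R|%N = (2 * t)%N by rewrite eb /=; lia.
  by rewrite et; rewrite eb in hb *; exact: cut_chain.
move=> cx cy hx hy; have [h|h] := leP x.2 y.2; first exact: main.
have [w1 w2 e] := main _ _ cy hy hx (ltW h).
by rewrite distnC; split=> //; exact: walk_rev.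
Qed.

Lemma cross_cut a b : iadj a b -> S a != S b ->
  (class1 a /\ b = right_end a /\ cut a) \/ (class1 b /\ a = right_end b /\ cut b).
Proof.
move=> ab nS; have /andP[adj _] := ab.
have [h|h] := eqVneq a.2 b.2; last by move: nS; rewrite (cut_side_chain Hz i k ab h) eqxx.
have [[c e]|[c e]] := adj_right_end adj h.
  have := cut_side_rung Hz Hm c; rewrite -e => /(_ ab) hs; left; split=> //; split=> //.
  by rewrite -hs; move: nS; case: (S a) (S b) => [] [].
have := cut_side_rung Hz Hm c; rewrite -e inner_adjC => /(_ ab) hs; right; split=> //;
  split=> //.
by rewrite -hs; move: nS; case: (S a) (S b) => [] [].
Qed.

Variable u : hex_point.
Hypotheses (Hc : class1 u) (Hcut : cut u) (Huv : iadj u (right_end u)).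
Let v := right_end u.

Lemma cut_ends : S v = ~~ S u.
Proof.
by have := cut_side_rung Hz Hm Hc Huv; rewrite Hcut -/v; case: (S u) (S v) => [] [].
Qed.

(** A walk leaves the side of u along an edge ab of the cut. The walk along the cut from a to u is
    as short as any walk from b to v, since a and b have the same height, and u and v too. *)
Lemma dist_left x : ivert x -> S x = S u -> (dist G x u < dist G x v)%N.
Proof.
move=> hx xu; apply: (@dist_lt_side _ G S) => //; last 2 first.
- by rewrite cut_ends; case: (S u).
- by apply: inner_connected => //; apply: (inner_adj_vertex (y := u)); rewrite inner_adjC.
move=> a b; rewrite adjacent_inner => ab sa sb.
have [[ca [e ha]]|[cb [e hb]]] : _ := cross_cut ab (eq_ind_r (fun s =>
  s != _) (contra_neq esym sb) sa).
  have [w _ _] := cut_walk ca Hc ha Hcut; exists `|(a.2 - u.2)%R|%N => // m /walk_height.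
  by rewrite e /v /right_end /=; clear; lia.
by have [_ _ sbu] := cut_walk cb Hc hb Hcut; rewrite sbu eqxx in sb.
Qed.

Lemma dist_right x : ivert x -> S x = S v -> (dist G x v < dist G x u)%N.
Proof.
move=> hx xv; apply: (@dist_lt_side _ G S) => //; last 2 first.
- by rewrite cut_ends; case: (S u).
- by apply: inner_connected => //; exact: inner_adj_vertex Huv.
move=> a b; rewrite adjacent_inner => ab sa sb.
have [[ca [e ha]]|[cb [e hb]]] : _ := cross_cut ab (eq_ind_r (fun s =>
  s != _) (contra_neq esym sb) sa).
  have [_ _ sau] := cut_walk ca Hc ha Hcut.
  by move: sa; rewrite sau cut_ends; case: (S u).
have [_ w _] := cut_walk cb Hc hb Hcut; exists `|(b.2 - u.2)%R|%N => [|m /walk_height].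
  by rewrite e.
by rewrite /right_end /=; clear; lia.
Qed.

Lemma N1_cut : N1 G (u, v) = [set x | ivert x /\ S x = S u]%classic.
Proof.
apply/seteqP; split=> x [/= hx h]; split=> //; last exact: dist_left.
apply: contraTeq h => h; rewrite -leqNgt ltnW //; apply: dist_right => //.
by rewrite cut_ends; move: h; case: (S x) (S u) => [] [].
Qed.

Lemma N2_cut : N2 G (u, v) = [set x | ivert x /\ S x != S u]%classic.
Proof.
apply/seteqP; split=> x [/= hx h]; split=> //.
  by apply: contraTneq h => h; rewrite -leqNgt ltnW //; exact: dist_left.
by apply: dist_right => //; rewrite cut_ends; move: h; case: (S x) (S u) => [] [].
Qed.

End Cut.
End Distance.

(** * Counting the vertices on a side *)

Local Open Scope fset_scope.
Local Open Scope ring_scope.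

Implicit Types A : {fset hex_point}.

Lemma chain_upK x : hex_vertex x -> chain_down (chain_up x) = x.
Proof.
case: x => a b; rewrite /hex_vertex /chain_up {1}/class1 /= => h.
by case: ifP => h1; rewrite /chain_down /class1 /=; case: ifP => h2;
  try (exfalso; lia); congr pair; lia.
Qed.

Lemma chain_downK x : hex_vertex x -> chain_up (chain_down x) = x.
Proof.
case: x => a b; rewrite /hex_vertex /chain_down {1}/class1 /= => h.
by case: ifP => h1; rewrite /chain_up /class1 /=; case: ifP => h2;
  try (exfalso; lia); congr pair; lia.
Qed.

(* The two sides count the chain edges of E by their upper and lower ends. *)
Lemma chain_sum A (E : rel hex_point) : symmetric E ->
  (forall x, x \in A -> hex_vertex x) ->
  (forall x, x \in A -> E x (chain_up x) -> chain_up x \in A) ->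
  (forall x, x \in A -> E x (chain_down x) -> chain_down x \in A) ->
  \sum_(x <- A) ((x.2 + 1) * (E x (chain_up x))%:Z - x.2 * (E x (chain_down x))%:Z) = 0.
Proof.
move=> symE hA hup hdown; rewrite sumrB; apply/eqP; rewrite subr_eq0; apply/eqP.
have mask (f : hex_point -> int) (P : pred hex_point) :
    \sum_(x <- A) f x * (P x)%:Z = \sum_(x <- [seq x <- A | P x]) f x.
  rewrite big_filter [RHS]big_mkcond; apply: eq_bigr => x _.
  by case: (P x); rewrite ?mulr1 ?mulr0.
rewrite (mask (fun x => x.2 + 1) (fun x => E x (chain_up x))).
rewrite (mask snd (fun x => E x (chain_down x))).
rewrite (eq_bigr (fun x => (chain_up x).2)) => [|x _]; last by rewrite chain_up_height.
rewrite -(big_map chain_up xpredT snd); apply: perm_big; apply: uniq_perm.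
- rewrite map_inj_in_uniq ?filter_uniq ?fset_uniq // => x y.
  rewrite !mem_filter => /andP[_ /hA hx] /andP[_ /hA hy] e.
  by rewrite -(chain_upK hx) e chain_upK.
- by rewrite filter_uniq ?fset_uniq.
move=> y; rewrite mem_filter; apply/mapP/andP.
  move=> [x]; rewrite mem_filter => /andP[ex xA] ->.
  have hx := hA x xA; rewrite (chain_upK hx) symE; split; first exact: ex.
  exact: (hup x xA ex).
move=> [ey yA]; have hy := hA y yA; exists (chain_down y).
  by rewrite mem_filter (chain_downK hy) symE ey (hdown y yA ey).
by rewrite (chain_downK hy).
Qed.

(** Each vertex counts for [(x.2 + 1) - x.2], one term for the edge above it and one for the edge
    below. By [chain_sum] the edges of E contribute 0 in all, and only the missing ones remain. *)
Lemma card_chain_sum A (E : rel hex_point) : symmetric E ->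
  (forall x, x \in A -> hex_vertex x) ->
  (forall x, x \in A -> E x (chain_up x) -> chain_up x \in A) ->
  (forall x, x \in A -> E x (chain_down x) -> chain_down x \in A) ->
  #|` A|%:Z = \sum_(x <- A)
    ((x.2 + 1) * (~~ E x (chain_up x))%:Z - x.2 * (~~ E x (chain_down x))%:Z).
Proof.
move=> symE hA hup hdown; have h0 := chain_sum symE hA hup hdown.
transitivity (\sum_(x <- A) (1 : int)).
  by rewrite big_const_seq count_predT iter_addr_0 natz.
rewrite -[RHS]addr0 -[X in _ = _ + X]h0 -big_split /=; apply: eq_bigr => x _.
by case: (E _ _) (E _ _) => [] [] /=; ring.
Qed.

Lemma neighbour_cases p c q v : hex_adjacent p c -> hex_adjacent c q -> p != q ->
  hex_adjacent c v -> [\/ v = p, v = q | v = third_neighbour p c q].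
Proof.
rewrite hex_adjacent_sym => hp hq pq hv; move: pq.
adj_cases hp; adj_cases hq; case: (hex_adjacent_cases hv) => -[+ hv'];
case: c {hp hq hv} hv' => a b /= hv' h3 h2 h1; try (exfalso; move: h1 h2 h3; clear; lia);
case: hv' => ->; rewrite /third_neighbour !xpair_eqE /= => pq; clear h1 h2 h3;
try (exfalso; lia).
all: first [by apply: Or31; congr pair; lia | by apply: Or32; congr pair; lia
           | by apply: Or33; congr pair; lia].
Qed.

(* The contribution of the vertex z k.+1 if its spoke leaves the region: its height
   plus 1 if the spoke goes up, minus its height if it goes down. *)
Definition exit_weight (z : nat -> hex_point) k : int :=
  let s := 2 * (z k.+1).2 - (z k).2 - (z k.+2).2 in
  s * (z k.+1).2 + (s == 1)%:Z.

(** The term l belongs to the vertex [z l.+1]. So for i below k the difference of the values at k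
    and i covers the vertices from [z i.+1] to [z k], which form the arc between the edges i and
    k. *)
Definition prefix_weight (z : nat -> hex_point) (o : bool) k : int :=
  \sum_(0 <= l < k) (spoke_out o (z l) (z l.+1) (z l.+2))%:Z * exit_weight z l.

Section Count.
Variables (z : nat -> hex_point) (n : nat).
Hypothesis Hz : lattice_cycle z n.
Local Notation inside := (inside z n).
Local Notation iadj := (inner_adj z n).
Local Notation cedge := (cycle_edge z n).
Local Notation G := (inner_graph z n).
Local Notation ivert := (inner_vertex z n).
Local Notation o := (inside (lhex (z 0) (z 1))).
Local Notation spoke k := (third_neighbour (z k) (z k.+1) (z k.+2)).
Local Notation ext b k := (spoke_out b (z k) (z k.+1) (z k.+2)).

Lemma inner_fset : exists V : {fset hex_point}, forall x, (x \in V) = ivert x.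
Proof.
have [m hm] := inner_vertex_bounded Hz.
move: (box m) (mem_box m) => s hs.
exists [fset x in s | ivert x] => x; rewrite !inE andb_idl // => /hm[h1 h2].
by rewrite hs h1.
Qed.

Lemma cycle_sum A (g : hex_point -> int) :
  (forall x, x \in A -> ~~ on_cycle z n x -> g x = 0) ->
  \sum_(x <- A) g x = \sum_(0 <= l < n) (z l.+1 \in A)%:Z * g (z l.+1).
Proof.
move=> hg; rewrite (bigID (on_cycle z n)) /= [X in _ + X]big_seq_cond [X in _ + X]big1
  ?addr0; last first.
  by move=> x /andP[xA]; exact: hg.
transitivity (\sum_(x <- [seq z l.+1 | l <- iota 0 n] | x \in A) g x); last first.
  rewrite big_map big_mkcond /= /index_iota subn0; apply: eq_bigr => l _.
  by case: (_ \in _); rewrite ?mul1r ?mul0r.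
rewrite -[LHS]big_filter -[RHS]big_filter; apply: perm_big; apply: uniq_perm.
- by rewrite filter_uniq ?fset_uniq.
- rewrite filter_uniq // map_inj_in_uniq ?iota_uniq // => k l.
  rewrite !mem_iota /= !add0n => kn ln /(cycle_eq Hz) /eqP.
  by rewrite -[k.+1]addn1 -[l.+1]addn1 eqn_modDr !modn_small // => /eqP.
move=> x; rewrite !mem_filter andbC; case: (x \in A) => //=.
apply/(on_cycleP Hz)/mapP => [[k ->]|[l _ ->]]; last by exists l.+1.
exists ((k + n.-1) %% n)%N; rewrite ?mem_iota /= ?ltn_pmod ?(cycle_gt0 Hz) //.
apply: (cycle_eq_mod Hz); have n0 := cycle_gt0 Hz.
by rewrite -addn1 modnDml -addnA addn1 prednK // modnDr.
Qed.

Lemma spoke_neq k : z k != spoke k /\ z k.+2 != spoke k.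
Proof.
have h := not_spoke_edge Hz k; split; apply/negP => /eqP e; move: h; rewrite -e.
  by rewrite cycle_edgeC cycle_edge_z.
by rewrite cycle_edge_z.
Qed.

Lemma inner_adj_spokeE k v : hex_adjacent (z k.+1) v ->
  iadj (z k.+1) v = ~~ (ext o k && (v == spoke k)).
Proof.
have [n1 n2] := spoke_neq k.
move=> /(neighbour_cases (cycle_adj Hz k) (cycle_adj Hz k.+1) (cycle_neq2 Hz k))[] ->.
- by rewrite (negPf n1) andbF inner_adjC; apply: inner_adj_cycle (cycle_edge_z Hz k).
- by rewrite (negPf n2) andbF; apply: inner_adj_cycle (cycle_edge_z Hz k.+1).
- by rewrite inner_adj_spoke // eqxx andbT.
Qed.

Lemma ext_negb k : ext (~~ o) k = ~~ ext o k.
Proof.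
have [_ h] := turn_cases (cycle_adj Hz k) (cycle_adj Hz k.+1) (cycle_neq2 Hz k).
by rewrite /spoke_out; case: h => -[-> _]; case: (o).
Qed.

(** At a vertex of Z this keeps only a spoke that stays in the region, the kind which the wrong
    orientation counts. *)
Definition strict_adj x y := iadj x y && ~~ cedge x y.

Lemma strict_adj_spokeE k v : hex_adjacent (z k.+1) v ->
  strict_adj (z k.+1) v = ext (~~ o) k && (v == spoke k).
Proof.
have [n1 n2] := spoke_neq k.
rewrite /strict_adj ext_negb.
move=> /(neighbour_cases (cycle_adj Hz k) (cycle_adj Hz k.+1) (cycle_neq2 Hz k))[] ->.
- by rewrite (negPf n1) andbF cycle_edgeC cycle_edge_z // andbF.
- by rewrite (negPf n2) andbF cycle_edge_z // andbF.
- by rewrite inner_adj_spoke // (not_spoke_edge Hz) eqxx.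
Qed.

Lemma exit_weightE k : exit_weight z k =
  ((z k.+1).2 + 1) * (chain_up (z k.+1) == spoke k)%:Z
    - (z k.+1).2 * (chain_down (z k.+1) == spoke k)%:Z.
Proof.
have [hs _] := turn_cases (cycle_adj Hz k) (cycle_adj Hz k.+1) (cycle_neq2 Hz k).
rewrite (third_neighbour_weight hs) /exit_weight /third_neighbour /=.
have -> : 2 * (z k.+1).2 - (z k).2 - (z k.+2).2 =
  3 * (z k.+1).2 - (z k).2 - (z k.+2).2 - (z k.+1).2 by ring.
by [].
Qed.

(** A vertex off Z keeps both of its chain edges; a vertex of Z misses one only if this is its spoke
    and leaves the region. *)
Lemma card_weight A : (forall x, x \in A -> ivert x) ->
  (forall x y, x \in A -> iadj x y -> x.2 != y.2 -> y \in A) ->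
  #|` A|%:Z = \sum_(0 <= l < n) (z l.+1 \in A)%:Z * ((ext o l)%:Z * exit_weight z l).
Proof.
move=> hA cl; rewrite (card_chain_sum (inner_adjC z n)); first last.
- by move=> x xA h; apply: cl xA h _; rewrite chain_down_height; apply/eqP; lia.
- by move=> x xA h; apply: cl xA h _; rewrite chain_up_height; apply/eqP; lia.
- by move=> x /hA /inner_vertex_hex.
rewrite cycle_sum => [|x /hA hx off].
  apply: eq_bigr => l _; congr (_ * _).
  have hv := adj_vertex (cycle_adj Hz l.+1).
  rewrite (inner_adj_spokeE (chain_up_adj hv)) (inner_adj_spokeE (chain_down_adj hv))
    !negbK.
  by rewrite exit_weightE; case: (ext _ _); rewrite /= ?mul1r ?mul0r // !mulr0 subrr.
have hv := inner_vertex_hex hx.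
rewrite (inner_adj_off_cycle Hz hx off (chain_up_adj hv)).
by rewrite (inner_adj_off_cycle Hz hx off (chain_down_adj hv)) /= !mulr0 subrr.
Qed.

Variable V : {fset hex_point}.
Hypothesis HV : forall x, (x \in V) = ivert x.

Lemma card_vertices : #|` V|%:Z = prefix_weight z o n.
Proof.
rewrite card_weight => [|x|x y]; last 2 first.
- by rewrite HV.
- by rewrite !HV => _ xy _; apply: (inner_adj_vertex (y := x)); rewrite inner_adjC.
by apply: eq_bigr => l _; rewrite HV inner_vertex_cycle // mul1r.
Qed.

Lemma prefix_weight_gt0 : 0 < prefix_weight z o n.
Proof.
rewrite -card_vertices ltz_nat cardfs_gt0; apply/fset0Pn; exists (z 0).
by rewrite HV inner_vertex_cycle.
Qed.

(* The spokes which stay in the region count the vertices off the cycle,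
   negatively; the sign of the total weight thus reveals the orientation. *)
Lemma prefix_weight_le0 : prefix_weight z (~~ o) n <= 0.
Proof.
have sym : symmetric strict_adj by move=> x y; rewrite /strict_adj inner_adjC cycle_edgeC.
have adjV x y : strict_adj x y -> y \in V.
  by rewrite HV => /andP[xy _]; apply: (inner_adj_vertex (y := x)); rewrite inner_adjC.
have := @chain_sum V strict_adj sym _ (fun x _ => @adjV _ _) (fun x _ => @adjV _ _).
rewrite (bigID (on_cycle z n)) /=.
set a := (X in X + _ = _); set b := (X in _ + X = _).
have -> : a = prefix_weight z (~~ o) n.
  rewrite /a big_mkcond /= cycle_sum => [|x _ /negPf -> //].
  apply: eq_bigr => l _; rewrite HV inner_vertex_cycle // on_cycle_z // mul1r.
  have hv := adj_vertex (cycle_adj Hz l.+1).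
  rewrite (strict_adj_spokeE (chain_up_adj hv)) (strict_adj_spokeE (chain_down_adj hv)).
  by rewrite exit_weightE; case: (ext _ _); rewrite /= ?mul1r ?mul0r // !mulr0 subrr.
(* A vertex off Z has both chain edges, hence contributes [(x.2 + 1) - x.2], that is 1. *)
have : 0 <= b.
  rewrite /b big_seq_cond; apply: sumr_ge0 => x /andP[]; rewrite HV => hx off.
  have hv := inner_vertex_hex hx.
  have st v : hex_adjacent x v -> strict_adj x v.
    move=> xv; rewrite /strict_adj (inner_adj_off_cycle Hz hx off xv) /=.
    apply: contra off => /(cycle_edgeP Hz)[k [] [e1 e2]]; apply/(on_cycleP Hz).
      by exists k.
    by exists k.+1.
  by rewrite !st ?chain_up_adj ?chain_down_adj //=; lia.
move=> b0 h; have {}h : prefix_weight z (~~ o) n + b = 0.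
  by apply: h => x; rewrite HV => /inner_vertex_hex.
by lia.
Qed.

Lemma prefix_weight_sub b i j : (i <= j)%N ->
  prefix_weight z b j - prefix_weight z b i =
  \sum_(i <= l < j) (ext b l)%:Z * exit_weight z l.
Proof.
by move=> ij; rewrite /prefix_weight (@big_cat_nat _ _ _ i 0 j) //= addrAC subrr add0r.
Qed.

Section Cut.
Variables (i k : nat).
Hypotheses (Hm : matched z n i k) (Hi : (i < n)%N) (Hk : (k < n)%N).
Local Notation S := (cut_side z n i k).
Local Notation m := `|prefix_weight z o k - prefix_weight z o i|.

(** Taken from the smaller index to the larger, the difference is a cardinal, hence not negative;
    the absolute value thus covers both orders of i and k. *)
Lemma card_cut_side : #|` [fset x in V | S x != S (z 0)]|%:Z = m.
Proof.
have arc : #|` [fset x in V | S x != S (z 0)]|%:Z =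
    prefix_weight z o (maxn i k) - prefix_weight z o (minn i k).
  rewrite card_weight => [|x|x y]; last 2 first.
  - by rewrite !inE HV => /andP[].
  - rewrite !inE !HV => /andP[_ hx] xy h.
    rewrite -(cut_side_chain Hz i k xy h) hx andbT.
    by apply: (inner_adj_vertex (y := x)); rewrite inner_adjC.
  rewrite prefix_weight_sub; last by lia.
  rewrite (eq_big_nat _ _ (F2 := fun l => if (minn i k <= l < maxn i k)%N then
      (ext o l)%:Z * exit_weight z l else 0)); last first.
    move=> l /= ln; rewrite !inE HV inner_vertex_cycle //=.
    have := cut_side_arc Hz Hm Hi Hk ln; rewrite -negb_eqb => ->.
    by rewrite ltnS; case: ifP; rewrite ?mul1r ?mul0r.
  rewrite -big_mkcond /= [RHS](big_nat_widenl _ 0) //.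
  rewrite [RHS](big_nat_widen _ _ n) /=; last by lia.
  by apply: eq_bigl => l; rewrite andbC.
rewrite arc; have : 0 <= prefix_weight z o (maxn i k) - prefix_weight z o (minn i k).
  by rewrite -arc.
case: (leqP i k) => _ h; first by rewrite ger0_norm.
by rewrite distrC ger0_norm.
Qed.

Lemma card_cut_side_compl :
  #|` [fset x in V | S x == S (z 0)]|%:Z = prefix_weight z o n - m.
Proof.
rewrite -card_vertices -card_cut_side.
have -> : [fset x in V | S x == S (z 0)] = V `\` [fset x in V | S x != S (z 0)].
  by apply/fsetP => x; rewrite !inE; case: (x \in V); rewrite ?andbF //= andbT negbK.
have sub : [fset x in V | S x != S (z 0)] `<=` V.
  by apply/fsubsetP => x; rewrite !inE => /andP[].
rewrite cardfsDS // -subzn //; exact: fsubset_leq_card.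
Qed.

Lemma cut_product u : class1 u -> on_cut z i k u -> iadj u (right_end u) ->
  (#|` fset_set (N1 G (u, right_end u))| * #|` fset_set (N2 G (u, right_end u))|)%:Z
  = m * (prefix_weight z o n - m).
Proof.
move=> cu hu uv; rewrite (N1_cut Hz Hm cu hu uv) (N2_cut Hz Hm cu hu uv).
have e1 : fset_set [set x | ivert x /\ S x = S u]%classic = [fset x in V | S x == S u].
  rewrite -[RHS]set_fsetK; congr fset_set; apply/seteqP; split=> x /=; rewrite !inE HV.
    by case=> -> ->; rewrite eqxx.
  by case/andP => -> /eqP.
have e2 : fset_set [set x | ivert x /\ S x != S u]%classic = [fset x in V | S x != S u].
  rewrite -[RHS]set_fsetK; congr fset_set; apply/seteqP; split=> x /=; rewrite !inE HV.
    by case=> -> ->.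
  by case/andP => -> ->.
rewrite e1 e2 PoszM.
have [h|h] := eqVneq (S u) (S (z 0)).
  by rewrite h card_cut_side card_cut_side_compl mulrC.
have -> : [fset x in V | S x == S u] = [fset x in V | S x != S (z 0)].
  by apply/fsetP => x; rewrite !inE; congr (_ && _); move: h;
    case: (S u) (S (z 0)) (S x) => [] [] [].
have -> : [fset x in V | S x != S u] = [fset x in V | S x == S (z 0)].
  by apply/fsetP => x; rewrite !inE; congr (_ && _); move: h;
    case: (S u) (S (z 0)) (S x) => [] [] [].
by rewrite card_cut_side card_cut_side_compl.
Qed.

End Cut.
End Count.

(** * The sum over the horizontal edges *)

(** Consecutive edges of a cut differ by 2 in height, so the first factor is their number. *)
Definition cut_term z n o i k : int :=
  let m := `|prefix_weight z o k - prefix_weight z o i| in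
  (divz ((z k).2 - (z i).2) 2 + 1) * (m * (prefix_weight z o n - m)).

Definition cut_sum z n o : int :=
  \sum_(0 <= k < n) \sum_(0 <= i < n) (matched z n i k)%:Z * cut_term z n o i k.

Lemma nat_argmax (n : nat) (P : pred nat) (f : nat -> int) l0 :
  (l0 < n)%N -> P l0 ->
  exists l, [/\ (l < n)%N, P l & forall j, (j < n)%N -> P j -> f j <= f l].
Proof.
move=> ln Pl; have := @arg_maxP _ _ _ (Ordinal ln) (fun l : 'I_n => P l) (fun l : 'I_n =>
  f l) Pl.
by case=> l Pl' lmax; exists l; split=> // j jn Pj; exact: (lmax (Ordinal jn)).
Qed.

Section Sum.
Variables (z : nat -> hex_point) (n : nat).
Hypothesis Hz : lattice_cycle z n.
Local Notation inside := (inside z n).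
Local Notation iadj := (inner_adj z n).
Local Notation cedge := (cycle_edge z n).
Local Notation G := (inner_graph z n).
Local Notation o := (inside (lhex (z 0) (z 1))).
Local Notation horizontal := (horizontal z).
Local Notation line := (line z).
Local Notation matched := (matched z n).

(** Otherwise the parity would not change however far the hexagon is raised in its column, by steps
    (-1, 2), against [inside_bounded]. *)
Lemma rung_above c : hex_centre c -> inside c ->
  exists l, [/\ (l < n)%N, horizontal l, line l = 2 * c.1 + c.2 & c.2 < (z l).2].
Proof.
move=> hc hin; apply: contrapT => none.
have [m [m0 hm]] := inside_bounded Hz.
pose t := (`|m| + `|c.2|)%N.+1; pose c' : hex_point := (c.1 - t%:Z, c.2 + 2 * t%:Z).
have hc' : hex_centre c' by move: hc; rewrite /hex_centre /c' /=; lia.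
have : inside c'.
  suff -> : inside c' = inside c by [].
  apply: eq_big_nat => l /= ln.
  rewrite /rung_below -/(horizontal l) -/(line l).
  have -> : 2 * c'.1 + c'.2 = 2 * c.1 + c.2 by rewrite /c' /=; lia.
  case hl : (horizontal l) => //=; case: eqP => //= e.
  have [[a ha] _ _] := horizontal_step Hz hl.
  have : ~ c.2 < (z l).2 by move=> h; apply: none; exists l.
  by rewrite /c' /= => h; apply/idP/idP; lia.
by move=> /(hm _ hc')[_]; rewrite /c' /t /=; lia.
Qed.

(** The ends are the highest edge of Z below c and the lowest one above c, in the column of c. *)
Lemma inside_matched c : hex_centre c -> inside c ->
  exists i k, [/\ (i < n)%N, (k < n)%N, matched i k, line i = 2 * c.1 + c.2 &
                  (z i).2 < c.2 /\ c.2 < (z k).2].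
Proof.
move=> hc hin.
pose on l := horizontal l && (line l == 2 * c.1 + c.2).
have [k0 [kn hk ek bk]] := rung_above hc hin.
have [k1 [{}kn /andP[/andP[{}hk /eqP {}ek] {}bk] kmin]] : exists k, [/\ (k < n)%N,
    on k && (c.2 < (z k).2) & forall j, (j < n)%N -> on j && (c.2 < (z j).2) ->
      (z k).2 <= (z j).2].
  have [|k [h1 h2 h3]] := @nat_argmax n (fun l => on l && (c.2 < (z l).2)) (fun l =>
    - (z l).2) k0 kn.
    by rewrite /on hk ek eqxx.
  by exists k; split=> // j jn /(h3 j jn); rewrite lerN2.
have [i0 [i0n hi0]] : exists l, (l < n)%N /\ (on l && ((z l).2 < c.2)).
  have [l ln /and3P[h1 h2 h3]] := inside_rung hin.
  by exists l; split=> //; apply/andP; split=> //; apply/andP; split.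
have [i [iln /andP[/andP[hi /eqP ei] bi] imax]] :=
  @nat_argmax n (fun l => on l && ((z l).2 < c.2)) (fun l => (z l).2) i0 i0n hi0.
exists i, k1; split=> //; apply/and4P; split=> //.
- by apply/and3P; split=> //; [rewrite ek ei|lia].
- suff -> : open_below z n k1 = inside c by [].
  apply: eq_big_nat => l /= ln; rewrite /rung_below /below -/(horizontal l) -/(line l) ek.
  case hl : (horizontal l) => //=; case: eqP => //= e.
  have [[a ha] _ _] := horizontal_step Hz hl.
  apply/idP/idP => h; last by lia.
  rewrite ltNge; apply/negP => h'.
  have {}h' : c.2 < (z l).2 by lia.
  by have := kmin l ln; rewrite /on hl e eqxx h' => /(_ isT); lia.
apply/allP => l; rewrite mem_iota /= add0n => ln; apply/negP.
rewrite /below => /andP[/and3P[_ /eqP e1 h1] /and3P[hl /eqP e2 h2]].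
have [h|h] := ltP c.2 (z l).2.
  by have := kmin l ln; rewrite /on hl e2 ek eqxx h => /(_ isT); lia.
have [[a ha] _ _] := horizontal_step Hz hl.
have {}h : (z l).2 < c.2 by lia.
by have := imax l ln; rewrite /on hl e2 ek eqxx h => /(_ isT); lia.
Qed.

Lemma cut_exists u : class1 u -> iadj u (right_end u) ->
  exists i k, [/\ (i < n)%N, (k < n)%N, matched i k & on_cut z i k u].
Proof.
move=> cu uv; have [a hin] := andP uv.
have e1 : lhex u (right_end u) = (u.1, u.2 + 1) by rewrite /lhex /=; congr pair; lia.
have e2 : lhex (right_end u) u = (u.1 + 1, u.2 - 1) by rewrite /lhex /=; congr pair; lia.
have a' := a; rewrite hex_adjacent_sym in a'.
case/orP: hin => hin.
  have [i [k [ln kn m]]] := inside_matched (lhex_centre a) hin.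
  rewrite e1 /= => h1 [h2 h3]; exists i, k; split=> //.
  by rewrite /on_cut h1; apply/and3P; split; [apply/eqP; lia|lia|lia].
have [i [k [ln kn m]]] := inside_matched (lhex_centre a') hin.
rewrite e2 /= => h1 [h2 h3]; exists i, k; split=> //.
have [hi hk e _] := matched_rel Hz m; have [[b hb] _ _] := horizontal_step Hz hk.
by rewrite /on_cut h1; apply/and3P; split; [apply/eqP; lia|lia|lia].
Qed.

(** Two cuts that share an edge overlap in one column. No end of one is strictly between the ends of
    the other; and an edge of Z cannot be the lower end of one cut and the upper end of the other,
    as it has its outer hexagon on one side only. *)
Lemma cut_unique i k i' k' u : (i < n)%N -> (k < n)%N -> (i' < n)%N -> (k' < n)%N ->
  matched i k -> matched i' k' -> on_cut z i k u -> on_cut z i' k' u ->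
  i = i' /\ k = k'.
Proof.
move=> ln kn i'n k'n m m' /and3P[/eqP l1 h1 h2] /and3P[/eqP l2 h3 h4].
have [hi hk e hik] := matched_rel Hz m; have [hi' hk' e' hik'] := matched_rel Hz m'.
have [q1 q2] := matched_outer Hz m; have [q3 q4] := matched_outer Hz m'.
have noadj a b : a = b -> (outer z o a).2 = (z a).2 - 1 ->
  (outer z o b).2 = (z b).2 + 1 -> False.
  by move=> -> -> h; lia.
have ekk : k = k'.
  apply: (rung_inj Hz) => //; first by rewrite -e -e' -l1 -l2.
  case: (ltgtP (z k).2 (z k').2) => // h.
    have [h'|h'] := ltP (z i').2 (z k).2.
      by case: (matched_between Hz m' kn hk) => //; rewrite -e -l1 -l2.
    have ik : i' = k.
      by apply: (rung_inj Hz) => //; [rewrite -e -l1 -l2|lia].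
    by case: (noadj i' k).
  have [h'|h'] := ltP (z i).2 (z k').2.
    by case: (matched_between Hz m k'n hk') => //; rewrite -e' -l1 -l2.
  have ik : i = k'.
    by apply: (rung_inj Hz) => //; [rewrite -e' -l1 -l2|lia].
  by case: (noadj i k').
split=> //; apply: (rung_inj Hz) => //; first by rewrite -l1 -l2.
case: (ltgtP (z i).2 (z i').2) => // h.
  by case: (matched_between Hz m i'n hi') => //; [rewrite -l1 -l2|rewrite ekk; lia].
by case: (matched_between Hz m' ln hi) => //; [rewrite -l1 -l2|rewrite -ekk; lia].
Qed.

Lemma rung_end i : horizontal i -> exists x, [/\ class1 x, cedge x (right_end x),
  x.2 = (z i).2 & 2 * x.1 + x.2 + 1 = line i].
Proof.
move=> hi; have a := cycle_adj Hz i; move/eqP: (hi) => e.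
have := cycle_edge_z Hz i; rewrite -[line i]/((z i).1 + (z i.+1).1 + (z i).2).
have [[c e1]|[c e1]] := adj_right_end a e => h.
  by exists (z i); split=> //; [rewrite -e1|rewrite e1 /=; lia].
exists (z i.+1); split=> //; first by rewrite -e1 cycle_edgeC.
by rewrite e [in RHS]e1 /=; lia.
Qed.

Variable E : {fset hex_point * hex_point}.
Hypothesis HE : forall e, (e \in E) = inner_edge z n e.

Lemma inner_edge_right u : ((u, right_end u) \in E) = class1 u && iadj u (right_end u).
Proof.
rewrite HE /inner_edge /inner_adj /=; case: (_ || _); rewrite ?andbF ?andbT //.
by case: u => a b; rewrite /class1 /right_end /hex_adjacent /hex_edge !inE !xpair_eqE /=;
  lia.
Qed.

Lemma horizontal_edge e : e \in E -> e.1.2 == e.2.2 ->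
  [/\ e = (e.1, right_end e.1), class1 e.1 & iadj e.1 (right_end e.1)].
Proof.
case: e => u v /= uv /eqP h; have : v = right_end u.
  move: uv h; rewrite HE => /andP[/= + _]; case: u v => [a b] [c d].
  by rewrite /hex_edge /right_end !inE !xpair_eqE /= => h1 h2; congr pair; lia.
by move=> e; move: uv; rewrite e inner_edge_right => /andP[-> ->].
Qed.

Lemma card_cut i k : matched i k ->
  \sum_(e <- E | e.1.2 == e.2.2) (on_cut z i k e.1)%:Z = divz ((z k).2 - (z i).2) 2 + 1.
Proof.
move=> m; have [hi hk e hik] := matched_rel Hz m.
have [x [cx ex bx lx]] := rung_end hi.
have [[a ha] _ _] := horizontal_step Hz hk.
pose pt (t : nat) : hex_point := (x.1 - t%:Z, x.2 + 2 * t%:Z).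
pose d := `|divz ((z k).2 - (z i).2) 2|%N.
have hd : (z k).2 - (z i).2 = 2 * d%:Z.
  rewrite /d -bx; rewrite -bx in hik; rewrite e in lx; lia.
have on_pt y : on_cut z i k y -> exists2 t, t \in iota 0 d.+1 & y = pt t.
  move=> /and3P[/eqP c1 c2 c3]; exists `|(x.1 - y.1)%R|%N.
    by rewrite mem_iota add0n; lia.
  by rewrite /pt [LHS]surjective_pairing; congr pair; lia.
transitivity (\sum_(e <- [seq (pt t, right_end (pt t)) | t <- iota 0 d.+1]) (1 : int));
  last first.
  by rewrite big_const_seq count_predT size_map size_iota iter_addr_0 hd; lia.
transitivity (\sum_(e <- [seq e <- E | (e.1.2 == e.2.2) && on_cut z i k e.1]) (1 : int)).
  rewrite big_filter big_mkcond [RHS]big_mkcond; apply: eq_bigr => f _.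
  by case: (_ == _) => //=; case: (on_cut _ _ _ _).
apply: perm_big; apply: uniq_perm; first by rewrite filter_uniq ?fset_uniq.
  rewrite map_inj_uniq ?iota_uniq // => s t []; rewrite /pt; lia.
move=> f; rewrite mem_filter; apply/andP/mapP.
  move=> [/andP[h1 /on_pt[t td et]] fE].
  by have [-> _ _] := horizontal_edge fE h1; exists t; rewrite // et.
move=> [t]; rewrite mem_iota add0n => /= td ->; split=> //=.
  by rewrite eqxx /on_cut /pt /=; apply/and3P; split; [apply/eqP; lia|lia|lia].
have ct : class1 (pt t) by move: cx; rewrite /class1 /pt /=; lia.
rewrite inner_edge_right ct /=.
(* The lowest edge is on Z; each higher one is in G because the hexagon just below it is inside. *)
case: t ct td => [|t] ct td.
  have -> : pt 0 = x by rewrite /pt mulr0 subr0 addr0 -surjective_pairing.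
  exact: inner_adj_cycle.
rewrite /inner_adj; apply/andP; split.
  by move: ct; case: (pt _) => b c;
    rewrite /class1 /right_end /hex_adjacent /hex_edge !inE !xpair_eqE /=; lia.
apply/orP; right; apply: (inside_cut Hz m); rewrite /lhex /pt /=; lia.
Qed.

Theorem horizontal_sum :
  \sum_(e <- E | e.1.2 == e.2.2)
     (#|` fset_set (N1 G e)| * #|` fset_set (N2 G e)|)%:Z = cut_sum z n o.
Proof.
have [V HV] := inner_fset Hz.
pose X i k := `|prefix_weight z o k - prefix_weight z o i| *
  (prefix_weight z o n - `|prefix_weight z o k - prefix_weight z o i|).
transitivity (\sum_(e <- E | e.1.2 == e.2.2) \sum_(0 <= k < n) \sum_(0 <= i < n)
    (matched i k && on_cut z i k e.1)%:Z * X i k).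
  rewrite big_seq_cond [RHS]big_seq_cond; apply: eq_bigr => e /andP[eE he].
  have [ee ce ie] := horizontal_edge eE he.
  have [i [k [ln kn m hc]]] := cut_exists ce ie.
  have -> : (#|` fset_set (N1 G e)| * #|` fset_set (N2 G e)|)%:Z = X i k.
    by rewrite ee (cut_product Hz HV m ln kn ce hc ie).
  have uniq j l : (j < n)%N -> (l < n)%N -> matched j l && on_cut z j l e.1 ->
      i = j /\ k = l.
    by move=> jn l_n /andP[m' hc']; apply: (@cut_unique i k j l e.1).
  rewrite big_mkord (bigD1 (Ordinal kn)) //= big_mkord (bigD1 (Ordinal ln)) //=.
  rewrite m hc mul1r big1 ?addr0 => [|j ji]; last first.
    case h : (_ && _); last by rewrite mul0r.
    by have [ij _] := uniq _ _ (ltn_ord j) kn h; case/eqP: ji; apply: val_inj.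
  rewrite big1 ?addr0 // => l lk; rewrite big_mkord big1 // => j _.
  case h : (_ && _); last by rewrite mul0r.
  by have [_ kl] := uniq _ _ (ltn_ord j) (ltn_ord l) h; case/eqP: lk; apply: val_inj.
rewrite exchange_big /=; apply: eq_big_nat => k /= kn.
rewrite exchange_big /=; apply: eq_big_nat => i /= ln.
rewrite -mulr_suml /cut_term.
case m : (matched i k); last by rewrite big1 ?mul0r // => e _; rewrite andFb.
by rewrite mul1r /= card_cut.
Qed.

End Sum.

(** * The three directions *)

(* The rotation of angle 2 pi / 3 about the origin. *)
Definition rotate u : hex_point := (- u.1 - u.2, u.1).

Definition unrotate u : hex_point := (u.2, - u.1 - u.2).

Lemma rotK : cancel rotate unrotate.
Proof. by case=> a b; rewrite /rotate /unrotate /=; congr pair; ring. Qed.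

Lemma unrotK : cancel unrotate rotate.
Proof. by case=> a b; rewrite /rotate /unrotate /=; congr pair; ring. Qed.

Lemma rot_inj : injective rotate. Proof. exact: can_inj rotK. Qed.

Lemma lhex_rot u v : lhex (rotate u) (rotate v) = rotate (lhex u v).
Proof. by rewrite /lhex /rotate /=; congr pair; ring. Qed.

Lemma hex_edge_rot u v : hex_edge (rotate u) (rotate v) = hex_edge u v.
Proof.
case: u v => [a b] [c d]; rewrite /hex_edge /rotate !inE !xpair_eqE /=.
have -> : (modz (- a - b - a) 3 == modz 1 3) = (modz (a - b) 3 == modz 1 3) by lia.
case: (_ == _) => //=; rewrite orbC -orbA orbC -!orbA.
by congr [|| _, _ | _]; apply/andP/andP => -[] /eqP h1 /eqP h2; split; apply/eqP; lia.
Qed.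

Lemma hex_adjacent_rot u v : hex_adjacent (rotate u) (rotate v) = hex_adjacent u v.
Proof. by rewrite /hex_adjacent !hex_edge_rot. Qed.

Definition rot_edge (e : hex_point * hex_point) := (rotate e.1, rotate e.2).

Lemma rot_edge_inj : injective rot_edge.
Proof. by case=> [a b] [c d] [] h1 h2 h3 h4; congr pair; apply: rot_inj; congr pair. Qed.

Lemma same_edge_rot u v x y : same_edge (rotate u) (rotate v) (rotate x) (rotate y) =
  same_edge u v x y.
Proof. by rewrite /same_edge !(inj_eq rot_inj). Qed.

Definition edge_term z n (e : hex_point * hex_point) : int :=
  (#|` fset_set (N1 (inner_graph z n) e)| * #|` fset_set (N2 (inner_graph z n) e)|)%N%:Z.

Section Rotation.
Variables (z : nat -> hex_point) (n : nat).
Hypothesis Hz : lattice_cycle z n.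
Local Notation z' := (rotate \o z).

Lemma lattice_cycle_rot : lattice_cycle z' n.
Proof.
case: Hz => h1 h2 h3 h4; split=> // [k|k|k l kn ln /rot_inj]; last exact: h4.
  by rewrite /= h2.
by rewrite /= hex_adjacent_rot.
Qed.

Lemma cycle_edge_rot u v : cycle_edge z' n (rotate u) (rotate v) = cycle_edge z n u v.
Proof. by apply: eq_existsb => k /=; rewrite same_edge_rot. Qed.

(** A rotation does not preserve the vertical columns along which [inside] counts edges. But both
    parities change exactly across the edges of Z, so their sum modulo 2 is constant along a
    straight path of hexagons to infinity, where both vanish. *)
Lemma inside_rot c : hex_centre c -> inside z' n (rotate c) = inside z n c.
Proof.
move=> hc; pose d (t : nat) : hex_point := (c.1 - t%:Z, c.2 - t%:Z).
have dc t : hex_centre (d t) by move: hc; rewrite /hex_centre /d /=; lia.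
have step t : inside z' n (rotate (d t)) (+) inside z n (d t) =
    inside z' n (rotate (d t.+1)) (+) inside z n (d t.+1).
  pose u : hex_point := (c.1 - t%:Z - 1, c.2 - t%:Z).
  pose v : hex_point := (c.1 - t%:Z, c.2 - t%:Z - 1).
  have uv : hex_adjacent u v.
    by move: hc; rewrite /hex_centre /hex_adjacent /hex_edge /u /v !inE !xpair_eqE /=; lia.
  have e1 : lhex u v = d t by rewrite /lhex /d /=; congr pair; lia.
  have e2 : lhex v u = d t.+1 by rewrite /lhex /d /=; congr pair; lia.
  have := inside_step Hz uv; rewrite e1 e2 -cycle_edge_rot.
  have uv' : hex_adjacent (rotate u) (rotate v) by rewrite hex_adjacent_rot.
  rewrite -(inside_step lattice_cycle_rot uv') !lhex_rot e1 e2.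
  by do 4!case: (inside _ _ _).
have all t : inside z' n (rotate c) (+) inside z n c =
    inside z' n (rotate (d t)) (+) inside z n (d t).
  elim: t => [|t ->]; last exact: step.
  by rewrite /d !subr0 -surjective_pairing.
have [m [m0 hm]] := inside_bounded Hz.
have [m' [m0' hm']] := inside_bounded lattice_cycle_rot.
pose t := (`|m| + `|m'| + `|c.1| + `|c.2|)%N.+1.
have h1 : inside z n (d t) = false.
  by apply: negbTE; apply/negP => /(hm _ (dc t))[]; rewrite /d /t /=; lia.
have h2 : inside z' n (rotate (d t)) = false.
  have hct : hex_centre (rotate (d t)) by have := dc t; rewrite /hex_centre /rotate /=; lia.
  by apply: negbTE; apply/negP => /(hm' _ hct)[]; rewrite /rotate /d /t /=; lia.
by have := all t; rewrite h1 h2; case: (inside _ _ _) (inside _ _ _) => [] [].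
Qed.

Lemma inside_lhex_rot u v : hex_adjacent u v ->
  inside z' n (lhex (rotate u) (rotate v)) = inside z n (lhex u v).
Proof. by move=> uv; rewrite lhex_rot inside_rot //; exact: lhex_centre. Qed.

Lemma inner_adj_rot u v : inner_adj z' n (rotate u) (rotate v) = inner_adj z n u v.
Proof.
rewrite /inner_adj hex_adjacent_rot; case uv : (hex_adjacent u v) => //=.
have vu := uv; rewrite hex_adjacent_sym in vu.
by rewrite !inside_lhex_rot.
Qed.

Lemma inner_edge_rot e : inner_edge z' n (rot_edge e) = inner_edge z n e.
Proof.
have hex e' z0 : inner_edge z0 n e' = hex_edge e'.1 e'.2 && inner_adj z0 n e'.1 e'.2.
  rewrite /inner_edge /inner_adj; case h : (hex_edge _ _) => //=.
  by rewrite hex_edge_adjacent.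
by rewrite !hex /= hex_edge_rot inner_adj_rot.
Qed.

Lemma inner_vertex_rot u : inner_vertex z' n (rotate u) = inner_vertex z n u.
Proof.
apply/inner_vertexP/inner_vertexP => [[v uv h]|[v uv h]].
  have uv' : hex_adjacent u (unrotate v) by rewrite -hex_adjacent_rot unrotK.
  by exists (unrotate v) => //; rewrite -inside_lhex_rot // unrotK.
by exists (rotate v); rewrite ?hex_adjacent_rot // inside_lhex_rot.
Qed.

Local Notation G := (inner_graph z n).
Local Notation G' := (inner_graph z' n).

Lemma path_rot (p : seq hex_point) x :
  path (adjacent G') (rotate x) (map rotate p) = path (adjacent G) x p.
Proof. by elim: p x => //= y p IH x; rewrite !adjacent_inner inner_adj_rot IH. Qed.

Lemma walk_rot k x y : walk G' k (rotate x) (rotate y) <-> walk G k x y.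
Proof.
split=> [[p [h1 h2 h3]]|[p [h1 h2 h3]]]; last first.
  by exists (map rotate p); rewrite path_rot last_map h2 size_map.
have ep : p = map rotate (map unrotate p) by rewrite mapK //; exact: unrotK.
exists (map unrotate p); rewrite -path_rot -ep size_map; split=> //.
by apply: rot_inj; rewrite -last_map -ep.
Qed.

Lemma dist_rot x y : dist G' (rotate x) (rotate y) = dist G x y.
Proof.
rewrite /dist; congr xget; apply/seteqP; split=> k /= [h1 h2]; split.
- exact/walk_rot.
- by move=> m /walk_rot; exact: h2.
- exact/walk_rot.
- by move=> m /walk_rot; exact: h2.
Qed.

Lemma card_rot (A B : set hex_point) (V : {fset hex_point}) :
  (A `<=` [set` V])%classic -> (forall x, B (rotate x) <-> A x) ->
  #|` fset_set B| = #|` fset_set A|.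
Proof.
move=> AV AB.
have finA : finite_set A by apply: (sub_finite_set AV); exact: finite_fset.
have -> : B = (rotate @` A)%classic.
  apply/seteqP; split=> [y By|_ [x Ax <-]]; last exact/AB.
  by exists (unrotate y); [apply/AB|]; rewrite unrotK.
by rewrite fset_set_image // card_imfset //; exact: rot_inj.
Qed.

Lemma edge_term_rot e : edge_term z' n (rot_edge e) = edge_term z n e.
Proof.
have [V HV] := inner_fset Hz.
congr (_ * _)%N%:Z; apply: (@card_rot _ _ V) => x.
- by move=> [h _]; rewrite /= HV.
- by rewrite /N1 /= inner_vertex_rot !dist_rot.
- by move=> [h _]; rewrite /= HV.
- by rewrite /N2 /= inner_vertex_rot !dist_rot.
Qed.

Lemma edge_fset : exists E : {fset hex_point * hex_point},
  forall e, (e \in E) = inner_edge z n e.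
Proof.
have [V HV] := inner_fset Hz.
exists [fset e in V `*` V | inner_edge z n e] => e.
rewrite !inE andb_idl // => /andP[h h']; have a := hex_edge_adjacent h.
have ad : inner_adj z n e.1 e.2 by rewrite /inner_adj a.
rewrite !HV (inner_adj_vertex ad) /=.
by apply: (inner_adj_vertex (y := e.1)); rewrite inner_adjC.
Qed.

Lemma edges_fset (E : {fset hex_point * hex_point}) :
  (forall e, (e \in E) = inner_edge z n e) -> fset_set (edges G) = E.
Proof.
move=> HE; rewrite -[RHS]set_fsetK; congr fset_set; apply/seteqP.
by split=> e /=; rewrite HE.
Qed.
End Rotation.

Definition edge_sum z n (P : pred (hex_point * hex_point)) : int :=
  \sum_(e <- fset_set (edges (inner_graph z n)) | P e) edge_term z n e.

Lemma edge_sum_rot z n P : lattice_cycle z n ->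
  edge_sum z n (P \o rot_edge) = edge_sum (rotate \o z) n P.
Proof.
move=> Hz; have Hz' := lattice_cycle_rot Hz.
have [E HE] := edge_fset Hz; have [E' HE'] := edge_fset Hz'.
rewrite /edge_sum (edges_fset HE) (edges_fset HE').
rewrite (eq_bigr _ (fun e _ => esym (edge_term_rot Hz e))).
rewrite -(big_map rot_edge P (edge_term (rotate \o z) n)); apply: perm_big;
  apply: uniq_perm.
- by rewrite map_inj_uniq ?fset_uniq //; exact: rot_edge_inj.
- exact: fset_uniq.
move=> e; rewrite HE'; apply/mapP/idP => [[f fE ->]|he].
  by rewrite inner_edge_rot // -HE.
have e' : e = rot_edge (unrotate e.1, unrotate e.2).
  by rewrite /rot_edge /= !unrotK -surjective_pairing.
by exists (unrotate e.1, unrotate e.2) => //; rewrite HE -inner_edge_rot -?e'.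
Qed.

Definition orientation z n : bool := inside z n (lhex (z 0) (z 1)).

(** Each edge is horizontal in exactly one of the three rotated copies, and [edge_term] is invariant
    under rotation. *)
Theorem szeged_cut_sum z n : lattice_cycle z n ->
  (Szeged (inner_graph z n))%:Z =
  cut_sum z n (orientation z n)
  + cut_sum (rotate \o z) n (orientation (rotate \o z) n)
  + cut_sum (rotate \o (rotate \o z)) n (orientation (rotate \o (rotate \o z)) n).
Proof.
move=> Hz; have Hz1 := lattice_cycle_rot Hz; have Hz2 := lattice_cycle_rot Hz1.
pose hor (e : hex_point * hex_point) := e.1.2 == e.2.2.
have edge_sumE z0 : lattice_cycle z0 n ->
  edge_sum z0 n hor = cut_sum z0 n (orientation z0 n).
  move=> Hz0; have [E HE] := edge_fset Hz0.
  by rewrite /edge_sum (edges_fset HE) (horizontal_sum Hz0 HE).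
rewrite -!edge_sumE // -!edge_sum_rot // /Szeged /edge_sum.
have [E HE] := edge_fset Hz; rewrite (edges_fset HE).
have -> : Posz (\sum_(e <- E) #|` fset_set (N1 (inner_graph z n) e)|
    * #|` fset_set (N2 (inner_graph z n) e)|)%N = \sum_(e <- E) edge_term z n e.
  by rewrite -[LHS]natz natr_sum; apply: eq_bigr => e _; rewrite natz.
move: (edge_term z n) => t.
rewrite [X in _ = X + _ + _]big_mkcond [X in _ = _ + X + _]big_mkcond.
rewrite [X in _ = _ + _ + X]big_mkcond -[X in _ = X + _]big_split -[RHS]big_split.
rewrite big_seq [RHS]big_seq; apply: eq_bigr => e; rewrite HE => he.
cbn [comp].
suff : [/\ hor e, ~~ hor (rot_edge e) & ~~ hor (rot_edge (rot_edge e))] \/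
    [/\ ~~ hor e, hor (rot_edge e) & ~~ hor (rot_edge (rot_edge e))] \/
    [/\ ~~ hor e, ~~ hor (rot_edge e) & hor (rot_edge (rot_edge e))].
  by case=> [[-> /negPf -> /negPf ->]|[[/negPf -> -> /negPf ->]|[/negPf -> /negPf -> ->]]];
    rewrite /= ?addr0 ?add0r.
have /andP[/hex_edge_adjacent a _] := he.
case: (hex_adjacent_cases a) => -[_]; rewrite /hor /=; case: (e) => -[b c] [b' c'] /=;
  by case=> -[-> ->]; [left|right; left|right; right]; split; lia.
Qed.

End InnerGraphs.

(** * Running programs *)

(** The value of an expression regardless of the word bound; under the conditions [fits] it is what
    [value] returns. *)
Fixpoint den (s : state) (e : expr) : int :=
  match e with
  | Const v => v
  | Reg r => register s r
  | Read a => memory s `|den s a|%N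
  | Bin op e1 e2 => eval_binop op (den s e1) (den s e2)
  end.

Fixpoint safe (s : state) (e : expr) : Prop :=
  match e with
  | Read a => 0 <= den s a /\ safe s a
  | Bin _ e1 e2 => safe s e1 /\ safe s e2
  | _ => True
  end.

(** The largest constant of the program is 15, the number of arrays. *)
Fixpoint small (e : expr) : bool :=
  match e with
  | Const v => (`|v| <= 15)%N
  | Reg _ => true
  | Read a => small a
  | Bin _ e1 e2 => small e1 && small e2
  end.

(** A Hoare triple for total correctness, with the bound T on the time. *)
Definition runs (B : nat) (c : cmd) (s : state) (T : nat) (Q : state -> Prop) : Prop :=
  exists t s', [/\ exec B c s t s', (t <= T)%N & Q s'].

Definition bounded_state (W : nat) (s : state) : Prop :=
  (forall r, `|register s r| <= W)%N /\ (forall i, `|memory s i| <= W)%N.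

Lemma absz_divz (x y : int) : (`|divz x y| <= `|x|)%N.
Proof.
have [->|y0] := eqVneq y 0; first by rewrite divz0.
have := divz_eq x y; have := modz_ge0 x y0; have := ltz_mod x y0.
by move: (divz x y) (modz x y) => q m; nia.
Qed.

Lemma bounded_set_register W s r v :
  bounded_state W s -> (`|v| <= W)%N -> bounded_state W (set_register s r v).
Proof. by case=> h1 h2 hv; split=> // i /=; case: ifP. Qed.

Lemma bounded_set_memory W s a v :
  bounded_state W s -> (`|v| <= W)%N -> bounded_state W (set_memory s a v).
Proof. by case=> h1 h2 hv; split=> // i /=; case: ifP. Qed.

Section Run.
Variables (B W K : nat).
Hypotheses (W15 : (15 <= W)%N) (WB : (W ^ K <= B)%N).

(** The result of an operation is at most twice the product of the bounds of its operands, and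
    [cost] provides one more factor W. So expressions of bounded cost have values polynomial in
    W. *)
Lemma den_bounded s e : bounded_state W s -> small e ->
  (`|den s e| <= W ^ cost e)%N.
Proof.
move=> [hr hm]; elim: e => [v|r|a IH|op e1 IH1 e2 IH2] /= h.
- by rewrite expn1; lia.
- by rewrite expn1.
- by apply: leq_trans (hm _) _; rewrite expnS leq_pmulr // expn_gt0; lia.
have /andP[/IH1 h1 /IH2 h2] := h.
rewrite expnS expnD.
have g1 : (0 < W ^ cost e1)%N by rewrite expn_gt0; lia.
have g2 : (0 < W ^ cost e2)%N by rewrite expn_gt0; lia.
move: (den s e1) (den s e2) (W ^ cost e1)%N (W ^ cost e2)%N h1 h2 g1 g2.
move=> x y X Y h1 h2 g1 g2.
have hs : (X + Y <= 2 * (X * Y))%N by nia.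
have hW : (2 * (X * Y) <= W * (X * Y))%N by rewrite leq_mul2r; apply/orP; right; lia.
have h0 : (0 < X * Y)%N by rewrite muln_gt0 g1.
have h3 : (X <= X * Y)%N by rewrite leq_pmulr.
case: op => /=.
- by apply: leq_trans (leq_trans hs hW); lia.
- by apply: leq_trans (leq_trans hs hW); lia.
- rewrite abszM; apply: leq_trans (leq_mul h1 h2) _.
  by apply: leq_trans hW; rewrite mul2n -addnn leq_addr.
- apply: leq_trans (absz_divz x y) (leq_trans h1 _).
  by apply: leq_trans (leq_trans h3 _) hW; rewrite mul2n -addnn leq_addr.
- by case: (_ < _)%R => /=; lia.
- by case: (_ == _) => /=; lia.
Qed.

Lemma value_den s e : bounded_state W s -> (cost e <= K)%N -> small e -> safe s e ->
  value B s e = Some (den s e).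
Proof.
move=> ws.
have word_den f : (cost f <= K)%N -> small f -> word B (den s f) = Some (den s f).
  move=> cf sf; rewrite /word; case: ifP => // /negP[].
  apply: leq_trans (den_bounded ws sf) (leq_trans _ WB).
  by rewrite leq_exp2l //; lia.
elim: e => [v|r|a IH|op e1 IH1 e2 IH2] //= ce se.
- by move=> _; exact: (word_den (Const v)).
- move=> [h /IH ->] //; last by lia.
  by case: (den s a) h.
move=> [/IH1 + /IH2]; case/andP: (se) => s1 s2 => -> //; last by lia.
move=> -> //; last by lia.
by apply: (word_den (Bin op e1 e2)).
Qed.

Definition fits s e : Prop := [/\ bounded_state W s, (cost e <= K)%N, small e & safe s e].

Lemma value_fits s e : fits s e -> value B s e = Some (den s e).
Proof. by case; exact: value_den. Qed.

Lemma runs_weaken c s T T' (Q Q' : state -> Prop) : (T <= T')%N ->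
  (forall s', Q s' -> Q' s') -> runs B c s T Q -> runs B c s T' Q'.
Proof.
move=> TT QQ [t [s' [h1 h2 h3]]]; exists t, s'; split=> //; last exact: QQ.
exact: leq_trans h2 TT.
Qed.

Lemma runs_skip s (Q : state -> Prop) : Q s -> runs B Skip s 1 Q.
Proof. by exists 1%N, s; split=> //; exact: ExecSkip. Qed.

Lemma runs_assign r e s (Q : state -> Prop) : fits s e ->
  Q (set_register s r (den s e)) -> runs B (Assign r e) s (cost e).+1 Q.
Proof.
move=> he hQ; exists (cost e).+1, (set_register s r (den s e)); split=> //.
by apply: ExecAssign; exact: value_fits.
Qed.

Lemma runs_write a e s (Q : state -> Prop) : fits s a -> fits s e -> 0 <= den s a ->
  Q (set_memory s `|den s a|%N (den s e)) -> runs B (Write a e) s (cost a + cost e).+1 Q.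
Proof.
move=> ha he a0 hQ; exists (cost a + cost e).+1, (set_memory s `|den s a|%N (den s e)).
split=> //; apply: ExecWrite; last exact: value_fits.
by rewrite value_fits // gez0_abs.
Qed.

Lemma runs_seq c1 c2 s T1 T2 (Q : state -> Prop) :
  runs B c1 s T1 (fun s1 => runs B c2 s1 T2 Q) -> runs B (Defs.Seq c1 c2) s (T1 + T2) Q.
Proof.
move=> [t1 [s1 [h1 l1 [t2 [s2 [h2 l2 hQ]]]]]]; exists (t1 + t2)%N, s2; split=> //.
  exact: ExecSeq h1 h2.
exact: leq_add.
Qed.

Lemma runs_if e c1 c2 s T (Q : state -> Prop) : fits s e ->
  (den s e != 0 -> runs B c1 s T Q) -> (den s e = 0 -> runs B c2 s T Q) ->
  runs B (If e c1 c2) s (cost e + T).+1 Q.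
Proof.
move=> he h1 h2.
have [t [s' [h l hQ]]] : runs B (if den s e != 0 then c1 else c2) s T Q.
  by case: eqP => h; [exact: h2|apply: h1; exact/eqP].
exists (cost e + t).+1, s'; split=> //; last by rewrite ltnS leq_add2l.
by apply: ExecIf h; exact: value_fits.
Qed.

(** The variant m also bounds the number of iterations, hence the time. *)
Lemma runs_while e c T (I : nat -> state -> Prop) (Q : state -> Prop) :
  (forall m s, I m s -> fits s e /\
     (den s e = 0 -> Q s) /\
     (den s e != 0 -> runs B c s T (fun s' => exists2 m', (m' < m)%N & I m' s'))) ->
  forall m s, I m s -> runs B (While e c) s (m * (cost e + T).+1 + (cost e).+1) Q.
Proof.
move=> step; elim/ltn_ind => m IH s hI.
have [he [h0 h1]] := step m s hI; have hv := value_fits he.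
have [d|d] := eqVneq (den s e) 0.
  exists (cost e).+1, s; split; [|exact: leq_addl|exact: h0].
  by apply: ExecWhileStop; rewrite hv d.
have [t1 [s1 [e1 l1 [m' mm hI']]]] := h1 d.
have [t2 [s2 [e2 l2 hQ]]] := IH m' mm s1 hI'.
exists (cost e + t1 + t2).+1, s2; split=> //; first exact: ExecWhileLoop hv d e1 e2.
have : ((m'.+1) * (cost e + T).+1 <= m * (cost e + T).+1)%N by rewrite leq_mul2r mm orbT.
by rewrite mulSn; lia.
Qed.

End Run.

(** * Matching the ends of the cuts by a sweep *)

Section Sweep.
Implicit Types (i j k l : nat).
Variables (z : nat -> hex_point) (n : nat).
Hypothesis Hz : lattice_cycle z n.
Local Notation o := (inside z n (lhex (z 0) (z 1))).

Lemma cycle_near k : `|(z k).1 - (z 0).1| <= k%:Z /\ `|(z k).2 - (z 0).2| <= k%:Z.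
Proof.
elim: k => [|k [h1 h2]]; first by rewrite !subrr.
by have a := cycle_adj Hz k; adj_cases a => _ /=; lia.
Qed.

(** The height changes by at most 1 along an edge of Z, so the shift by n brings the heights between
    0 and 2 n. *)
Definition key k : nat := `|((z k).2 - (z 0).2 + n%:Z)%R|%N.

(** The three coordinates in [line] are within k or k + 1 of those of [z 0], so the total deviation
    is at most 3 k + 1 and the shift by 3 n makes it nonnegative for k below n. *)
Definition column k : nat :=
  `|(line z k - (2 * (z 0).1 + (z 0).2) + 3 * n%:Z)%R|%N.

Lemma keyE k : (k < n)%N -> (key k)%:Z = (z k).2 - (z 0).2 + n%:Z.
Proof. by move=> kn; have [_] := cycle_near k; rewrite /key; lia. Qed.

Lemma key_le k : (k < n)%N -> (key k <= 2 * n)%N.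
Proof. by move=> kn; have [_] := cycle_near k; have := keyE kn; lia. Qed.

Lemma columnE k : (k < n)%N ->
  (column k)%:Z = line z k - (2 * (z 0).1 + (z 0).2) + 3 * n%:Z.
Proof.
move=> kn; have [h1 h2] := cycle_near k; have [h3 h4] := cycle_near k.+1.
by rewrite /column /line; lia.
Qed.

(* The bucket of height b is a linked list; [bucket_head k b] is one plus the
   last edge of height b before k, and 0 if there is none. *)
Fixpoint bucket_head k (b : nat) : nat :=
  if k is k'.+1 then
    if horizontal z k' && (key k' == b) then k'.+1 else bucket_head k' b
  else 0.

Lemma bucket_head_le k b : (bucket_head k b <= k)%N.
Proof. by elim: k => //= k IH; case: ifP => // _; lia. Qed.

Lemma bucket_head_max k b j : (j < k)%N -> horizontal z j -> key j = b ->
  (j < bucket_head k b)%N.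
Proof.
elim: k => //= k IH jk hj kj; case: ifP => [//|h].
apply: IH => //; rewrite ltn_neqAle -ltnS jk andbT; apply/eqP => e.
by rewrite -e hj kj eqxx in h.
Qed.

Lemma bucket_head_succ k b j : bucket_head k b = j.+1 ->
  [/\ (j < k)%N, horizontal z j & key j = b].
Proof.
elim: k => //= k IH; case: ifP => [/andP[h /eqP e] [<-]//|_ /IH[h1 h2 h3]].
by split=> //; exact: ltnW.
Qed.

(* The edges already swept when the lists of the buckets before b - 1 have been
   emptied, and p is the remaining part of the list b - 1. *)
Definition swept b p k : bool :=
  horizontal z k && ((key k).+1 < b)%N || (horizontal z k && ((key k).+1 == b) && (p <=
    k)%N).

Lemma swept_next b k : (k < n)%N ->
  swept b.+1 (bucket_head n b) k = swept b 0 k.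
Proof.
rewrite /swept => kn; case hk : (horizontal z k) => //=.
have [e|e] := eqVneq (key k) b.
  have := bucket_head_max kn hk e; lia.
by lia.
Qed.

Lemma swept_step p k : (k < n)%N -> (p < n)%N -> horizontal z p ->
  swept (key p).+1 (bucket_head p (key p)) k = swept (key p).+1 p.+1 k || (k == p).
Proof.
rewrite /swept => kn pn hp.
have [->|kp] := eqVneq k p.
  by rewrite hp eqxx bucket_head_le !orbT.
case hk : (horizontal z k) => //=; rewrite orbF.
case e : ((key k).+1 == (key p).+1) => //=; congr (_ || _).
have [h|h] := ltnP k p; last by have := bucket_head_le p (key p); lia.
have := bucket_head_max h hk (succn_inj (eqP e)); lia.
Qed.

Lemma swept0 p k : swept 0 p k = false.
Proof. by rewrite /swept ltn0 /=; case: (horizontal z k). Qed.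

Lemma swept_self p : swept (key p).+1 p.+1 p = false.
Proof. by rewrite /swept !ltnn !andbF. Qed.

Lemma swept_all k : (k < n)%N -> swept (2 * n + 2) 0 k = horizontal z k.
Proof.
move=> kn; have := key_le kn; rewrite /swept.
by case: (horizontal z k) => //=; lia.
Qed.

Definition column_swept b p c k : bool := swept b p k && (column k == c).

(* [v] is the content of the cell of the column c: 0 if all the cuts met in this
   column are closed, else one plus the lower end of the open one. *)
Definition column_state b p c (v : int) : Prop :=
  let odd := \big[addb/false]_(0 <= k < n) column_swept b p c k in
  if odd then exists i, [/\ v = i.+1%:Z, (i < n)%N, column_swept b p c i &
      forall k, (k < n)%N -> column_swept b p c k -> (z k).2 <= (z i).2]
  else v = 0.

Definition closed_cuts (k : nat) : int :=
  \sum_(0 <= i < n) (matched z n i k)%:Z * cut_term z n o i k.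

Lemma column_state_ext b p b' p' c v :
  (forall k, (k < n)%N -> swept b p k = swept b' p' k) ->
  column_state b p c v -> column_state b' p' c v.
Proof.
move=> h; have h' k : (k < n)%N -> column_swept b p c k = column_swept b' p' c k.
  by move=> kn; rewrite /column_swept h.
rewrite /column_state (eq_big_nat _ _ (F2 := column_swept b' p' c)) => [|k /= kn];
  last exact: h'.
case: ifP => // _ [i [h1 h2 h3 h4]]; exists i; split=> //; first by rewrite -h'.
by move=> k kn; rewrite -h' //; exact: h4.
Qed.

Section Step.
Variable p : nat.
Hypotheses (pn : (p < n)%N) (hp : horizontal z p).
Local Notation b := (key p).+1.
Local Notation p' := (bucket_head p (key p)).

(** The sweep goes by increasing height, and distinct horizontal edges of a column have distinct
    heights: those swept before p are those below p. *)
Lemma column_swept_below k : (k < n)%N ->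
  column_swept b p.+1 (column p) k = below z k p.
Proof.
move=> kn; rewrite /column_swept /below /swept.
case hk : (horizontal z k) => //=.
have ec : (column k == column p) = (line z k == line z p).
  by apply/eqP/eqP => h; have := columnE kn; have := columnE pn;
    [rewrite h|rewrite h /column]; lia.
have e1 := keyE kn; have e2 := keyE pn.
rewrite ec andbC; have [el|//] := eqVneq (line z k) (line z p) => /=.
apply/orP/idP => [[h|/andP[/eqP h h']]|h]; first by lia.
  have kp : k = p by apply: (rung_inj Hz) => //; lia.
  by rewrite kp ltnn in h'.
by left; lia.
Qed.

Lemma column_state_other c v : c != column p ->
  column_state b p.+1 c v -> column_state b p' c v.
Proof.
move=> cp; have h k : (k < n)%N -> column_swept b p.+1 c k = column_swept b p' c k.
  move=> kn; rewrite /column_swept swept_step //.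
  have [->|_] := eqVneq k p; last by rewrite orbF.
  by rewrite eq_sym (negPf cp) !andbF.
rewrite /column_state (eq_big_nat _ _ (F2 := column_swept b p' c)) => [|k /= kn];
  last exact: h.
case: ifP => // _ [i [h1 h2 h3 h4]]; exists i; split=> //; first by rewrite -h.
by move=> k kn; rewrite -h //; exact: h4.
Qed.

Lemma column_odd_step :
  \big[addb/false]_(0 <= k < n) column_swept b p' (column p) k =
  ~~ \big[addb/false]_(0 <= k < n) column_swept b p.+1 (column p) k.
Proof.
rewrite (eq_big_nat _ _ (F2 := fun k => column_swept b p.+1 (column p) k (+) (k == p)));
  last first.
  move=> k /= kn; rewrite /column_swept swept_step //.
  have [->|_] := eqVneq k p; last by rewrite orbF addbF.
  by rewrite swept_self // eqxx.
rewrite big_split /=.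
suff -> : \big[addb/false]_(0 <= k < n) (k == p) = true by rewrite addbT.
rewrite big_mkord (bigD1 (Ordinal pn)) //= eqxx big1 // => k kp.
by apply: contraNF kp => /eqP kp; apply/eqP/val_inj.
Qed.

(** The number of edges below p in its column is even, so no cut has its upper end at p. *)
Lemma column_open : column_state b p.+1 (column p) 0 ->
  column_state b p' (column p) p.+1%:Z /\ closed_cuts p = 0.
Proof.
rewrite /column_state column_odd_step.
case: ifP => [_ [i []//]|odd _]; split.
  exists p; split=> // [|k kn].
    by rewrite /column_swept swept_step // !eqxx orbT.
  rewrite /column_swept swept_step // andb_orl => /orP[h|/andP[/eqP -> //]].
  have : column_swept b p.+1 (column p) k by [].
  by rewrite column_swept_below // => /and3P[_ _ /ltW].
rewrite /closed_cuts big1_seq // => i _; rewrite /matched.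
suff -> : open_below z n p = false by rewrite !andbF mul0r.
rewrite -odd; apply: eq_big_nat => k /= kn; by rewrite column_swept_below.
Qed.

(** The number of edges below p is odd and i is the highest of them, so it is the one edge matched
    with p. *)
Lemma column_close i : column_state b p.+1 (column p) i.+1%:Z ->
  [/\ column_state b p' (column p) 0, (i < n)%N & closed_cuts p = cut_term z n o i p].
Proof.
rewrite /column_state column_odd_step.
case: ifP => [odd [j [[<-] ln hi imax]]|_ //]; split=> //.
rewrite column_swept_below // in hi.
have m : matched z n i p.
  apply/and4P; split=> //.
    suff -> : open_below z n p =
        \big[addb/false]_(0 <= k < n) column_swept b p.+1 (column p) k by [].
    by apply: eq_big_nat => k /= kn; rewrite column_swept_below.
  apply/allP => l; rewrite mem_iota add0n /= => l_n; apply/negP => /andP[h1 h2].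
  have := imax l l_n; rewrite column_swept_below // => /(_ h2).
  by case/and3P: h1 => _ _ h1; lia.
rewrite /closed_cuts big_mkord (bigD1 (Ordinal ln)) //= m mul1r big1 ?addr0 // => k ki.
suff -> : matched z n k p = false by rewrite mul0r.
apply: negbTE; apply: contraNN ki => m'; apply/eqP/val_inj => /=.
have [h1 h2 h3 _] := matched_rel Hz m; have [h4 _ h5 _] := matched_rel Hz m'.
have [_ _ _ h] := matched_rel Hz m; have [_ _ _ h'] := matched_rel Hz m'.
apply: (rung_inj Hz) => //; first by rewrite h3 h5.
case: (ltgtP (z k).2 (z i).2) => // hlt.
  by case: (matched_between Hz m' ln h1) => //; [rewrite h3 h5|lia].
by case: (matched_between Hz m (ltn_ord k) h4) => //; [rewrite h3 h5|lia].
Qed.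

Lemma swept_sum_step (F : nat -> int) :
  \sum_(0 <= k < n | swept b p' k) F k = \sum_(0 <= k < n | swept b p.+1 k) F k + F p.
Proof.
rewrite big_mkcond [X in _ = X + _]big_mkcond /= !big_mkord.
rewrite (bigD1 (Ordinal pn)) //= [X in _ = X + _](bigD1 (Ordinal pn)) //=.
rewrite swept_step // swept_self // eqxx /= add0r addrC; congr (_ + _).
apply: eq_bigr => k kp; rewrite swept_step //.
suff -> : (val k == p) = false by rewrite orbF.
by apply: contraNF kp => /eqP kp; apply/eqP/val_inj.
Qed.

Lemma swept_count_step :
  (count (fun k => horizontal z k && ~~ swept b p' k) (iota 0 n) <
   count (fun k => horizontal z k && ~~ swept b p.+1 k) (iota 0 n))%N.
Proof.
rewrite -!sum1_count /= -/(index_iota _ _).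
have -> : iota 0 n = index_iota 0 n by rewrite /index_iota subn0.
rewrite big_mkcond [X in (_ < X)%N]big_mkcond /= !big_mkord.
rewrite (bigD1 (Ordinal pn)) //= [X in (_ < X)%N](bigD1 (Ordinal pn)) //=.
rewrite swept_step // eqxx orbT andbF swept_self // hp /= add0n add1n ltnS.
apply: leq_sum => k kp; rewrite swept_step //.
suff -> : (val k == p) = false by rewrite orbF.
by apply: contraNF kp => /eqP kp; apply/eqP/val_inj.
Qed.

End Step.

Lemma closed_cuts_sum :
  \sum_(0 <= k < n | swept (2 * n + 2) 0 k) closed_cuts k = cut_sum z n o.
Proof.
rewrite big_mkcond; apply: eq_big_nat => k /= kn; rewrite swept_all //.
case h : (horizontal z k) => //; rewrite big1_seq // => i _.
by rewrite /matched h mul0r.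
Qed.

End Sweep.

(** * The program *)

(** Meant for commands without loops; the value for [While] is a dummy. *)
Fixpoint straight_cost (c : cmd) : nat :=
  match c with
  | Skip => 1
  | Assign _ e => (cost e).+1
  | Write a e => (cost a + cost e).+1
  | Defs.Seq c1 c2 => straight_cost c1 + straight_cost c2
  | If e c1 c2 => (cost e + maxn (straight_cost c1) (straight_cost c2)).+1
  | While _ _ => 0
  end.

Definition straight B c s Q := runs B c s (straight_cost c) Q.

Lemma straight_seq B c1 c2 s Q :
  straight B c1 s (fun s1 => straight B c2 s1 Q) -> straight B (Defs.Seq c1 c2) s Q.
Proof. exact: runs_seq. Qed.

Lemma straight_weaken B c s (Q Q' : state -> Prop) :
  straight B c s Q -> (forall s', Q s' -> Q' s') -> straight B c s Q'.
Proof. by move=> h QQ; apply: runs_weaken h. Qed.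

Lemma straight_if B W K e c1 c2 s Q : (15 <= W)%N -> (W ^ K <= B)%N -> fits W K s e ->
  (den s e != 0 -> straight B c1 s Q) -> (den s e = 0 -> straight B c2 s Q) ->
  straight B (If e c1 c2) s Q.
Proof.
move=> hW hB he h1 h2; apply: (runs_if hW hB he) => h.
  by apply: runs_weaken (h1 h) => //; exact: leq_maxl.
by apply: runs_weaken (h2 h) => //; exact: leq_maxr.
Qed.

Definition addr (t i : expr) : expr :=
  Bin Plus (Bin Times (Const 2) (Reg 1)) (Bin Plus (Bin Times (Const 15) i) t).

(* Memory beyond the input is split in 15 interleaved arrays, five for each of
   the three directions of cuts. *)
Definition cell (n t i : nat) : nat := 2 * n + (15 * i + t).

Definition input_fst (i : expr) : expr := Read (Bin Times (Const 2) i).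
Definition input_snd (i : expr) : expr := Read (Bin Plus (Bin Times (Const 2) i) (Const 1)).
Definition input_third (i : expr) : expr :=
  Bin Minus (Bin Minus (Const 0) (input_fst i)) (input_snd i).

(** The rotation permutes a, b and - a - b cyclically, so each direction reads the same input
    through permuted coordinates. *)
Definition coord_fst (q : nat) : expr -> expr :=
  match q with 0 => input_fst | 1 => input_third | _ => input_snd end.
Definition coord_snd (q : nat) : expr -> expr :=
  match q with 0 => input_snd | 1 => input_fst | _ => input_third end.

(** Reduction modulo n by one conditional subtraction, exact when register 2 is below n and d is
    between 0 and n. *)
Definition cyclic_index (d : int) : expr :=
  let j := Bin Plus (Reg 2) (Const d) in
  Bin Minus j (Bin Times (Reg 1) (Bin Less (Bin Minus (Reg 1) (Const 1)) j)).

Definition rotated (q : nat) (z : nat -> hex_point) : nat -> hex_point :=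
  match q with 0 => z | 1 => rotate \o z | _ => rotate \o (rotate \o z) end.

Definition input_state (z : nat -> hex_point) (n : nat) (s : state) : Prop :=
  register s 1 = n%:Z /\ forall j, (j < n)%N ->
    memory s (2 * j) = (z j).1 /\ memory s (2 * j + 1) = (z j).2.

Lemma cell_inj n t i t' i' : (t < 15)%N -> (t' < 15)%N ->
  (cell n t' i' == cell n t i) = (t' == t) && (i' == i).
Proof. by rewrite /cell => h h'; apply/eqP/andP => [e|[/eqP -> /eqP -> //]]; split;
  lia. Qed.

Lemma memory_cell s n t i v t' i' : (t < 15)%N -> (t' < 15)%N ->
  memory (set_memory s (cell n t i) v) (cell n t' i') =
  if (t' == t) && (i' == i) then v else memory s (cell n t' i').
Proof. by move=> h h'; rewrite /= cell_inj. Qed.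

Lemma input_state_memory z n s t i v : input_state z n s ->
  input_state z n (set_memory s (cell n t i) v).
Proof.
case=> h1 h2; split=> // j jn; have [<- <-] := h2 j jn; rewrite /= /cell.
by split; case: ifP => // /eqP; lia.
Qed.

Lemma input_state_register z n s r v : r != 1%N -> input_state z n s ->
  input_state z n (set_register s r v).
Proof. by move=> r1 [h1 h2]; split=> //=; rewrite eq_sym (negPf r1). Qed.

Section Den.
Variables (z : nat -> hex_point) (n : nat) (s : state).
Hypothesis Hs : input_state z n s.

Lemma den_addr te ie t i : den s te = t%:Z -> den s ie = i%:Z ->
  den s (addr te ie) = (cell n t i)%:Z.
Proof. by case: Hs => h1 _ /= -> ->; rewrite h1 /cell; lia. Qed.

Lemma absz_den_addr te ie t i : den s te = t%:Z -> den s ie = i%:Z ->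
  `|den s (addr te ie)|%N = cell n t i.
Proof. by move=> h1 h2; rewrite (den_addr h1 h2). Qed.

Lemma safe_addr te ie : safe s te -> safe s ie -> safe s (addr te ie).
Proof. by move=> h1 h2; do !split. Qed.

Lemma den_read_addr te ie t i : den s te = t%:Z -> den s ie = i%:Z ->
  den s (Read (addr te ie)) = memory s (cell n t i).
Proof. by move=> h1 h2; cbn [den]; rewrite (absz_den_addr h1 h2). Qed.

Lemma safe_read_addr te ie t i : den s te = t%:Z -> den s ie = i%:Z ->
  safe s te -> safe s ie -> safe s (Read (addr te ie)).
Proof. by move=> h1 h2 h3 h4; split; [rewrite (den_addr h1 h2)|exact: safe_addr]. Qed.

Lemma den_input ie j : den s ie = j%:Z -> (j < n)%N ->
  den s (input_fst ie) = (z j).1 /\ den s (input_snd ie) = (z j).2.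
Proof.
move=> h jn; have [_ /(_ j jn)[h1 h2]] := Hs; rewrite /= h.
by rewrite -h1 -h2; split; congr (memory s _); lia.
Qed.

Lemma safe_input ie (j : nat) : den s ie = j%:Z -> safe s ie ->
  safe s (input_fst ie) /\ safe s (input_snd ie).
Proof. by move=> h h'; rewrite /= h; do !split => //; lia. Qed.

Lemma den_coord q ie j : den s ie = j%:Z -> (j < n)%N ->
  den s (coord_fst q ie) = (rotated q z j).1 /\ den s (coord_snd q ie) = (rotated q z j).2.
Proof.
move=> h jn; have [h1 h2] := den_input h jn.
case: q => [|[|q]] //; rewrite /coord_fst /coord_snd /input_third; cbn [den eval_binop];
  rewrite h1 h2 /=; split=> //; ring.
Qed.

Lemma safe_coord q ie (j : nat) : den s ie = j%:Z -> safe s ie ->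
  safe s (coord_fst q ie) /\ safe s (coord_snd q ie).
Proof.
move=> h h'; have [h1 h2] := safe_input h h'.
by case: q => [|[|q]] //; split=> //; split=> //; split.
Qed.

Lemma den_index k (d : nat) : register s 2 = k%:Z -> (k < n)%N -> (d <= n)%N ->
  den s (cyclic_index d%:Z) = ((k + d) %% n)%N%:Z.
Proof.
move=> h2 kn dn; have [h1 _] := Hs; rewrite /= h1 h2.
have -> : ((n%:Z - 1 < k%:Z + d%:Z)%R) = (n <= k + d)%N by lia.
case: leqP => h /=; last by rewrite modn_small // mulr0 subr0.
have -> : (k + d = (k + d - n) + n)%N by lia.
by rewrite modnDr modn_small; lia.
Qed.

Lemma safe_index d : safe s (cyclic_index d). Proof. by []. Qed.
End Den.

Arguments addr : simpl never.
Arguments coord_fst : simpl never.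
Arguments coord_snd : simpl never.
Arguments cyclic_index : simpl never.
Arguments cell : simpl never.

Section Program.
Variable q : nat.

Definition turn_expr : expr :=
  let a := coord_fst q in let b := coord_snd q in
  Bin Minus
    (Bin Times (Bin Minus (a (cyclic_index 1)) (a (Reg 2))) (Bin Minus (b (cyclic_index
      2)) (b (cyclic_index 1))))
    (Bin Times (Bin Minus (b (cyclic_index 1)) (b (Reg 2))) (Bin Minus (a (cyclic_index
      2)) (a (cyclic_index 1)))).

Definition height_expr : expr :=
  let b := coord_snd q in
  Bin Minus (Bin Minus (Bin Times (Const 2) (b (cyclic_index 1))) (b (Reg 2))) (b
    (cyclic_index 2)).

Definition weight_expr : expr :=
  Bin Plus (Bin Times height_expr (coord_snd q (cyclic_index 1))) (Bin Equal height_expr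
    (Const 1)).

Definition key_expr : expr :=
  Bin Plus (Bin Minus (coord_snd q (Reg 2)) (coord_snd q (Const 0))) (Reg 1).

Definition column_expr : expr :=
  let a := coord_fst q in let b := coord_snd q in
  Bin Plus (Bin Minus (Bin Plus (Bin Plus (a (Reg 2)) (a (cyclic_index 1))) (b (Reg 2)))
                      (Bin Plus (Bin Times (Const 2) (a (Const 0))) (b (Const 0))))
           (Bin Times (Const 3) (Reg 1)).

Definition tag_expr (t : nat) : expr := Const (5 * q + t)%N%:Z.

(* Registers: 1 the length n, 2 the current edge k, 3 and 4 the prefix sums for the
   two orientations, 5 the result, 6 the orientation, 7 and 8 the next bucket and
   the rest of the current one, 9 the open edge, 10 the number of vertices, 11 the
   size of a side.  Arrays: 0 and 1 the prefix sums, 2 and 3 the links and heads of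
   the buckets, 4 the open edges of the columns. *)
Definition scan_step : cmd :=
  Defs.Seq (Write (addr (tag_expr 0) (Reg 2)) (Reg 3))
  (Defs.Seq (Write (addr (tag_expr 1) (Reg 2)) (Reg 4))
  (Defs.Seq
    (If (Bin Equal (coord_snd q (Reg 2)) (coord_snd q (cyclic_index 1)))
      (Defs.Seq (Write (addr (tag_expr 2) (Reg 2)) (Read (addr (tag_expr 3) key_expr)))
                (Write (addr (tag_expr 3) key_expr) (Bin Plus (Reg 2) (Const 1))))
      Skip)
  (Defs.Seq (Assign 3 (Bin Plus (Reg 3) (Bin Times (Bin Equal turn_expr (Const 1))
    weight_expr)))
  (Defs.Seq (Assign 4 (Bin Plus (Reg 4) (Bin Times (Bin Equal turn_expr (Const (-1)))
    weight_expr)))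
  (Assign 2 (Bin Plus (Reg 2) (Const 1))))))).

Definition prefix_expr (i : expr) : expr :=
  Read (addr (Bin Plus (tag_expr 0) (Reg 6)) i).

(** Register 11 times 1 - 2 b, where b is the truth value of its being negative, is its absolute
    value. *)
Definition close_step : cmd :=
  Defs.Seq (Assign 9 (Bin Minus (Reg 9) (Const 1)))
  (Defs.Seq (Assign 11 (Bin Minus (prefix_expr (Reg 2)) (prefix_expr (Reg 9))))
  (Defs.Seq (Assign 11 (Bin Times (Reg 11)
       (Bin Minus (Const 1) (Bin Times (Const 2) (Bin Less (Reg 11) (Const 0))))))
  (Defs.Seq (Assign 5 (Bin Plus (Reg 5)
       (Bin Times (Bin Plus (Bin Quot (Bin Minus (coord_snd q (Reg 2)) (coord_snd q (Reg
         9)))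
                                      (Const 2)) (Const 1))
                  (Bin Times (Reg 11) (Bin Minus (Reg 10) (Reg 11))))))
  (Write (addr (tag_expr 4) column_expr) (Const 0))))).

Definition sweep_step : cmd :=
  If (Bin Equal (Reg 8) (Const 0))
    (Defs.Seq (Assign 8 (Read (addr (tag_expr 3) (Reg 7)))) (Assign 7 (Bin Plus (Reg 7)
      (Const 1))))
    (Defs.Seq (Assign 2 (Bin Minus (Reg 8) (Const 1)))
    (Defs.Seq (Assign 8 (Read (addr (tag_expr 2) (Reg 2))))
    (Defs.Seq (Assign 9 (Read (addr (tag_expr 4) column_expr)))
    (If (Bin Equal (Reg 9) (Const 0))
      (Write (addr (tag_expr 4) column_expr) (Bin Plus (Reg 2) (Const 1)))
      close_step)))).

Definition scan_cond : expr := Bin Less (Reg 2) (Reg 1).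
Definition sweep_cond : expr :=
  Bin Less (Reg 7) (Bin Plus (Bin Times (Const 2) (Reg 1)) (Const 2)).

Definition scan_init : cmd :=
  Defs.Seq (Assign 2 (Const 0)) (Defs.Seq (Assign 3 (Const 0)) (Assign 4 (Const 0))).

(** Register 6 is 0 when the total weight in register 3 is positive, that is when the inside lies to
    the left, and 1 otherwise; it serves as an offset selecting one of the two arrays of prefix
    sums. *)
Definition sweep_init : cmd :=
  Defs.Seq (Assign 6 (Bin Minus (Const 1) (Bin Less (Const 0) (Reg 3))))
  (Defs.Seq (Assign 10 (Bin Plus (Bin Times (Reg 3) (Bin Minus (Const 1) (Reg 6)))
                                 (Bin Times (Reg 4) (Reg 6))))
  (Defs.Seq (Assign 7 (Const 0)) (Assign 8 (Const 0)))).

Definition round : cmd :=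
  Defs.Seq scan_init (Defs.Seq (While scan_cond scan_step)
    (Defs.Seq sweep_init (While sweep_cond sweep_step))).

End Program.

Lemma posz_eq_neq0 (x y : int) : Posz (x == y) != 0 -> x = y.
Proof. by case: (eqVneq x y). Qed.

(** * Correctness of the round for one direction *)

Section Round.
Variables (z0 : nat -> hex_point) (n q : nat).
Hypothesis Hq : (q < 3)%N.
Local Notation z := (rotated q z0).
Hypothesis Hz : lattice_cycle z n.
Variables (B W K : nat).
Hypotheses (W15 : (15 <= W)%N) (WB : (W ^ K <= B)%N) (HK : (1000 <= K)%N).
Local Notation o := (orientation z n).
Local Notation fits := (fits W K).

(** 1000 is a round bound on the cost of the expressions of the program. *)
Definition cheap (e : expr) : bool := (cost e <= 1000)%N && small e.

Lemma fits_cheap s e : bounded_state W s -> cheap e -> safe s e -> fits s e.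
Proof. by move=> h /andP[h1 h2] h3; split=> //; apply: leq_trans HK. Qed.

Section Exprs.
Variables (s : state) (k : nat).
Hypotheses (Hs : input_state z0 n s) (H2 : register s 2 = k%:Z) (kn : (k < n)%N).

Lemma den_next (d : nat) : (d < 3)%N ->
  den s (coord_fst q (cyclic_index d%:Z)) = (z (k + d)).1 /\
  den s (coord_snd q (cyclic_index d%:Z)) = (z (k + d)).2.
Proof.
move=> d3; have n2 := cycle_gt2 Hz; rewrite -(cycle_mod Hz (k + d)).
have dn : (d <= n)%N by lia.
by apply: (den_coord Hs) (den_index Hs H2 kn dn) _; apply: ltn_pmod; lia.
Qed.

Lemma den_here :
  den s (coord_fst q (Reg 2)) = (z k).1 /\ den s (coord_snd q (Reg 2)) = (z k).2.
Proof. exact: (@den_coord _ _ _ Hs q (Reg 2) k). Qed.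

Lemma den_first :
  den s (coord_fst q (Const 0)) = (z 0).1 /\ den s (coord_snd q (Const 0)) = (z 0).2.
Proof. by have n2 := cycle_gt2 Hz; apply: (@den_coord _ _ _ Hs q (Const 0) 0) => //;
  lia. Qed.

Lemma safe_next (d : nat) : (d < 3)%N ->
  safe s (coord_fst q (cyclic_index d%:Z)) /\ safe s (coord_snd q (cyclic_index d%:Z)).
Proof.
move=> d3; have n2 := cycle_gt2 Hz; have dn : (d <= n)%N by lia.
exact: safe_coord (den_index Hs H2 kn dn) (safe_index _ _).
Qed.

Lemma safe_here : safe s (coord_fst q (Reg 2)) /\ safe s (coord_snd q (Reg 2)).
Proof. exact: (@safe_coord s q (Reg 2) k). Qed.

Lemma safe_first : safe s (coord_fst q (Const 0)) /\ safe s (coord_snd q (Const 0)).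
Proof. by apply: (@safe_coord s q (Const 0) 0). Qed.

Lemma den_turn : den s (turn_expr q) = turn (z k) (z k.+1) (z k.+2).
Proof.
have [a0 b0] := den_here; have [a1 b1] := den_next (isT : (1 < 3)%N).
have [a2 b2] := den_next (isT : (2 < 3)%N).
by cbn [turn_expr den eval_binop]; rewrite a0 b0 a1 b1 a2 b2 addn1 addn2.
Qed.

Lemma safe_turn : safe s (turn_expr q).
Proof.
have [a0 b0] := safe_here; have [a1 b1] := safe_next (isT : (1 < 3)%N).
by have [a2 b2] := safe_next (isT : (2 < 3)%N); do !split.
Qed.

Lemma den_weight : den s (weight_expr q) = exit_weight z k.
Proof.
have [a0 b0] := den_here; have [a1 b1] := den_next (isT : (1 < 3)%N).
have [a2 b2] := den_next (isT : (2 < 3)%N).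
cbn [weight_expr height_expr den eval_binop]; rewrite b0 b1 b2 addn1 addn2.
by [].
Qed.

Lemma safe_weight : safe s (weight_expr q).
Proof.
have [a0 b0] := safe_here; have [a1 b1] := safe_next (isT : (1 < 3)%N).
by have [a2 b2] := safe_next (isT : (2 < 3)%N); do !split.
Qed.

Lemma den_key : den s (key_expr q) = (key z n k)%:Z.
Proof.
have [_ b0] := den_here; have [_ b1] := den_first; have [e _] := Hs.
by cbn [key_expr den eval_binop]; rewrite b0 b1 e (keyE Hz).
Qed.

Lemma safe_key : safe s (key_expr q).
Proof. by have [_ b0] := safe_here; have [_ b1] := safe_first; do !split. Qed.

Lemma den_column : den s (column_expr q) = (column z n k)%:Z.
Proof.
have [a0 b0] := den_here; have [a1 b1] := den_next (isT : (1 < 3)%N).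
have [a b] := den_first; have [e _] := Hs.
cbn [column_expr den eval_binop]; rewrite a0 b0 a1 a b e addn1.
by rewrite (columnE Hz).
Qed.

Lemma safe_column : safe s (column_expr q).
Proof.
have [a0 b0] := safe_here; have [a1 b1] := safe_next (isT : (1 < 3)%N).
by have [a b] := safe_first; do !split.
Qed.

End Exprs.

(** The last clause keeps the arrays of the later directions at 0, so no time is spent on clearing
    them. *)
Definition common (s : state) : Prop :=
  [/\ input_state z0 n s, bounded_state W s &
      forall t i, (5 * q + 5 <= t)%N -> (t < 15)%N -> memory s (cell n t i) = 0].

Definition table (s : state) (t i : nat) : int := memory s (cell n (5 * q + t) i).

Lemma common_write s t i v : (t < 5)%N -> (`|v| <= W)%N -> common s ->
  common (set_memory s (cell n (5 * q + t) i) v).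
Proof.
move=> t5 vW [h1 h2 h3]; split; first exact: input_state_memory.
  exact: bounded_set_memory.
move=> t' i' h h'; rewrite memory_cell //; last by lia.
by case: eqP => [e|_]; [exfalso; lia|exact: h3].
Qed.

Lemma common_assign s r v : r != 1%N -> (`|v| <= W)%N -> common s ->
  common (set_register s r v).
Proof.
move=> r1 vW [h1 h2 h3]; split; [exact: input_state_register|exact: bounded_set_register|].
by move=> t i; exact: h3.
Qed.

Lemma table_write s t i v t' i' : (t < 5)%N -> (t' < 5)%N ->
  table (set_memory s (cell n (5 * q + t) i) v) t' i' =
  if (t' == t) && (i' == i) then v else table s t' i'.
Proof. by move=> h h'; rewrite /table memory_cell ?eqn_add2l //; lia. Qed.

Lemma table_bounded s t i : common s -> (`|table s t i| <= W)%N.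
Proof. by case=> _ [_ h] _; exact: h. Qed.

Lemma den_tag s t : den s (tag_expr q t) = (5 * q + t)%N%:Z. Proof. by []. Qed.

Lemma straight_write s t ie e i (Q : state -> Prop) : common s ->
  den s ie = i%:Z -> safe s ie -> cheap (addr (tag_expr q t) ie) -> cheap e -> safe s e ->
  Q (set_memory s (cell n (5 * q + t) i) (den s e)) ->
  straight B (Write (addr (tag_expr q t) ie) e) s Q.
Proof.
move=> [h1 h2 h3] hi si ca ce se hQ.
apply: (runs_write W15 WB).
- by apply: fits_cheap => //; exact: safe_addr.
- exact: fits_cheap.
- by rewrite (den_addr h1 (den_tag s t) hi).
- by rewrite (absz_den_addr h1 (den_tag s t) hi).
Qed.

Lemma straight_assign s r e (Q : state -> Prop) : common s -> cheap e -> safe s e ->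
  Q (set_register s r (den s e)) -> straight B (Assign r e) s Q.
Proof. by move=> [h1 h2 h3] ce se hQ; apply: (runs_assign W15 WB) => //;
  exact: fits_cheap. Qed.

Lemma straight_test s e c1 c2 (Q : state -> Prop) : common s -> cheap e -> safe s e ->
  (den s e != 0 -> straight B c1 s Q) -> (den s e = 0 -> straight B c2 s Q) ->
  straight B (If e c1 c2) s Q.
Proof. by move=> [h1 h2 h3] ce se; apply: (straight_if W15 WB); exact: fits_cheap. Qed.

Lemma den_table s t ie i : common s -> den s ie = i%:Z ->
  den s (Read (addr (tag_expr q t) ie)) = table s t i.
Proof. by move=> [h _ _] hi; rewrite (den_read_addr h (den_tag s t) hi). Qed.

Lemma safe_table s t ie i : common s -> den s ie = i%:Z -> safe s ie ->
  safe s (Read (addr (tag_expr q t) ie)).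
Proof. by move=> [h _ _] hi si; apply: (safe_read_addr h (den_tag s t) hi). Qed.

Variable acc0 : int.
Hypotheses (Wn : (4 * n + 4 <= W)%N)
  (Wprefix : forall b k, (k <= n)%N -> (3 * `|prefix_weight z b k| <= W)%N)
  (Wacc : forall P : pred nat,
     (`|(acc0 + \sum_(0 <= k < n | P k) closed_cuts z n k)%R| <= W)%N).

Ltac cheap_tac := move: Hq; clear; case: (q) => [|[|[|]]] // _; vm_compute; reflexivity.

Definition scan_tables (k : nat) (s : state) : Prop :=
  [/\ forall j, (j < k)%N -> table s 0 j = prefix_weight z true j /\
                             table s 1 j = prefix_weight z false j,
      forall b, table s 3 b = (bucket_head z n k b)%:Z,
      forall j, (j < k)%N -> horizontal z j ->
                table s 2 j = (bucket_head z n j (key z n j))%:Z &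
      forall i, table s 4 i = 0].

Definition scan_inv (k : nat) (s : state) : Prop :=
  [/\ common s, register s 5 = acc0, register s 2 = k%:Z,
      register s 3 = prefix_weight z true k /\ register s 4 = prefix_weight z false k &
      scan_tables k s].

Lemma scan_step_spec k s : (k < n)%N -> scan_inv k s ->
  straight B (scan_step q) s (scan_inv k.+1).
Proof.
move=> kn [cs r5 r2 [r3 r4] [T01 T3 T2 T4]].
have Wk b j : (j <= n)%N -> (`|prefix_weight z b j| <= W)%N.
  by move=> /(Wprefix b); lia.
have [is0 _ _] := cs.
apply: straight_seq; apply: (@straight_write s 0 (Reg 2) (Reg 3) k) => //.
  by cheap_tac.
rewrite [den s (Reg 3)]r3.
set s1 := set_memory _ _ _.
have cs1 : common s1 by apply: common_write => //; apply: Wk; lia.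
apply: straight_seq; apply: (@straight_write s1 1 (Reg 2) (Reg 4) k) => //.
  by cheap_tac.
rewrite [den s1 (Reg 4)]r4.
set s2 := set_memory _ _ _.
have cs2 : common s2 by apply: common_write => //; apply: Wk; lia.
have [is2 _ _] := cs2.
have r2' : register s2 2 = k%:Z by [].
have T' t i : (1 < t < 5)%N -> table s2 t i = table s t i.
  move=> /andP[t1 t5]; rewrite !table_write //.
  by case: t t1 {t5} => [|[|t]].
apply: straight_seq.
pose mid s' := [/\ common s', forall r,
  register s' r = register s2 r & scan_tables k.+1 s'].
have T01' : forall j, (j < k.+1)%N -> table s2 0 j = prefix_weight z true j /\
                             table s2 1 j = prefix_weight z false j.
  move=> j jk; rewrite !table_write //=; case: eqP => [->//|jn].
  by apply: T01; rewrite ltn_neqAle -ltnS jk andbT; apply/eqP.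
have [_ hb0] := den_here is2 r2' kn.
have [_ hb1] := den_next is2 r2' kn (isT : (1 < 3)%N); rewrite addn1 in hb1.
have [_ sb0] := safe_here r2'; have [_ sb1] := safe_next is2 r2' kn (isT : (1 < 3)%N).
apply: (@straight_weaken _ _ _ mid).
  apply: (straight_test cs2) => //; first by cheap_tac.
    move=> h; have hk : horizontal z k.
      by move: h; cbn [den eval_binop]; rewrite hb0 hb1 -/(horizontal z k);
        case: (horizontal z k).
    have ke := den_key is2 r2' kn; have sk := safe_key r2'.
    apply: straight_seq; apply: (@straight_write s2 2 (Reg 2) _ k) => //;
      first by cheap_tac.
        by cheap_tac.
      exact: safe_table ke sk.
    rewrite (den_table _ cs2 ke) T' // T3.
    set s3 := set_memory _ _ _.
    have cs3 : common s3.
      apply: common_write => //; have := bucket_head_le z n k (key z n k); lia.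
    have [is3 _ _] := cs3; have r2'' : register s3 2 = k%:Z by [].
    have ke' := den_key is3 r2'' kn; have sk' := safe_key r2''.
    apply: (@straight_write s3 3 _ _ _ _ cs3 ke') => //; first by cheap_tac.
    have -> : den s3 (Bin Plus (Reg 2) (Const 1)) = k.+1%:Z by rewrite /= r2; lia.
    split=> //; first by apply: common_write => //; lia.
    split.
    - by move=> j jk; have [<- <-] := T01' j jk; rewrite !table_write.
    - by move=> b; rewrite !table_write //= hk; case: (eqVneq (key z n k) b) => // _;
      rewrite T3.
    - move=> j jk hj; rewrite !table_write //=; case: eqP => [->//|jn].
      by rewrite T2 // ltn_neqAle -ltnS jk andbT; apply/eqP.
    - by move=> i; rewrite !table_write //= T4.
  move=> h; have hk : horizontal z k = false.
    by move: h; cbn [den eval_binop]; rewrite hb0 hb1 -/(horizontal z k);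
      case: (horizontal z k).
  apply: runs_skip; split=> //; split=> //.
  - by move=> b; rewrite T' // T3 /= hk.
  - move=> j jk hj; rewrite T' // T2 // ltn_neqAle -ltnS jk andbT.
    by apply: contraTneq hj => ->; rewrite hk.
  - by move=> i; rewrite T' // T4.
move=> s3 [cs3 r3' [U01 U3 U2 U4]].
have [is3 _ _] := cs3; have p2 : register s3 2 = k%:Z by rewrite r3'.
have pstep b : prefix_weight z b k.+1 =
    prefix_weight z b k + (spoke_out b (z k) (z k.+1) (z k.+2))%:Z * exit_weight z k.
  by rewrite /prefix_weight big_nat_recr.
have st := safe_turn is3 p2 kn; have sw := safe_weight is3 p2 kn.
apply: straight_seq; apply: (straight_assign cs3); first by cheap_tac.
  exact: (conj I (conj (conj st I) sw)).
have -> : den s3 (Bin Plus (Reg 3) (Bin Times (Bin Equal (turn_expr q) (Const 1))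
  (weight_expr q)))
    = prefix_weight z true k.+1.
  by cbn [den eval_binop];
    rewrite (den_turn is3 p2 kn) (den_weight is3 p2 kn) r3' [register s2 3]r3 pstep.
set s4 := set_register _ _ _.
have cs4 : common s4 by apply: common_assign => //; exact: Wk.
have [is4 _ _] := cs4; have p2' : register s4 2 = k%:Z by [].
have st' := safe_turn is4 p2' kn; have sw' := safe_weight is4 p2' kn.
apply: straight_seq; apply: (straight_assign cs4); first by cheap_tac.
  exact: (conj I (conj (conj st' I) sw')).
have -> : den s4 (Bin Plus (Reg 4) (Bin Times (Bin Equal (turn_expr q) (Const (-1)))
  (weight_expr q)))
    = prefix_weight z false k.+1.
  cbn [den eval_binop]; rewrite (den_turn is4 p2' kn) (den_weight is4 p2' kn).
  by rewrite /s4 [register (set_register _ _ _) 4]r3' [register s2 4]r4 pstep.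
set s5 := set_register _ _ _.
have cs5 : common s5 by apply: common_assign => //; exact: Wk.
apply: (straight_assign cs5) => //.
have -> : den s5 (Bin Plus (Reg 2) (Const 1)) = k.+1%:Z by rewrite /= p2; lia.
split=> //.
- by apply: common_assign => //; lia.
- by rewrite /= r3'.
Qed.

Definition sweep_tables (s : state) : Prop :=
  [/\ forall j, (j < n)%N -> table s 0 j = prefix_weight z true j /\
                             table s 1 j = prefix_weight z false j,
      forall b, table s 3 b = (bucket_head z n n b)%:Z &
      forall j, (j < n)%N -> horizontal z j ->
                table s 2 j = (bucket_head z n j (key z n j))%:Z].

Definition sweep_state (b p : nat) (s : state) : Prop :=
  [/\ register s 6 = (~~ o)%:Z, register s 10 = prefix_weight z o n,
      p = 0%N \/ exists j, [/\ p = j.+1, (j < n)%N, horizontal z j & (key z n j).+1 = b],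
      register s 5 = acc0 + \sum_(0 <= k < n | swept z n b p k) closed_cuts z n k &
      forall c, column_state z n b p c (table s 4 c)].

(** The variant counts the buckets still to be opened and the edges still to be swept; each step
    lowers one of these numbers and keeps the other. *)
Definition sweep_inv (m : nat) (s : state) : Prop :=
  exists b p, [/\ common s, register s 7 = b%:Z /\ register s 8 = p%:Z,
    (b <= 2 * n + 2)%N /\
    m = (2 * n + 2 - b + count (fun k =>
      horizontal z k && ~~ swept z n b p k) (iota 0 n))%N,
    sweep_state b p s & sweep_tables s].

Lemma den_prefix s ie j : common s -> sweep_tables s -> register s 6 = (~~ o)%:Z ->
  den s ie = j%:Z -> (j < n)%N -> den s (prefix_expr q ie) = prefix_weight z o j.
Proof.
move=> [h _ _] [T _ _] h6 hj jn; have [T0 T1] := T j jn.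
have ht : den s (Bin Plus (tag_expr q 0) (Reg 6)) = (5 * q + ~~ o)%N%:Z.
  by rewrite /= h6 addn0; lia.
rewrite (den_read_addr h ht hj) -/(table s (~~ o) j).
by case: (o); [exact: T0|exact: T1].
Qed.

Lemma safe_prefix s ie j : common s -> register s 6 = (~~ o)%:Z ->
  den s ie = j%:Z -> safe s ie -> safe s (prefix_expr q ie).
Proof.
move=> [h _ _] h6 hj sj.
have ht : den s (Bin Plus (tag_expr q 0) (Reg 6)) = (5 * q + ~~ o)%N%:Z.
  by rewrite /= h6 addn0; lia.
by apply: (safe_read_addr h ht hj).
Qed.

Lemma swept_sum_ext b p b' p' :
  (forall k, (k < n)%N -> swept z n b p k = swept z n b' p' k) ->
  \sum_(0 <= k < n | swept z n b p k) closed_cuts z n k =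
  \sum_(0 <= k < n | swept z n b' p' k) closed_cuts z n k.
Proof.
move=> h; rewrite big_nat_cond [RHS]big_nat_cond; apply: eq_bigl => k.
by case: (ltnP k n) => [/h ->|]; rewrite ?andbF.
Qed.

Lemma swept_sum_bounded b p :
  (`|(acc0 + \sum_(0 <= k < n | swept z n b p k) closed_cuts z n k)%R| <= W)%N.
Proof. exact: Wacc. Qed.

Lemma advance_spec b s : common s -> register s 7 = b%:Z -> (b < 2 * n + 2)%N ->
  sweep_state b 0 s -> sweep_tables s ->
  straight B (Defs.Seq (Assign 8 (Read (addr (tag_expr q 3) (Reg 7))))
                       (Assign 7 (Bin Plus (Reg 7) (Const 1)))) s
    (fun s' => exists2 m',
       (m' < 2 * n + 2 - b + count (fun k =>
         horizontal z k && ~~ swept z n b 0 k) (iota 0 n))%N &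
       sweep_inv m' s').
Proof.
move=> cs r7 bn [h6 h10 _ h5 hc] T; have [T01 T3 T2] := T.
have d3 := @den_table s 3 (Reg 7) b cs r7.
apply: straight_seq; apply: (straight_assign cs); first by cheap_tac.
  exact: (@safe_table s 3 (Reg 7) b cs r7 I).
rewrite d3 T3; set s1 := set_register _ _ _.
have hle := bucket_head_le z n n b.
have cs1 : common s1 by apply: common_assign => //; lia.
apply: (straight_assign cs1) => //.
have -> : den s1 (Bin Plus (Reg 7) (Const 1)) = b.+1%:Z by rewrite /= r7; lia.
set p := bucket_head z n n b.
have sw k : (k < n)%N -> swept z n b 0 k = swept z n b.+1 p k.
  by move=> kn; rewrite (swept_next z (n := n)).
have ec : count (fun k => horizontal z k && ~~ swept z n b.+1 p k) (iota 0 n) =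
    count (fun k => horizontal z k && ~~ swept z n b 0 k) (iota 0 n).
  by apply: eq_in_count => k; rewrite mem_iota add0n => /= kn; rewrite sw.
exists (2 * n + 2 - b.+1 + count (fun k =>
  horizontal z k && ~~ swept z n b.+1 p k) (iota 0 n))%N.
  by rewrite ec; lia.
exists b.+1, p; split=> //.
- by apply: common_assign => //; lia.
- split=> //.
  + case ep : p => [|j]; [by left|right; exists j].
    by have [h1 h2 h3] := bucket_head_succ ep; split=> //; rewrite h3.
  + by rewrite /= h5 (swept_sum_ext sw).
  + by move=> c; apply: column_state_ext (hc c).
Qed.

Lemma pop_spec s p : common s -> register s 7 = (key z n p).+1%:Z ->
  register s 8 = p.+1%:Z ->
  (p < n)%N -> horizontal z p -> sweep_state (key z n p).+1 p.+1 s -> sweep_tables s ->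
  straight B (Defs.Seq (Assign 2 (Bin Minus (Reg 8) (Const 1)))
    (Defs.Seq (Assign 8 (Read (addr (tag_expr q 2) (Reg 2))))
    (Defs.Seq (Assign 9 (Read (addr (tag_expr q 4) (column_expr q))))
    (If (Bin Equal (Reg 9) (Const 0))
      (Write (addr (tag_expr q 4) (column_expr q)) (Bin Plus (Reg 2) (Const 1)))
      (close_step q))))) s
    (fun s' => [/\ common s', register s' 7 = (key z n p).+1%:Z /\
       register s' 8 = (bucket_head z n p (key z n p))%:Z,
       sweep_state (key z n p).+1 (bucket_head z n p (key z n p)) s' & sweep_tables s']).
Proof.
move=> cs r7 r8 pn hp [h6 h10 _ h5 hc] T; have [T01 T3 T2] := T.
set b := (key z n p).+1; set p' := bucket_head z n p (key z n p).
have p'p : (p' <= p)%N := bucket_head_le z n p (key z n p).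
apply: straight_seq; apply: (straight_assign cs) => //.
have -> : den s (Bin Minus (Reg 8) (Const 1)) = p%:Z by rewrite /= r8; lia.
set s1 := set_register _ _ _.
have cs1 : common s1 by apply: common_assign => //; lia.
have d2 := @den_table s1 2 (Reg 2) p cs1 erefl.
apply: straight_seq; apply: (straight_assign cs1); first by cheap_tac.
  exact: (@safe_table s1 2 (Reg 2) p cs1 erefl I).
rewrite d2 [table s1 2 p]T2 // -/p'.
set s2 := set_register _ _ _.
have cs2 : common s2 by apply: common_assign => //; lia.
have [is2 _ _] := cs2.
have r2 : register s2 2 = p%:Z by [].
have dc := den_column is2 r2 pn; have sc := safe_column is2 r2 pn.
apply: straight_seq; apply: (straight_assign cs2); first by cheap_tac.
  exact: safe_table cs2 dc sc.
rewrite (den_table 4 cs2 dc).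
have -> : table s2 4 (column z n p) = table s 4 (column z n p) by [].
set v := table s 4 (column z n p).
have hv : column_state z n b p.+1 (column z n p) v by exact: hc.
set s3 := set_register _ _ _.
have cs3 : common s3 by apply: common_assign => //; exact: table_bounded.
have [is3 _ _] := cs3.
have r2' : register s3 2 = p%:Z by [].
have dc3 := den_column is3 r2' pn; have sc3 := safe_column is3 r2' pn.
have p'head : p' = 0%N \/ exists j, [/\ p' = j.+1, (j < n)%N,
  horizontal z j & (key z n j).+1 = b].
  case ep : p' => [|j]; [by left|right; exists j].
  have [h1 h2 h3] := bucket_head_succ ep; split=> //; last by rewrite h3.
  exact: ltn_trans h1 pn.
apply: (straight_test cs3) => // [h|h].
  have v0 : v = 0 := @posz_eq_neq0 v 0 h.
  have [co cc] := column_open Hz pn hp (eq_ind _ _ hv _ v0).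
  apply: (@straight_write s3 4 _ _ _ _ cs3 dc3) => //; first by cheap_tac.
  have -> : den s3 (Bin Plus (Reg 2) (Const 1)) = p.+1%:Z by rewrite /=; lia.
  split=> //.
  - by apply: common_write => //; lia.
  - split=> //.
    + by rewrite /= h5 (swept_sum_step pn hp) cc addr0.
    + move=> c; rewrite table_write //=; case: eqP => [->//|/eqP nc].
      exact: column_state_other (hc c).
  - split.
    + by move=> j jn; rewrite !table_write //=; exact: T01.
    + by move=> j; rewrite table_write //=; exact: T3.
    + by move=> j jn hj; rewrite table_write //=; exact: T2.
have nv : v <> 0 by move=> v0; move: h; rewrite /= v0.
have [i [ev iln _ _]] : exists i, [/\ v = i.+1%:Z, (i < n)%N,
    column_swept z n b p.+1 (column z n p) i &
    forall k, (k < n)%N -> column_swept z n b p.+1 (column z n p) k -> (z k).2 <= (z i).2].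
  by move: hv; rewrite /column_state; case: ifP.
have [cl _ cc] := column_close Hz pn hp (eq_ind _ _ hv _ ev).
apply: straight_seq; apply: (straight_assign cs3) => //.
have -> : den s3 (Bin Minus (Reg 9) (Const 1)) = i%:Z by rewrite /= ev; lia.
set s4 := set_register _ _ _.
have cs4 : common s4 by apply: common_assign => //; lia.
have T4 : sweep_tables s4 by [].
have dp := @den_prefix s4 (Reg 2) p cs4 T4 h6 erefl pn.
have di := @den_prefix s4 (Reg 9) i cs4 T4 h6 erefl iln.
have sp := @safe_prefix s4 (Reg 2) p cs4 h6 erefl I.
have si := @safe_prefix s4 (Reg 9) i cs4 h6 erefl I.
apply: straight_seq; apply: (straight_assign cs4); first by cheap_tac.
  by split.
have -> : den s4 (Bin Minus (prefix_expr q (Reg 2)) (prefix_expr q (Reg 9))) =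
    prefix_weight z o p - prefix_weight z o i.
  by cbn [den eval_binop]; rewrite dp di.
set d := _ - _.
have Wp := Wprefix o (ltnW pn); have Wi := Wprefix o (ltnW iln).
have dW : (`|d| <= W)%N by rewrite /d; lia.
set s5 := set_register _ _ _.
have cs5 : common s5 by apply: common_assign.
apply: straight_seq; apply: (straight_assign cs5) => //.
have -> : den s5 (Bin Times (Reg 11) (Bin Minus (Const 1)
    (Bin Times (Const 2) (Bin Less (Reg 11) (Const 0))))) = `|d|.
  by rewrite /=; case: (ltrP d 0) => hd /=; lia.
set s6 := set_register _ _ _.
have cs6 : common s6 by apply: common_assign => //; lia.
have [is6 _ _] := cs6.
have [_ dbp] := @den_coord _ _ _ is6 q (Reg 2) p erefl pn.
have [_ dbi] := @den_coord _ _ _ is6 q (Reg 9) i erefl iln.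
have [_ sbp] := @safe_coord s6 q (Reg 2) p erefl I.
have [_ sbi] := @safe_coord s6 q (Reg 9) i erefl I.
apply: straight_seq; apply: (straight_assign cs6); first by cheap_tac.
  by do !split.
set e5 := Bin Plus (Reg 5) _.
have -> : den s6 e5 = acc0 + \sum_(0 <= k < n | swept z n b p' k) closed_cuts z n k.
  rewrite (swept_sum_step pn hp) cc addrA -h5 /e5; cbn [den eval_binop].
  by rewrite dbp dbi [register s6 10]h10.
set s7 := set_register _ _ _.
have cs7 : common s7 by apply: common_assign => //; exact: swept_sum_bounded.
have [is7 _ _] := cs7.
have r7' : register s7 2 = p%:Z by [].
have dc7 := den_column is7 r7' pn; have sc7 := safe_column is7 r7' pn.
apply: (@straight_write s7 4 _ _ _ _ cs7 dc7) => //; first by cheap_tac.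
split=> //.
- exact: common_write.
- split=> //.
  move=> c; rewrite table_write //=; case: eqP => [->//|/eqP nc].
  exact: column_state_other (hc c).
- split.
  + by move=> j jn; rewrite !table_write //=; exact: T01.
  + by move=> j; rewrite table_write //=; exact: T3.
  + by move=> j jn hj; rewrite table_write //=; exact: T2.
Qed.

Lemma sweep_step_spec m s : sweep_inv m s ->
  den s sweep_cond != 0 ->
  straight B (sweep_step q) s (fun s' => exists2 m', (m' < m)%N & sweep_inv m' s').
Proof.
move=> [b [p [cs [r7 r8] [bn ->] hs T]]] hcond.
have r1 : register s 1 = n%:Z by case: cs => -[].
have {hcond}bn' : (b < 2 * n + 2)%N.
  by move: hcond; rewrite /= r7 r1; case: ltrP => //; lia.
apply: (straight_test cs) => // [h|h].
  have p0 : p = 0%N by have := @posz_eq_neq0 (register s 8) 0 h; rewrite r8 => -[].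
  by rewrite p0 in hs *; exact: advance_spec.
have [_ _ [p0|[j [ep jn hj kb]]] _ _] := hs; first by move: h; rewrite /= r8 p0.
rewrite ep -kb in hs r7 r8 *.
apply: (straight_weaken (pop_spec cs r7 r8 jn hj hs T)) => s' [c' [r7' r8'] hs' T'].
eexists; last first.
  exists (key z n j).+1, (bucket_head z n j (key z n j)); split=> //; split; last by [].
  by rewrite kb.
by rewrite ltn_add2l; exact: swept_count_step.
Qed.

Definition round_time : nat :=
  straight_cost scan_init +
  ((n * (cost scan_cond + straight_cost (scan_step q)).+1 + (cost scan_cond).+1) +
   (straight_cost sweep_init +
    ((3 * n + 2) * (cost sweep_cond + straight_cost (sweep_step q)).+1 + (cost
      sweep_cond).+1))).

Lemma sweep_end m s : sweep_inv m s -> den s sweep_cond = 0 ->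
  common s /\ register s 5 = acc0 + cut_sum z n o.
Proof.
move=> [b [p [cs [r7 r8] [bn _] [_ _ hp h5 _] _]]] hcond.
have r1 : register s 1 = n%:Z by case: cs => -[].
have eb : b = (2 * n + 2)%N by move: hcond; rewrite /= r7 r1; case: ltrP => //; lia.
have p0 : p = 0%N.
  by case: hp => // -[j [_ jn _ kb]]; have := key_le Hz jn; lia.
by split=> //; rewrite h5 eb p0 closed_cuts_sum.
Qed.

Lemma round_spec s : input_state z0 n s -> bounded_state W s ->
  (forall t i, (5 * q <= t)%N -> (t < 15)%N -> memory s (cell n t i) = 0) ->
  register s 5 = acc0 ->
  runs B (round q) s round_time
    (fun s' => common s' /\ register s' 5 = acc0 + cut_sum z n o).
Proof.
move=> is0 bs fs r5.
have cs : common s by split=> // t i h; apply: fs; lia.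
have T0 t i : (t < 5)%N -> table s t i = 0 by move=> t5; apply: fs; lia.
apply: runs_seq; apply: (@runs_weaken _ _ _ (straight_cost scan_init) _ (scan_inv 0)) =>
  // [s1 h1|]; last first.
  apply: straight_seq; apply: (straight_assign cs) => //.
  set s1 := set_register _ _ _; have cs1 : common s1 by exact: common_assign.
  apply: straight_seq; apply: (straight_assign cs1) => //.
  set s2 := set_register _ _ _; have cs2 : common s2 by exact: common_assign.
  apply: (straight_assign cs2) => //.
  split=> //; first exact: common_assign.
    by rewrite /prefix_weight !big_geq.
  by split=> // [b|i]; exact: T0.
apply: runs_seq.
have loop1 m s2 : (exists k, [/\ m = (n - k)%N, (k <= n)%N & scan_inv k s2]) ->
   fits s2 scan_cond /\ (den s2 scan_cond = 0 -> scan_inv n s2) /\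
   (den s2 scan_cond != 0 -> runs B (scan_step q) s2 (straight_cost (scan_step q))
     (fun s' => exists2 m', (m' < m)%N & exists k, [/\ m' = (n - k)%N,
       (k <= n)%N & scan_inv k s'])).
  move=> [k [-> kn hk]]; have [cs2 _ r2 _ _] := hk; have [[r1 _] b2 _] := cs2.
  have dcond : den s2 scan_cond = (k < n)%N%:Z by rewrite /= r2 r1; case: ltnP => h; lia.
  split; first by exact: fits_cheap.
  rewrite dcond; split=> [h|h].
    by have <- : k = n by move: h; case: ltnP => //; lia.
  have kn' : (k < n)%N by move: h; case: ltnP.
  apply: (straight_weaken (scan_step_spec kn' hk)) => s' hs'.
  by exists (n - k.+1)%N; [lia|exists k.+1].
apply: (@runs_weaken _ _ _ (n * (cost scan_cond + straight_cost (scan_step q)).+1 + (cost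
  scan_cond).+1) _ (scan_inv n)) => // [s2 h2|]; last first.
  by apply: (runs_while W15 WB loop1); exists 0%N; rewrite subn0.
have [cs2 r52 _ [r3 r4] [U01 U3 U2 U4]] := h2.
apply: runs_seq.
have [V HV] := inner_fset Hz.
have pos := prefix_weight_gt0 Hz HV; have neg := prefix_weight_le0 Hz HV.
have eo : (0 < prefix_weight z true n) = o.
  by move: pos neg; rewrite -/o; case: (o) => /= g1 g2; [rewrite g1|rewrite ltNge g2].
have WN b := Wprefix b (leqnn n).
apply: (@straight_weaken _ _ _ (sweep_inv (2 * n + 2 +
    count (fun k => horizontal z k && ~~ swept z n 0 0 k) (iota 0 n)))) => [|s7 h7].
  apply: straight_seq; apply: (straight_assign cs2) => //.
  have -> : den s2 (Bin Minus (Const 1) (Bin Less (Const 0) (Reg 3))) = (~~ o)%:Z.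
    by rewrite /= r3 eo; case: (o).
  set s3 := set_register _ _ _; have cs3 : common s3.
    by apply: common_assign => //; case: (o) => /=; lia.
  apply: straight_seq; apply: (straight_assign cs3) => //.
  have -> : den s3 (Bin Plus (Bin Times (Reg 3) (Bin Minus (Const 1) (Reg 6)))
      (Bin Times (Reg 4) (Reg 6))) = prefix_weight z o n.
    by rewrite /= r3 r4; case: (o) => /=; ring.
  set s4 := set_register _ _ _; have cs4 : common s4.
    by apply: common_assign => //; have := WN o; lia.
  apply: straight_seq; apply: (straight_assign cs4) => //.
  set s5 := set_register _ _ _; have cs5 : common s5 by exact: common_assign.
  apply: (straight_assign cs5) => //.
  exists 0%N, 0%N; split=> //.
  - exact: common_assign.
  - by rewrite subn0.
  - split=> //; first by left.
      rewrite /= r52 big1_seq ?addr0 // => k /andP[]; by rewrite swept0.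
    move=> c; rewrite /column_state big1_seq => [|k _];
      last by rewrite /column_swept swept0.
    exact: U4.
have cnt : (count (fun k => horizontal z k && ~~ swept z n 0 0 k) (iota 0 n) <= n)%N.
  by rewrite -[leqRHS](size_iota 0 n) count_size.
have loop2 m s6 : sweep_inv m s6 ->
   fits s6 sweep_cond /\
   (den s6 sweep_cond = 0 -> common s6 /\ register s6 5 = acc0 + cut_sum z n o) /\
   (den s6 sweep_cond != 0 -> runs B (sweep_step q) s6 (straight_cost (sweep_step q))
     (fun s' => exists2 m', (m' < m)%N & sweep_inv m' s')).
  move=> h6; split; last by split=> [|h]; [exact: sweep_end h6|exact: sweep_step_spec].
  by case: h6 => b [p [[_ b6 _] _ _ _ _]]; exact: fits_cheap.
apply: (runs_weaken _ _ (runs_while W15 WB loop2 h7)) => //.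
by rewrite leq_add2r leq_mul2r; apply/orP; right; lia.
Qed.

End Round.

(** * Words and time *)

Lemma norm_sum_le (n : nat) (P : pred nat) (F : nat -> int) (D : int) : 0 <= D ->
  (forall k, (k < n)%N -> `|F k| <= D) ->
  `|\sum_(0 <= k < n | P k) F k| <= n%:Z * D.
Proof.
move=> D0 h; apply: le_trans (ler_norm_sum _ _ _) _.
apply: (@le_trans _ _ (\sum_(0 <= k < n) D)); last first.
  by rewrite big_const_nat iter_addr_0 subn0 -mulr_natl natz.
rewrite big_mkcond /= big_nat_cond [leRHS]big_nat_cond.
apply: ler_sum => k /andP[/= kn _]; case: ifP => // _; exact: h.
Qed.

Section Bounds.
Variables (z : nat -> hex_point) (n M : nat).
Hypothesis Hz : lattice_cycle z n.
Hypotheses (M6 : (6 <= M)%N) (nM : (n <= M)%N)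
  (zM : forall k, `|(z k).1| <= 2 * M%:Z /\ `|(z k).2| <= 2 * M%:Z).

Lemma norm_exit_weight k : `|exit_weight z k| <= 9 * M%:Z.
Proof.
have a := cycle_adj Hz k; have a' := cycle_adj Hz k.+1.
have h : `|2 * (z k.+1).2 - (z k).2 - (z k.+2).2| <= 2.
  by adj_cases a'; adj_cases a => /= _ _; lia.
have [_ hz] := zM k.+1.
suff gen (s b : int) : `|s| <= 2 -> `|b| <= 2 * M%:Z ->
    `|s * b + (s == 1)%:Z| <= 9 * M%:Z by exact: gen.
move=> hs hb; have : `|s * b| <= 2 * (2 * M%:Z) by rewrite normrM ler_pM.
by case: (s == 1) => /=; lia.
Qed.

Lemma norm_prefix_weight b k : (k <= n)%N -> `|prefix_weight z b k| <= 9 * M%:Z ^+ 2.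
Proof.
move=> kn; have h j : `|(spoke_out b (z j) (z j.+1) (z j.+2))%:Z * exit_weight z j| <= 9
  * M%:Z.
  by have := norm_exit_weight j; case: (spoke_out _ _ _ _);
    rewrite ?mul1r ?mul0r ?normr0 //; lia.
apply: le_trans (@norm_sum_le k xpredT _ (9 * M%:Z) _ (fun j _ => h j)) _; first by lia.
by rewrite expr2 mulrCA ler_pM2l // ler_wpM2r //; lia.
Qed.

(** Heights are at most 2 M in absolute value, so a cut has at most 4 M + 1 edges; prefix sums are
    at most 9 M^2, so m is at most 18 M^2 and N - m at most 27 M^2. *)
Lemma norm_cut_term o i k : (i < n)%N -> (k < n)%N ->
  `|cut_term z n o i k| <= 5 * M%:Z * (18 * M%:Z ^+ 2 * (27 * M%:Z ^+ 2)).
Proof.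
move=> ln kn; rewrite /cut_term.
have hN := norm_prefix_weight o (leqnn n); have hk := norm_prefix_weight o (ltnW kn).
have hi := norm_prefix_weight o (ltnW ln).
have [_ zk] := zM k; have [_ zi] := zM i.
rewrite normrM ler_pM ?normr_ge0 //.
  have := absz_divz ((z k).2 - (z i).2) 2; lia.
rewrite normrM ler_pM ?normr_ge0 //; first by rewrite normr_id; lia.
by lia.
Qed.

Lemma norm_closed_cuts k : (k < n)%N ->
  `|closed_cuts z n k| <= M%:Z * (5 * M%:Z * (18 * M%:Z ^+ 2 * (27 * M%:Z ^+ 2))).
Proof.
move=> kn; set D := 5 * _ * _; have D0 : 0 <= D by rewrite /D; do !apply: mulr_ge0;
  rewrite ?exprn_ge0.
apply: le_trans (@norm_sum_le n xpredT _ D D0 _) _ => [i ln|].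
  have := @norm_cut_term (inside z n (lhex (z 0) (z 1))) i k ln kn.
  by case: (matched z n i k); rewrite ?mul1r ?mul0r ?normr0.
by rewrite ler_wpM2r.
Qed.

(** The factors multiply to 2430 n M^6, and 2430 is less than 6^5, hence than M^5. *)
Lemma norm_closed_cuts_sum P :
  `|\sum_(0 <= k < n | P k) closed_cuts z n k| <= M%:Z ^+ 12.
Proof.
apply: le_trans (norm_sum_le P _ norm_closed_cuts) _.
  by do !apply: mulr_ge0; rewrite ?exprn_ge0.
have hM : 6 <= M%:Z by lia.
have h2 : 36 <= M%:Z ^+ 2 by rewrite expr2; move: hM; move: (M%:Z); clear; nia.
have h5 : 2430 <= M%:Z ^+ 5.
  rewrite [_ ^+ 5](_ : _ = M%:Z ^+ 2 * M%:Z ^+ 2 * M%:Z); last by ring.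
  by move: hM h2; move: (M%:Z) (M%:Z ^+ 2); clear; nia.
have h6 : 0 <= M%:Z ^+ 6 by rewrite exprn_ge0.
have hn : n%:Z <= M%:Z by lia.
have -> : n%:Z * (M%:Z * (5 * M%:Z * (18 * M%:Z ^+ 2 * (27 * M%:Z ^+ 2)))) =
  n%:Z * M%:Z ^+ 6 * 2430 by ring.
have -> : M%:Z ^+ 12 = M%:Z * M%:Z ^+ 6 * M%:Z ^+ 5 by ring.
apply: ler_pM; [exact: mulr_ge0|by []|exact: ler_wpM2r|exact: h5].
Qed.

Lemma norm_cut_sum : `|cut_sum z n (orientation z n)| <= M%:Z ^+ 12.
Proof. by rewrite -(closed_cuts_sum Hz); exact: norm_closed_cuts_sum. Qed.

End Bounds.

Lemma encode_cycle_nth (Z : seq hex_point) j : (j < size Z)%N ->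
  nth (Posz 0) (encode_cycle Z) (2 * j) = (nth (0, 0) Z j).1 /\
  nth (Posz 0) (encode_cycle Z) (2 * j + 1) = (nth (0, 0) Z j).2.
Proof.
elim: Z j => // u Z IH [|j] jn; first by [].
by have [<- <-] := IH j jn; rewrite mulnS.
Qed.

Lemma size_encode_cycle (Z : seq hex_point) : size (encode_cycle Z) = (2 * size Z)%N.
Proof. by elim: Z => //= u Z; rewrite /encode_cycle /= => ->; rewrite mulnS. Qed.

Lemma magnitude_bounds (xs : seq int) : (size xs <= magnitude xs)%N /\
  forall i, (`|nth (Posz 0) xs i| <= magnitude xs)%N.
Proof.
split=> [|i]; first exact: leq_addr.
have [h|h] := ltnP i (size xs); last by rewrite nth_default.
by apply: leq_trans (leq_addl _ _); apply: leq_bigmax_seq; rewrite ?mem_nth.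
Qed.

Definition szeged_program : cmd :=
  Defs.Seq (Assign 1 (Bin Quot (Reg 0) (Const 2)))
  (Defs.Seq (round 0) (Defs.Seq (round 1) (Defs.Seq (round 2) (Assign 0 (Reg 5))))).

Definition szeged_time (n : nat) : nat :=
  4 + (round_time n 0 + (round_time n 1 + (round_time n 2 + 2))).

(** The time of each round is affine in n with nonnegative coefficients. *)
Lemma szeged_time_linear n : (0 < n)%N -> (szeged_time n <= 5 * szeged_time 1 * n)%N.
Proof.
move=> n0.
have h q : (round_time n q <= 5 * round_time 1 q * n)%N.
  rewrite /round_time.
  move: (straight_cost scan_init) (cost scan_cond) (straight_cost (scan_step q))
    (straight_cost sweep_init) (cost sweep_cond) (straight_cost (sweep_step q)).
  move=> a b c d e f; nia.
have := h 0%N; have := h 1%N; have := h 2%N; rewrite /szeged_time; nia.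
Qed.

Lemma rotated_cycle q z n : lattice_cycle z n -> lattice_cycle (rotated q z) n.
Proof.
by case: q => [|[|q]] // h; [exact: lattice_cycle_rot|do 2!apply: lattice_cycle_rot].
Qed.

Lemma rotated_bounded q z (M : int) : (forall k, `|(z k).1| <= M /\ `|(z k).2| <= M) ->
  forall k, `|(rotated q z k).1| <= 2 * M /\ `|(rotated q z k).2| <= 2 * M.
Proof. by move=> h k; have := h k; case: q => [|[|q]]; rewrite /rotated /rotate /=;
  lia. Qed.

Theorem theorem3p4 (R : realType) :
  computable_in_time hex_cycle encode_cycle
    (fun Z => Posz (Szeged (benzenoid R Z)))
    (fun Z => size Z).
Proof.
(* With W = M^14 there is room for the three sums, each at most M^12, that accumulate in register 5;
   the exponent 1000 is the bound on the cost of expressions, whose values stay below W^1000. *)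
exists szeged_program, (5 * szeged_time 1)%N, (14 * 1000)%N => Z HZ.
have Hz := hex_cycle_lattice HZ.
rewrite (benzenoid_inner R HZ) (szeged_cut_sum Hz).
set z := cycle_nth Z in Hz *; set n := size Z in Hz *.
set xs := encode_cycle Z; set M := magnitude xs.
have [Mn Mx] := magnitude_bounds xs; rewrite -/M size_encode_cycle -/n in Mn Mx.
have n2 := cycle_gt2 Hz; have M6 : (6 <= M)%N by lia.
have nM : (n <= M)%N by lia.
rewrite expnM; have [W eW] : exists W, W = (M ^ 14)%N by exists (M ^ 14)%N.
have [B eB] : exists B, B = (W ^ 1000)%N by exists (W ^ 1000)%N.
rewrite -eW -eB.
have MW : (M <= W)%N by rewrite eW -[leqLHS]expn1 leq_exp2l //; lia.
have M2W : (M ^ 2 <= W)%N by rewrite eW leq_exp2l //; lia.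
have M4W : (M ^ 4 <= W)%N by rewrite eW leq_exp2l //; lia.
have W15 : (15 <= W)%N by rewrite (leq_trans _ M2W) // (@leq_trans (6 ^ 2)) // leq_exp2r.
have [K K1 WB] : exists2 K, (1000 <= K)%N & (W ^ K <= B)%N by exists 1000%N; rewrite ?eB.
clear eB.
have zM k : `|(z k).1| <= M%:Z /\ `|(z k).2| <= M%:Z.
  have kn : (k %% n < n)%N by rewrite ltn_pmod; lia.
  have [h1 h2] := encode_cycle_nth kn; rewrite /z /cycle_nth -h1 -h2.
  by have := Mx (2 * (k %% n))%N; have := Mx (2 * (k %% n) + 1)%N; rewrite -!lez_nat !abszE.
pose stage q acc s := [/\ input_state z n s, bounded_state W s,
  forall t i, (5 * q <= t)%N -> (t < 15)%N -> memory s (cell n t i) = 0 &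
  register s 5 = acc].
have M0 : 0 <= M%:Z ^+ 12 by rewrite exprn_ge0.
have W14 : W%:Z = M%:Z ^+ 14 by rewrite eW -natz natrX natz.
clear eW.
have step q acc s : (q < 3)%N -> `|acc| <= q%:Z * M%:Z ^+ 12 -> stage q acc s ->
    runs B (round q) s (round_time n q)
      (stage q.+1 (acc + cut_sum (rotated q z) n (orientation (rotated q z) n))).
  move=> q3 hacc [h1 h2 h3 h5].
  have Hzq := rotated_cycle q Hz; have zqM := rotated_bounded q zM.
  have Wn : (4 * n + 4 <= W)%N.
    by apply: leq_trans M2W; rewrite -mulnn; move: nM M6; clear; nia.
  have Wp b k : (k <= n)%N -> (3 * `|prefix_weight (rotated q z) b k| <= W)%N.
    move=> kn; apply: leq_trans M4W; rewrite -lez_nat.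
    have h := norm_prefix_weight Hzq M6 nM zqM b kn.
    have -> : (M ^ 4)%N%:Z = M%:Z ^+ 2 * M%:Z ^+ 2 by rewrite -natz natrX natz -exprD.
    have h36 : 36 <= M%:Z ^+ 2 by rewrite (@le_trans _ _ (6 ^+ 2)) // lerXn2r ?nnegrE //;
      lia.
    move: (prefix_weight _ _ _) (M%:Z ^+ 2) h h36 => p X h h36; rewrite PoszM; nia.
  have Wa P : (`|(acc + \sum_(0 <= k < n | P k) closed_cuts (rotated q z) n k)%R| <= W)%N.
    rewrite -lez_nat W14; have := norm_closed_cuts_sum Hzq M6 nM zqM P.
    move: (\sum_(_ <= _ < _ | _) _) => S hS.
    have -> : M%:Z ^+ 14 = M%:Z ^+ 2 * M%:Z ^+ 12 by rewrite -exprD.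
    have h36 : 36 <= M%:Z ^+ 2 by rewrite (@le_trans _ _ (6 ^+ 2)) // lerXn2r ?nnegrE //;
      lia.
    move: (M%:Z ^+ 2) (M%:Z ^+ 12) M0 hacc hS h36 => X Y Y0 hacc hS h36.
    have : q%:Z * Y <= 2 * Y by rewrite ler_wpM2r //; lia.
    have : 36 * Y <= X * Y by rewrite ler_wpM2r.
    by lia.
  have := round_spec q3 Hzq W15 WB K1 Wn Wp Wa h1 h2 h3 h5.
  apply: runs_weaken => // s' [[g1 g2 g3] g5]; split=> // t i ht; apply: g3.
  by rewrite -mulnSr in ht *; lia.
have next q acc : `|acc| <= q%:Z * M%:Z ^+ 12 ->
    `|acc + cut_sum (rotated q z) n (orientation (rotated q z) n)| <= q.+1%:Z * M%:Z ^+ 12.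
  move=> hacc; have := norm_cut_sum (rotated_cycle q Hz) M6 nM (rotated_bounded q zM).
  move: (cut_sum _ _ _) (M%:Z ^+ 12) hacc => S X hacc hS.
  by rewrite intS mulrDl mul1r; lia.
have b0 : bounded_state W (init xs).
  split=> r /=.
    case: eqP => _; last by rewrite absz0.
    by rewrite size_encode_cycle; exact: leq_trans Mn MW.
  exact: leq_trans (Mx r) MW.
suff [t [s [h1 h2 h3]]] : runs B szeged_program (init xs) (szeged_time n) (fun s =>
  register s 0 =
    0 + cut_sum (rotated 0 z) n (orientation (rotated 0 z) n)
      + cut_sum (rotated 1 z) n (orientation (rotated 1 z) n)
      + cut_sum (rotated 2 z) n (orientation (rotated 2 z) n)).
  exists t, s; split=> //; last by rewrite h3 add0r.
  by apply: leq_trans h2 _; apply: szeged_time_linear; lia.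
have cheap_fits s e : bounded_state W s -> cheap e -> safe s e -> fits W K s e.
  by move=> h /andP[c1 c2] c3; split=> //; exact: leq_trans K1.
apply: runs_seq; apply: (runs_assign W15 WB); first exact: cheap_fits.
have -> : den (init xs) (Bin Quot (Reg 0) (Const 2)) = n%:Z.
  by rewrite /= size_encode_cycle -/n PoszM mulrC mulzK.
set s0 := set_register _ _ _.
have st0 : stage 0%N 0 s0.
  split=> //.
  - split=> // j jn; have [h1 h2] := encode_cycle_nth jn.
    by rewrite /z /cycle_nth modn_small.
  - by apply: bounded_set_register => //; rewrite (leq_trans nM).
  - move=> t i _ _ /=; rewrite nth_default // size_encode_cycle /cell; exact: leq_addr.
have a0 : `|0 : int| <= 0%:Z * M%:Z ^+ 12 by rewrite mul0r normr0.
apply: runs_seq; apply: runs_weaken (step 0%N _ _ isT a0 st0) => // s1 st1.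
have a1 := next _ _ a0.
apply: runs_seq; apply: runs_weaken (step 1%N _ _ isT a1 st1) => // s2 st2.
have a2 := next _ _ a1.
apply: runs_seq; apply: runs_weaken (step 2%N _ _ isT a2 st2) => // s3 [_ b3 _ h5].
by apply: (runs_assign W15 WB); [exact: cheap_fits|exact: h5].
Qed.
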